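(* Let $1 \le p < t < r < \infty$ or $1 \le p \le t < r = \infty$. Let $W:\mathbb{R}^n\to M_n(\mathbb{C})$ be a matrix weight. A subset $\mathcal{F}\subset\mathcal{W}^{1,p,t,r}(W)$ is totally bounded if the following conditions are valid: (i) $\mathcal{F}$ uniformly vanishes at infinity, that is, $$\lim_{R\to\infty}\ \sup_{f\in\mathcal{F}}\|f\chi_{B^c(0,R)}\|_{\mathcal{W}^{1,p,t,r}(W)}=0;$$ (ii) $\mathcal{F}$ is equicontinuous, that is, $$\lim_{a\to0}\ \sup_{f\in\mathcal{F}}\ \sup_{y\in B(0,a)}\|f-\tau_yf\|_{\mathcal{W}^{1,p,t,r}(W)}=0,$$ where $\tau_y$ denotes the translation operator, $\tau_yf(x):=f(x-y)$.
   Context: $M_n(\mathbb{C})$ is the set of $n\times n$ complex matrices, and $\|A\|=\sup_{|\vec z|=1}|A\vec z|$ is the operator norm with respect to the Euclidean norm $|\cdot|$ on $\mathbb{C}^n$. A matrix weight is a function $W:\mathbb{R}^n\to M_n(\mathbb{C})$ such that $W(x)$ is nonnegative definite for every $x$, $W(x)$ is invertible for almost every $x$, and the entries of $W$ are locally integrable. Powers $W^\alpha(x)$ are defined (for a.e. $x$) by diagonalization: if $W(x)=U\,\mathrm{diag}(\lambda_1,\dots,\lambda_n)U^*$ with $U$ unitary, then $W^\alpha(x)=U\,\mathrm{diag}(\lambda_1^\alpha,\dots,\lambda_n^\alpha)U^*$. Set the scalar weight $\omega:=\|W\|$. For $j\in\mathbb{Z}$, $k\in\mathbb{Z}^n$,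 $Q_{j,k}=\prod_{i=1}^n[2^{-j}k_i,2^{-j}(k_i+1))$ are the dyadic cubes. For a cube $Q$, $W(Q):=\int_Q\|W(y)\|\,dy$ and $\omega(Q):=\int_Q\omega(y)\,dy$. For measurable $\vec f:\mathbb{R}^n\to\mathbb{C}^n$, $$\|\vec f\|_{M_p^{t,r}(W)}:=\left\|\left\{W(Q_{j,k})^{1/t-1/p}\left(\int_{Q_{j,k}}|W^{1/p}(y)\vec f(y)|^p\,dy\right)^{1/p}\right\}_{j\in\mathbb{Z},k\in\mathbb{Z}^n}\right\|_{\ell^r},$$ and for measurable scalar $f$, $$\|f\|_{M_p^{t,r}(\omega)}:=\left\|\left\{\omega(Q_{j,k})^{1/t-1/p}\left(\int_{Q_{j,k}}|f(y)|^p\omega(y)\,dy\right)^{1/p}\right\}_{j\in\mathbb{Z},k\in\mathbb{Z}^n}\right\|_{\ell^r}.$$ The degenerate Bourgain-Morrey-Sobolev space $\mathcal{W}^{1,p,t,r}(W)$ is the set of all Lebesgue measurable functions $f$ on $\mathbb{R}^n$ such that $$\|f\|_{\mathcal{W}^{1,p,t,r}(W)}:=\|f\|_{M_p^{t,r}(\omega)}+\|\nabla f\|_{M_p^{t,r}(W)}<\infty,$$ where $\nabla f=(\partial_{x_1}f,\dots,\partial_{x_n}f)^T$ is the gradient of $f$. $B(0,R)$ is the ball of center $0$ and radius $R$, $B^c(0,R)$ its complement, and $\chi_E$ the characteristic function of $E$. A set $A$ in a metric space $(X,\rho)$ is totally bounded if for each $\epsilon>0$ it has a finite $\epsilon$-net,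 i.e. a finite set $E\subset X$ such that every $a\in A$ satisfies $\rho(a,e)<\epsilon$ for some $e\in E$; here the metric is the one induced by $\|\cdot\|_{\mathcal{W}^{1,p,t,r}(W)}$. *)

(* Defs.v *)
From HB Require Import structures.
From mathcomp Require Import all_boot all_order all_algebra.
From mathcomp Require Import all_classical all_reals all_analysis.
From mathcomp Require Import measurable_realfun.
From mathcomp Require Import complex.

Set Implicit Arguments.
Unset Strict Implicit.
Unset Printing Implicit Defensive.

Import Order.TTheory GRing.Theory Num.Theory.
Import numFieldNormedType.Exports.

Local Open Scope classical_set_scope.
Local Open Scope ring_scope.

(* ['rV[R]_n] carries the product sigma-algebra of the coordinates, i.e. the Borel
   one, and [lebesgue_rV] is the n-fold product of the Lebesgue measure of R. *)

Definition rV_display : measure_display.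
Proof. exact: default_measure_display. Qed.

Section rV_measurable.
Context (R : realType) (n : nat).

Definition rV_coord (i : 'I_n) (x : 'rV[R]_n) : measurableTypeR R := x ord0 i.

Let rV_set0 : g_sigma_preimage rV_coord set0.
Proof. exact: sigma_algebra0. Qed.

Let rV_setC A : g_sigma_preimage rV_coord A -> g_sigma_preimage rV_coord (~` A).
Proof. exact: sigma_algebraC. Qed.

Let rV_bigcup (F : _^nat) : (forall i, g_sigma_preimage rV_coord (F i)) ->
  g_sigma_preimage rV_coord (\bigcup_i (F i)).
Proof. exact: sigma_algebra_bigcup. Qed.

HB.instance Definition _ := @isMeasurable.Build rV_display 'rV[R]_n
  (g_sigma_preimage rV_coord) rV_set0 rV_setC rV_bigcup.

Lemma measurable_rV_coord i : measurable_fun setT (rV_coord i).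
Proof.
move=> _ B mB; rewrite setTI; apply: sub_sigma_algebra => /=.
rewrite -bigcup_seq/=; exists i => /=; first by rewrite mem_index_enum.
by exists B => //; rewrite setTI.
Qed.

Lemma measurable_fun_rVP d (T : measurableType d) (f : T -> 'rV[R]_n) :
  measurable_fun setT f <-> forall i, measurable_fun setT (rV_coord i \o f).
Proof.
split=> [mf i|mf].
  by apply: measurableT_comp => //; exact: measurable_rV_coord.
apply: (@measurability _ _ _ _ setT f
  (\big[setU/set0]_(i < n) preimage_set_system setT (rV_coord i) measurable)) => //.
move=> _ [C + <-]; rewrite -bigcup_seq => -[i _ [B mB <-]].
by rewrite setTI; exact: mf.
Qed.
End rV_measurable.

Section lebesgue_step.
Context (R : realType) (n : nat).
Local Open Scope ereal_scope.

Definition rV_cons (p : measurableTypeR R * 'rV[R]_n) : 'rV[R]_n.+1 :=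
  \row_i (if unlift ord0 i is Some j then p.2 ord0 j else p.1).

Definition rV_uncons (v : 'rV[R]_n.+1) : measurableTypeR R * 'rV[R]_n :=
  (v ord0 ord0, \row_j v ord0 (lift ord0 j)).

Lemma rV_consE0 p : rV_cons p ord0 ord0 = p.1.
Proof. by rewrite mxE unlift_none. Qed.

Lemma rV_consES p j : rV_cons p ord0 (lift ord0 j) = p.2 ord0 j.
Proof. by rewrite mxE liftK. Qed.

Lemma rV_unconsK : cancel rV_uncons rV_cons.
Proof.
move=> v; apply/rowP => i; case: (unliftP ord0 i) => [j|] ->.
  by rewrite rV_consES mxE.
by rewrite rV_consE0.
Qed.

Lemma rV_consK : cancel rV_cons rV_uncons.
Proof.
move=> [x v]; rewrite /rV_uncons rV_consE0; congr pair.
by apply/rowP => j; rewrite mxE rV_consES.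
Qed.

Lemma measurable_rV_cons : measurable_fun setT rV_cons.
Proof.
apply/measurable_fun_rVP => i; case: (unliftP ord0 i) => [j|] ->.
  rewrite (_ : _ \o _ = rV_coord j \o snd).
    by apply: measurableT_comp => //; exact: measurable_rV_coord.
  by apply/funext => p /=; exact: rV_consES.
rewrite (_ : _ \o _ = fst); first exact: measurable_fst.
by apply/funext => p /=; exact: rV_consE0.
Qed.

Lemma measurable_rV_uncons : measurable_fun setT rV_uncons.
Proof.
apply: measurable_fun_pair; first exact: (measurable_rV_coord ord0).
apply/measurable_fun_rVP => i.
rewrite (_ : _ \o _ = rV_coord (lift ord0 i)); first exact: measurable_rV_coord.
by apply/funext => v; rewrite /= /rV_coord mxE.
Qed.

Variable mu : {sigma_finite_measure set 'rV[R]_n -> \bar R}.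

Definition lebesgue_step : set 'rV[R]_n.+1 -> \bar R :=
  pushforward (lebesgue_measure \x mu) rV_cons.


Let lebesgue_step0 : lebesgue_step set0 = 0.
Proof. by rewrite /lebesgue_step /pushforward preimage_set0 measure0. Qed.

Let lebesgue_step_ge0 A : 0 <= lebesgue_step A.
Proof. exact: (measure_ge0 (lebesgue_measure \x mu)). Qed.

Let lebesgue_step_sigma_additive : semi_sigma_additive lebesgue_step.
Proof.
move=> F mF tF mUF; rewrite /lebesgue_step /pushforward preimage_bigcup.
have mp A : measurable A -> measurable (rV_cons @^-1` A).
  by move=> mA; rewrite -[X in measurable X]setTI; exact: measurable_rV_cons.
apply: measure_semi_sigma_additive.
- by move=> k; exact: mp.
- apply/trivIsetP => /= i j _ _ ij; rewrite -preimage_setI.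
  by move/trivIsetP : tF => /(_ _ _ _ _ ij) ->//; rewrite preimage_set0.
- by rewrite -preimage_bigcup; exact: mp.
Qed.

HB.instance Definition _ := isMeasure.Build _ _ _ lebesgue_step
  lebesgue_step0 lebesgue_step_ge0 lebesgue_step_sigma_additive.

Let lebesgue_step_sigma_finite : sigma_finite setT lebesgue_step.
Proof.
have /sigma_finiteP[F [TF ndF Foo]] := sigma_finiteT (@lebesgue_measure R).
have /sigma_finiteP[G [TG ndG Goo]] := sigma_finiteT mu.
exists (fun k => rV_uncons @^-1` (F k `*` G k)).
  rewrite -preimage_bigcup predeqE => v; split=> // _.
  have [i _ Fi] : (\bigcup_k F k) (v ord0 ord0) by rewrite -TF.
  have [j _ Gj] : (\bigcup_k G k) (rV_uncons v).2 by rewrite -TG.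
  exists (maxn i j) => //; split.
    by apply: (subsetPset _ _ (ndF _ _ (leq_maxl i j))) Fi.
  by apply: (subsetPset _ _ (ndG _ _ (leq_maxr i j))) Gj.
move=> k; have [mF Fk] := Foo k; have [mG Gk] := Goo k; split.
  by rewrite -[X in measurable X]setTI; apply: measurable_rV_uncons => //;
    exact: measurableX.
rewrite /lebesgue_step /pushforward -comp_preimage (_ : _ \o _ = id).
  by rewrite preimage_id product_measure1E// lte_mul_pinfty// ge0_fin_numE.
by apply/funext => p /=; exact: rV_consK.
Qed.

HB.instance Definition _ :=
  Measure_isSigmaFinite.Build _ _ _ lebesgue_step lebesgue_step_sigma_finite.
End lebesgue_step.

Section lebesgue_rV.
Context (R : realType).
Local Open Scope ereal_scope.

Definition lebesgue_rV0 : set 'rV[R]_0 -> \bar R := \d_(0%R : 'rV[R]_0).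

HB.instance Definition _ := Measure.on lebesgue_rV0.

Let lebesgue_rV0_sigma_finite : sigma_finite setT lebesgue_rV0.
Proof.
exists (fun=> setT); first by rewrite bigcup_const.
by move=> _; split=> //; rewrite /lebesgue_rV0 diracE ltry.
Qed.

HB.instance Definition _ :=
  Measure_isSigmaFinite.Build _ _ _ lebesgue_rV0 lebesgue_rV0_sigma_finite.

Fixpoint lebesgue_rV (n : nat) : {sigma_finite_measure set 'rV[R]_n -> \bar R} :=
  match n with
  | 0 => lebesgue_rV0
  | m.+1 => lebesgue_step (lebesgue_rV m)
  end.

Lemma lebesgue_rV_box n (a b : 'I_n -> R) : (forall i, a i <= b i)%R ->
  lebesgue_rV n [set x : 'rV[R]_n | forall i, (a i <= x ord0 i < b i)%R] =
  (\prod_i (b i - a i))%R%:E.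
Proof.
elim: n a b => [|n IHn] a b ab.
  rewrite big_ord0 /= /lebesgue_rV0 diracE.
  by rewrite mem_set// => -[].
pose B := [set v : 'rV[R]_n | forall j,
  (a (lift ord0 j) <= v ord0 j < b (lift ord0 j))%R].
have -> : lebesgue_rV n.+1
    [set x : 'rV[R]_n.+1 | forall i, (a i <= x ord0 i < b i)%R] =
    (lebesgue_measure \x lebesgue_rV n)
      ([set` `[a ord0, b ord0[%R] `*` B).
  rewrite /= /lebesgue_step /pushforward; congr product_measure1.
  apply/seteqP; split => [p /= h|p /= [h0 h1] i].
    split; first by have := h ord0; rewrite rV_consE0 in_itv.
    by move=> j; rewrite -rV_consES.
  case: (unliftP ord0 i) => [j|] ->; first by rewrite rV_consES.
  by rewrite rV_consE0; rewrite in_itv in h0.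
rewrite product_measure1E//.
  rewrite IHn// big_ord_recl EFinM; congr *%E.
  transitivity (@lebesgue_measure R [set` `[a ord0, b ord0[%R]) => //.
  rewrite lebesgue_measure_itv/= lte_fin.
  by have := ab ord0; rewrite le_eqVlt => /predU1P[->|->]; rewrite ?ltxx ?subrr.
rewrite (_ : B = \bigcap_(j in [set: 'I_n])
    (rV_coord j @^-1` [set` `[a (lift ord0 j), b (lift ord0 j)[%R])).
  apply: fin_bigcap_measurable => // j _.
  by rewrite -[X in measurable X]setTI; exact: measurable_rV_coord.
apply/seteqP; split => [v Bv j _|v Bv j]; first by rewrite /= in_itv; exact: Bv.
by have := Bv j I; rewrite /= in_itv.
Qed.
End lebesgue_rV.

Section lebesgue_functions.
Context (R : realType) (n : nat).
Local Notation mu := (@lebesgue_rV R n).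

(* Lebesgue measurability refers to the completed Borel sigma-algebra.  The
   library integral with respect to the Borel measure [lebesgue_rV] is defined
   for arbitrary functions (through Borel simple functions below the positive
   and negative parts), and on a function which is measurable for the completion
   it is the Lebesgue integral. *)
Definition lebesgue_measurable_fun (g : 'rV[R]_n -> R) : Prop :=
  forall B : set (measurableTypeR R), measurable B ->
    completed_algebra_gen mu (g @^-1` B).

Definition lebesgue_measurable_cfun (f : 'rV[R]_n -> R[i]) : Prop :=
  lebesgue_measurable_fun (fun x => complex.Re (f x)) /\
  lebesgue_measurable_fun (fun x => complex.Im (f x)).

Definition loc_integrable (f : 'rV[R]_n -> R[i]) : Prop :=
  lebesgue_measurable_cfun f /\
  forall K : set 'rV[R]_n, compact K ->
    (\int[mu]_(x in K) (Normc.normc (f x))%:E < +oo)%E.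

Definition cintegral (f : 'rV[R]_n -> R[i]) : R[i] :=
  Complex (\int[mu]_x complex.Re (f x)) (\int[mu]_x complex.Im (f x)).

Definition partial (i : 'I_n) (phi : 'rV[R]_n -> R) : 'rV[R]_n -> R :=
  fun x => 'D_(delta_mx ord0 i) phi x.

Fixpoint class_C (k : nat) (phi : 'rV[R]_n -> R) : Prop :=
  match k with
  | 0 => continuous phi
  | l.+1 => forall i : 'I_n,
      (forall x, derivable phi x (delta_mx ord0 i)) /\ class_C l (partial i phi)
  end.

Definition test_function (phi : 'rV[R]_n -> R) : Prop :=
  (forall k, class_C k phi) /\ compact (closure [set x | phi x != 0]).

Definition is_weak_gradient
    (f : 'rV[R]_n -> R[i]) (G : 'rV[R]_n -> 'cV[R[i]]_n) : Prop :=
  loc_integrable f /\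
  forall i : 'I_n, loc_integrable (fun x => G x i ord0) /\
    forall phi, test_function phi ->
      cintegral (fun x => f x * real_complex R (partial i phi x)) =
      - cintegral (fun x => G x i ord0 * real_complex R (phi x)).

(* Weak gradients are unique up to null sets, so the choice is irrelevant to the
   norms below. *)
Definition weak_gradient (f : 'rV[R]_n -> R[i]) : 'rV[R]_n -> 'cV[R[i]]_n :=
  xget (fun=> 0) [set G | is_weak_gradient f G].

Definition translate (y : 'rV[R]_n) (f : 'rV[R]_n -> R[i]) :
  'rV[R]_n -> R[i] := fun x => f (x - y).

(* The library norm on ['rV[R]_n] is the sup norm, hence this ball. *)
Definition eucl_ball (a : R) : set 'rV[R]_n :=
  [set x : 'rV[R]_n | Num.sqrt (\sum_(i < n) x ord0 i ^+ 2) < a].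

Definition dyadic_cube (j : int) (k : 'rV[int]_n) : set 'rV[R]_n :=
  [set x : 'rV[R]_n | forall i : 'I_n,
    2 ^ (- j) * (k ord0 i)%:~R <= x ord0 i < 2 ^ (- j) * (k ord0 i + 1)%:~R].
End lebesgue_functions.

Section matrix_weights.
Context (R : realType) (n : nat).
Local Open Scope sesquilinear_scope.

Definition enorm (z : 'cV[R[i]]_n) : R :=
  Num.sqrt (\sum_(i < n) Normc.normc (z i ord0) ^+ 2).

Definition opnorm (A : 'M[R[i]]_n) : R :=
  sup [set enorm (A *m z) | z in [set z | enorm z = 1]].

Definition nonneg_definite (A : 'M[R[i]]_n) : Prop :=
  A \is hermsymmx /\ forall z : 'cV[R[i]]_n, 0 <= (z ^t* *m A *m z) ord0 ord0.

(* For a Hermitian matrix the library diagonalization is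
   [A = P^-1 *m diag_mx (spectral_diag A) *m P] with [P = spectralmx A] unitary;
   the power does not depend on the choice of the diagonalization. *)
Definition mxpower (A : 'M[R[i]]_n) (alpha : R) : 'M[R[i]]_n :=
  invmx (spectralmx A) *m
  diag_mx (map_mx (fun l => real_complex R (complex.Re l `^ alpha))
                  (spectral_diag A)) *m
  spectralmx A.

Definition matrix_weight (W : 'rV[R]_n -> 'M[R[i]]_n) : Prop :=
  [/\ forall x, nonneg_definite (W x),
      {ae @lebesgue_rV R n, forall x, W x \in unitmx} &
      forall i j, loc_integrable (fun x => W x i j)].
End matrix_weights.

Section bourgain_morrey.
Context (R : realType) (n : nat).
Local Notation mu := (@lebesgue_rV R n).
Local Open Scope ereal_scope.

(* The l^r norm of a nonnegative family, for r positive, possibly infinite. *)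
Definition lr_norm (I : choiceType) (r : \bar R) (a : I -> \bar R) : \bar R :=
  match r with
  | r0%:E => (\esum_(i in [set: I]) a i `^ r0) `^ r0^-1
  | +oo => ereal_sup (range a)
  | -oo => 0
  end.

Definition bm_norm (w : 'rV[R]_n -> R) (p t : R) (r : \bar R)
    (f : 'rV[R]_n -> R[i]) : \bar R :=
  lr_norm r (fun jk : int * 'rV[int]_n =>
    let Q : set 'rV[R]_n := dyadic_cube jk.1 jk.2 in
    (\int[mu]_(y in Q) (w y)%:E) `^ (t^-1 - p^-1) *
    (\int[mu]_(y in Q) (Normc.normc (f y) `^ p * w y)%:E) `^ p^-1).

Definition matrix_bm_norm (W : 'rV[R]_n -> 'M[R[i]]_n) (p t : R) (r : \bar R)
    (g : 'rV[R]_n -> 'cV[R[i]]_n) : \bar R :=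
  lr_norm r (fun jk : int * 'rV[int]_n =>
    let Q : set 'rV[R]_n := dyadic_cube jk.1 jk.2 in
    (\int[mu]_(y in Q) (opnorm (W y))%:E) `^ (t^-1 - p^-1) *
    (\int[mu]_(y in Q) (enorm (mxpower (W y) p^-1 *m g y) `^ p)%:E) `^ p^-1).

Definition bms_norm (W : 'rV[R]_n -> 'M[R[i]]_n) (p t : R) (r : \bar R)
    (f : 'rV[R]_n -> R[i]) : \bar R :=
  if `[< exists G, is_weak_gradient f G >] then
    bm_norm (fun x => opnorm (W x)) p t r f +
    matrix_bm_norm W p t r (weak_gradient f)
  else +oo.

(* The norm of f chi_E.  The gradient is cut off along with f: it is not the
   distributional gradient of the product f chi_E, which would in general have a
   singular part on the boundary of E.  When E is the complement of a ball this is
   the norm of f over the interior of E, the sphere being a null set; and when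
   f chi_E does have a weak gradient, that gradient is a.e. the one used here. *)
Definition bms_norm_on (E : set 'rV[R]_n)
    (W : 'rV[R]_n -> 'M[R[i]]_n) (p t : R) (r : \bar R)
    (f : 'rV[R]_n -> R[i]) : \bar R :=
  if `[< exists G, is_weak_gradient f G >] then
    bm_norm (fun x => opnorm (W x)) p t r (fun x => \1_E x * f x)%R +
    matrix_bm_norm W p t r (fun x => \1_E x *: weak_gradient f x)%R
  else +oo.

Definition bms_space (W : 'rV[R]_n -> 'M[R[i]]_n) (p t : R) (r : \bar R) :
    set ('rV[R]_n -> R[i]) :=
  [set f | lebesgue_measurable_cfun f /\ bms_norm W p t r f < +oo].

(* Supremum in [0, +oo], so that the supremum of the empty set is 0. *)
Definition nnsup (A : set (\bar R)) : \bar R := ereal_sup (A `|` [set 0]).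

Definition totally_bounded (V : zmodType) (nrm : V -> \bar R) (X A : set V) :=
  forall e : R, (0 < e)%R ->
    exists E : set V, [/\ finite_set E, E `<=` X &
      forall f, A f -> exists2 g, E g & nrm (f - g)%R < e%:E].
End bourgain_morrey.

(* Main.v *)
Require Import Defs.
From HB Require Import structures.
From mathcomp Require Import all_boot all_order all_algebra.
From mathcomp Require Import all_classical all_reals all_analysis.
From mathcomp Require Import measurable_realfun complex ring lra.

Set Implicit Arguments.
Unset Strict Implicit.
Unset Printing Implicit Defensive.

Import Order.TTheory GRing.Theory Num.Theory.
Import numFieldNormedType.Exports.
Import HBSimple HBNNSimple.

Local Open Scope classical_set_scope.
Local Open Scope ring_scope.

(** The function part and the gradient part of the norm have the same shape: a
    [dyadic_norm], i.e. an l^r norm of weighted L^p norms over the dyadic cubes, of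
    a pointwise size comparable to [rho L x v], the l^1 norm of [v *m L x] for a
    Borel field [L] of invertible real matrices.  For the gradient [L] is the real
    form of [W ^ (1/p)]; for the function it is a scalar matrix.

    The compactness argument is [equicontinuous_colouring].  It approximates
    functions by their averages over the dyadic cubes of a small side.  The error
    at a point is at most a mean of |G x - G (x + y)| over small [y], and the norm
    commutes with such means up to a constant, because p <= r
    ([mixed_norm_average]); so equicontinuity makes the error uniformly small
    ([N_oscillation]).  Far from the origin the functions themselves are small.
    Hence, up to a small error, a function is known from its averages over
    finitely many cubes, and it remains to see that these finitely many vectors
    can be taken from a finite set.

    They are bounded, uniformly over the family, without any bound on the norms
    of its members ([avg_bounded]): an average over a distant cube is controlled
    by the vanishing at infinity, and averages over neighbouring cubes differ by
    an amount that equicontinuity controls, so the bound propagates inwards.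
    Conversely, two close averages must be close in norm.  A constant vector may
    have infinite norm on a cube, but the vectors of finite norm form a
    finite-dimensional space, on which the norm is bounded by a multiple of
    [norm1] ([finite_seminorm_bounded]), and differences of averages lie in
    that space.  Rounding the averages therefore colours the family with finitely
    many colours such that functions of the same colour are close; one member
    of each colour, for the two parts of the norm together, is a finite net.

    To apply this, Lebesgue measurable functions and the weight are replaced by
    Borel functions off null sets.  The gradient is chosen separately for every
    function, and commutes with differences and translations only up to null sets:
    this is the uniqueness of weak gradients, [weak_gradient_unique].  That the
    powers of the weight are Borel follows from a functional calculus: the class
    of functions [g] for which [g (A s)] is measurable in [s] is an algebra closed
    under pointwise limits, hence contains the powers ([la_borel]). *)

(** * Powers, Jensen's inequality and Tonelli's theorem on rectangles *)

Section ereal_powers.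
Context (R : realType).
Local Open Scope ereal_scope.
Implicit Types (x y : \bar R) (q : R).

Lemma le_poweR q x y : (0 <= q)%R -> 0 <= x -> x <= y -> x `^ q <= y `^ q.
Proof.
move=> q0 x0 xy; apply: gt0_ler_poweR => //; rewrite in_itv/= ?x0 ?leey //.
by rewrite (le_trans x0 xy).
Qed.

Lemma poweRK q x : q != 0%R -> 0 <= x -> (x `^ q) `^ q^-1 = x.
Proof. by move=> q0 x0; rewrite -poweRrM mulfV// poweRe1. Qed.

Lemma poweRVK q x : q != 0%R -> 0 <= x -> (x `^ q^-1) `^ q = x.
Proof. by move=> q0 x0; rewrite -poweRrM mulVf// poweRe1. Qed.

Lemma poweR_le_add q x y : (0 < q)%R -> 0 <= x -> 0 <= y ->
  (x + y) `^ q <= (2 `^ q)%R%:E * (x `^ q + y `^ q).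
Proof.
move=> q0 x0 y0; wlog xy : x y x0 y0 / x <= y => [wlg|].
  have [|/ltW] := leP x y; first exact: wlg.
  by rewrite addeC [X in _ * X]addeC; exact: wlg.
apply: (@le_trans _ _ ((2%:E * y) `^ q)).
  apply: le_poweR; [exact: ltW|exact: adde_ge0|].
  by rewrite mule_natl mule2n leeD2r.
rewrite poweRM// poweR_EFin lee_pmul//= ?lee_fin ?powR_ge0 ?poweR_ge0//.
by rewrite leeDr// poweR_ge0.
Qed.
End ereal_powers.

Section jensen.
Context d (T : measurableType d) (R : realType) (mu : {measure set T -> \bar R}).
Local Open Scope ereal_scope.

(** Jensen's inequality up to the factor [2 `^ q].  For every level [l] the
    integrand is at most [l + l `^ (1 - q) * a `^ q], as one sees by comparing [a]
    with [l]; the best level is the power mean of [a]. *)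
Lemma poweR_integral_le (B : set T) (a : T -> \bar R) (V q : R) :
  measurable B -> mu B = V%:E -> (0 < V)%R -> (1 <= q)%R ->
  measurable_fun B a -> (forall y, B y -> 0 <= a y) ->
  (\int[mu]_(y in B) a y) `^ q <=
  (2 `^ q * V `^ (q - 1))%R%:E * \int[mu]_(y in B) (a y `^ q).
Proof.
move=> mB muB V0 q1 ma a0.
have q0 : (0 < q)%R by lra.
have maq : measurable_fun B (fun y => a y `^ q).
  exact: (measurableT_comp (measurable_poweR q) ma).
set S := \int[mu]_(y in B) (a y `^ q).
have S0 : 0 <= S by apply: integral_ge0 => y _; exact: poweR_ge0.
have C0 : (0 < 2 `^ q * V `^ (q - 1))%R by rewrite mulr_gt0// powR_gt0.
have [Sy|Sfin] := eqVneq S +oo; first by rewrite Sy gt0_muley// leey.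
have {}Sfin : S \is a fin_num by rewrite ge0_fin_numE// ltey.
pose s := fine S; have sS : S = s%:E by rewrite fineK.
have s0 : (0 <= s)%R by rewrite -lee_fin -sS.
have Hl (l : R) : (0 < l)%R -> (s <= V * l `^ q)%R ->
    \int[mu]_(y in B) a y <= (2 * (l * V))%:E.
  move=> l0 sl.
  apply: (@le_trans _ _ (\int[mu]_(y in B) (l%:E + (l `^ (1 - q))%:E * a y `^ q))).
    apply: ge0_le_integral => //.
      apply: emeasurable_funD => //; exact: measurable_funeM.
    move=> y By; have [ly|/ltW ly] := leP (a y) l%:E.
      by apply: (le_trans ly); rewrite leeDl// mule_ge0// ?lee_fin ?powR_ge0// poweR_ge0.
    apply: (@le_trans _ _ ((l `^ (1 - q))%:E * a y `^ q)); last by rewrite leeDr// lee_fin ltW.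
    case: (a y) ly (a0 _ By) => [z|_ _|//]; last first.
      by rewrite poweRyr ?gt_eqF// gt0_muley ?lte_fin ?powR_gt0.
    rewrite poweR_EFin -EFinM !lee_fin => lz z0; rewrite -[in leLHS](powRr1 z0) -[in leLHS](subrK q 1%R).
    have zp : (0 < z)%R by apply: lt_le_trans lz.
    rewrite [in leLHS]powRD; last by rewrite (gt_eqF zp) implybT.
    rewrite ler_wpM2r ?powR_ge0//.
    rewrite -(opprB q 1) !powRN lef_pV2 ?posrE ?powR_gt0//.
    by apply: ge0_ler_powR; rewrite ?subr_ge0 ?nnegrE ?(ltW l0) ?(ltW zp) ?(ltW lz).
  rewrite ge0_integralD//; last 3 first.
  - by move=> y _; rewrite lee_fin ltW.
  - by move=> y _; rewrite mule_ge0// ?lee_fin ?powR_ge0// poweR_ge0.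
  - exact: measurable_funeM.
  rewrite integral_cst// ge0_integralZl//; last 2 first.
  - by move=> y _; exact: poweR_ge0.
  - by rewrite lee_fin powR_ge0.
  rewrite -/S sS muB -!EFinM -EFinD lee_fin mulrDl mul1r lerD2l.
  rewrite -[in leRHS](powRr1 (ltW l0)) -[in leRHS](subrK q 1%R).
  rewrite [in leRHS]powRD ?(gt_eqF l0) ?implybT// -mulrA ler_wpM2l ?powR_ge0//.
  by rewrite mulrC.
apply/lee_addgt0Pr => e e0.
(* [l `^ q] is the mean of [a `^ q], increased so that [l] is positive even when
   this mean vanishes; in the conclusion the increase costs exactly [e] *)
pose l := ((s / V + e / (2 `^ q * V `^ q)) `^ q^-1)%R.
have bas : (0 < s / V + e / (2 `^ q * V `^ q))%R.
  by rewrite ltr_wpDl// ?divr_ge0 ?(ltW V0)// divr_gt0// mulr_gt0// powR_gt0.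
have l0 : (0 < l)%R by rewrite /l powR_gt0.
have lq : (l `^ q = s / V + e / (2 `^ q * V `^ q))%R.
  by rewrite /l -powRrM mulVf ?gt_eqF// powRr1// ltW.
have := Hl l l0; rewrite lq => /(_ _)H.
apply: (@le_trans _ _ ((2 * (l * V))%:E `^ q)).
  apply: le_poweR; [exact: ltW|exact: integral_ge0|].
  apply: H; rewrite mulrDr mulrCA divff ?gt_eqF// mulr1 lerDl.
  by rewrite mulr_ge0 ?ltW// divr_gt0// mulr_gt0// powR_gt0.
rewrite sS poweR_EFin -EFinM -EFinD lee_fin !powRM ?mulr_ge0 ?(ltW l0) ?(ltW V0)// lq.
have -> : (V `^ q = V `^ (q - 1) * V)%R.
  by rewrite -[X in (_ * X)%R](powRr1 (ltW V0)) -powRD ?subrK// (gt_eqF V0) implybT.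
set A := (2 `^ q)%R; set D := (V `^ (q - 1))%R.
have A0 : (A != 0)%R by rewrite gt_eqF// powR_gt0.
have D0 : (D != 0)%R by rewrite gt_eqF// powR_gt0.
have V1 : (V != 0)%R by rewrite gt_eqF.
by rewrite le_eqVlt; apply/orP; left; apply/eqP; field; rewrite V1 D0 A0.
Qed.

End jensen.

Section tonelli_on.
Context d1 d2 (T1 : measurableType d1) (T2 : measurableType d2) (R : realType).
Variable m1 : {sigma_finite_measure set T1 -> \bar R}.
Variable m2 : {sigma_finite_measure set T2 -> \bar R}.
Local Open Scope ereal_scope.
Variables (A : set T1) (B : set T2) (f : T1 * T2 -> \bar R).
Hypotheses (mA : measurable A) (mB : measurable B).
Hypotheses (mf : measurable_fun setT f) (f0 : forall z, 0 <= f z).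

Lemma tonelli_on :
  \int[m1]_(x in A) \int[m2]_(y in B) f (x, y) =
  \int[m2]_(y in B) \int[m1]_(x in A) f (x, y).
Proof.
pose g := f \_ (A `*` B).
have mg : measurable_fun setT g.
  apply/(measurable_restrictT _ _).1; first exact: measurableX.
  exact: measurable_funS mf.
have g0 z : 0 <= g z by rewrite /g patchE; case: ifP.
have gE x y : g (x, y) = if (x \in A) && (y \in B) then f (x, y) else 0.
  by rewrite /g patchE in_setX.
transitivity (\int[m1]_x \int[m2]_y g (x, y)).
  rewrite integral_mkcond; apply: eq_integral => x _; rewrite patchE.
  case: ifPn => xA; last first.
    by rewrite integral0_eq// => y _; rewrite gE (negbTE xA).
  rewrite integral_mkcond; apply: eq_integral => y _.
  by rewrite patchE gE xA /=.
rewrite (@fubini_tonelli _ _ _ _ _ m1 m2 g)//.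
rewrite [RHS]integral_mkcond; apply: eq_integral => y _; rewrite patchE.
case: ifPn => yB; last first.
  by rewrite integral0_eq// => x _; rewrite gE (negbTE yB) andbF.
rewrite [RHS]integral_mkcond; apply: eq_integral => x _.
by rewrite patchE gE yB andbT.
Qed.

Lemma measurable_integral_on1 :
  measurable_fun setT (fun x => \int[m2]_(y in B) f (x, y)).
Proof.
pose g := f \_ (setT `*` B).
have mg : measurable_fun setT g.
  apply/(measurable_restrictT _ _).1; first exact: measurableX.
  exact: measurable_funS mf.
rewrite (_ : (fun x => _) = (fun x => \int[m2]_y g (x, y))).
  by apply: (@measurable_fun_fubini_tonelli_F _ _ _ _ _ m2 g) => // z; rewrite /g patchE; case: ifP.
apply/funext => x; rewrite integral_mkcond; apply: eq_integral => y _.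
by rewrite /g !patchE in_setX in_setT.
Qed.
End tonelli_on.

(** * Mixed norms *)

Section lr_norm_theory.
Context (R : realType) (I : choiceType).
Local Open Scope ereal_scope.
Implicit Types (a b : I -> \bar R) (r : \bar R).

Lemma esumZl_le a (k : R) : (0 <= k)%R -> (forall i, 0 <= a i) ->
  \esum_(i in [set: I]) (k%:E * a i) <= k%:E * \esum_(i in [set: I]) a i.
Proof.
move=> k0 a0; apply: ge_ereal_sup => _ [A [finA _] <-].
rewrite -ge0_mule_fsumr//; apply: lee_wpmul2l; first by rewrite lee_fin.
by apply: esum_ge; exists A.
Qed.

Lemma le_lr_norm r a b : 0 < r -> (forall i, 0 <= a i) ->
  (forall i, a i <= b i) -> lr_norm r a <= lr_norm r b.
Proof.
case: r => [r| |]//= r0 a0 ab; last first.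
  apply: ge_ereal_sup => _ [i _ <-]; apply: (le_trans (ab i)).
  by apply: ereal_sup_ubound; exists i.
rewrite lte_fin in r0.
apply: le_poweR; first by rewrite invr_ge0 ltW.
  by apply: esum_ge0 => i _; exact: poweR_ge0.
by apply: le_esum => i _; apply: le_poweR => //; exact: ltW.
Qed.

Lemma le_lr_norm_ub r a i : 0 < r -> (forall i, 0 <= a i) ->
  a i <= lr_norm r a.
Proof.
case: r => [r| |]//= r0 a0; last by apply: ereal_sup_ubound; exists i.
rewrite lte_fin in r0.
rewrite -[leLHS](@poweRK _ r) ?gt_eqF//; apply: le_poweR.
- by rewrite invr_ge0 ltW.
- exact: poweR_ge0.
- apply: esum_ge; exists [set i]; first by split.
  by rewrite fsbig_set1.
Qed.

Lemma lr_normZ_le r a (k : R) : 0 < r -> (0 <= k)%R -> (forall i, 0 <= a i) ->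
  lr_norm r (fun i => k%:E * a i) <= k%:E * lr_norm r a.
Proof.
case: r => [r| |]//= r0 k0 a0; last first.
  apply: ge_ereal_sup => _ [i _ <-]; apply: lee_wpmul2l; first by rewrite lee_fin.
  by apply: ereal_sup_ubound; exists i.
rewrite lte_fin in r0.
have k0' : 0 <= k%:E by rewrite lee_fin.
have s0 : 0 <= \esum_(i in [set: I]) a i `^ r.
  by apply: esum_ge0 => i _; exact: poweR_ge0.
rewrite -[X in X * _](@poweRK _ r) ?gt_eqF// -poweRM// ?poweR_ge0//.
apply: le_poweR; first by rewrite invr_ge0 ltW.
  by apply: esum_ge0 => i _; exact: poweR_ge0.
rewrite (eq_esum (b := fun i => (k `^ r)%:E * a i `^ r)).
  by apply: esumZl_le => [|i]; rewrite ?powR_ge0 ?poweR_ge0.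
by move=> i _; rewrite poweRM.
Qed.

(** One factor 2 comes from [(x + y) `^ r <= 2 `^ r * (x `^ r + y `^ r)], the
    other from the outer exponent, as [2 `^ r^-1 <= 2]. *)
Lemma lr_normD_le r a b : 1 <= r -> (forall i, 0 <= a i) ->
  (forall i, 0 <= b i) ->
  lr_norm r (fun i => a i + b i) <= 4%:E * (lr_norm r a + lr_norm r b).
Proof.
move=> r1 a0 b0.
case: r r1 => [r| |]//= r1; last first.
  apply: ge_ereal_sup => _ [i _ <-].
  have ha : a i <= ereal_sup (range a) by apply: ereal_sup_ubound; exists i.
  have hb : b i <= ereal_sup (range b) by apply: ereal_sup_ubound; exists i.
  apply: (le_trans (leeD ha hb)).
  rewrite -[leLHS]mul1e; apply: lee_wpmul2r; last by rewrite lee_fin; lra.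
  by apply: adde_ge0; [exact: le_trans ha|exact: le_trans hb].
rewrite lee_fin in r1.
have r0 : (0 < r)%R by lra.
have rn : (r != 0)%R by rewrite gt_eqF.
set A := \esum_(i in _) a i `^ r; set B := \esum_(i in _) b i `^ r.
have A0 : 0 <= A by apply: esum_ge0 => i _; exact: poweR_ge0.
have B0 : 0 <= B by apply: esum_ge0 => i _; exact: poweR_ge0.
have ri0 : (0 < r^-1)%R by rewrite invr_gt0.
have two : (2 `^ r^-1 <= 2 :> R)%R.
  by apply: ler1_powR; [lra|rewrite invf_le1].
apply: (@le_trans _ _ (((2 `^ r)%:E * (A + B)) `^ r^-1)).
  apply: le_poweR; first exact: ltW.
    by apply: esum_ge0 => i _; exact: poweR_ge0.
  rewrite -esumD; [|by move=> *; exact: poweR_ge0..].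
  apply: le_trans (esumZl_le _ _); last 2 first.
  - exact: powR_ge0.
  - by move=> i; rewrite adde_ge0// poweR_ge0.
  by apply: le_esum => i _; exact: poweR_le_add.
rewrite poweRM ?adde_ge0 ?lee_fin ?powR_ge0// poweR_EFin -powRrM mulfV// powRr1//.
apply: (@le_trans _ _ (2%:E * ((2 `^ r^-1)%:E * (A `^ r^-1 + B `^ r^-1)))).
  by apply: lee_wpmul2l => //; exact: poweR_le_add.
rewrite muleA -EFinM; apply: lee_wpmul2r; first by rewrite adde_ge0// poweR_ge0.
by rewrite lee_fin; lra.
Qed.
End lr_norm_theory.

Section mixed_norm.
Context d (T : measurableType d) (R : realType).
Variable mu : {sigma_finite_measure set T -> \bar R}.
Local Open Scope ereal_scope.

Definition mixed_norm (I : choiceType) (Q : I -> set T) (c : I -> \bar R)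
    (p : R) (r : \bar R) (h : T -> \bar R) : \bar R :=
  lr_norm r (fun i => c i * (\int[mu]_(y in Q i) h y `^ p) `^ p^-1).

Variables (I : choiceType) (Q : I -> set T) (c : I -> \bar R) (p : R) (r : \bar R).
Hypotheses (mQ : forall i, measurable (Q i)) (c0 : forall i, 0 <= c i).
Hypotheses (p1 : (1 <= p)%R) (pr : p%:E <= r).

Local Notation N := (mixed_norm Q c p r).
Local Notation a_ h i := (c i * (\int[mu]_(y in Q i) h y `^ p) `^ p^-1).

Let p0 : (0 < p)%R. Proof. exact: lt_le_trans ltr01 p1. Qed.
Let pn0 : (p != 0)%R. Proof. by rewrite gt_eqF. Qed.
Let pi0 : (0 < p^-1)%R. Proof. by rewrite invr_gt0. Qed.
Let r1 : 1 <= r. Proof. by apply: le_trans pr; rewrite lee_fin. Qed.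
Let r0 : 0 < r. Proof. exact: lt_le_trans r1. Qed.
Let int0 (h : T -> \bar R) i : 0 <= \int[mu]_(y in Q i) h y `^ p.
Proof. by apply: integral_ge0 => y _; exact: poweR_ge0. Qed.
Let a0 (h : T -> \bar R) i : 0 <= a_ h i.
Proof. by rewrite mule_ge0// poweR_ge0. Qed.
Let mpow D (h : T -> \bar R) q : measurable_fun setT h ->
  measurable_fun D (fun x => h x `^ q).
Proof.
move=> mh; apply: (@measurable_funS _ _ _ _ setT) => //.
exact: (measurableT_comp (measurable_poweR q) mh).
Qed.

Lemma mixed_norm_ge_term h i : a_ h i <= N h.
Proof. by apply: (le_lr_norm_ub (a := fun i => a_ h i)). Qed.

Lemma le_mixed_norm h1 h2 : measurable_fun setT h1 -> measurable_fun setT h2 ->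
  (forall x, 0 <= h1 x) -> (forall x, h1 x <= h2 x) -> N h1 <= N h2.
Proof.
move=> m1 m2 h10 h12; apply: le_lr_norm => // i.
apply: lee_wpmul2l => //; apply: le_poweR => //; first exact: ltW.
apply: ge0_le_integral => //; [by move=> *; exact: poweR_ge0|exact: mpow..|].
by move=> x _; apply: le_poweR => //; exact: ltW.
Qed.

(** A factor 4 for the L^p norms, as in [lr_normD_le], and a factor 4 for the
    l^r norm. *)
Lemma mixed_normD_le h1 h2 :
  measurable_fun setT h1 -> measurable_fun setT h2 ->
  (forall x, 0 <= h1 x) -> (forall x, 0 <= h2 x) ->
  N (fun x => h1 x + h2 x) <= 16%:E * (N h1 + N h2).
Proof.
move=> m1 m2 h10 h20.
have aD i : a_ (fun x => h1 x + h2 x) i <= 4%:E * (a_ h1 i + a_ h2 i).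
  rewrite -ge0_muleDr ?poweR_ge0// muleCA; apply: lee_wpmul2l => //.
  set X := \int[mu]_(y in Q i) h1 y `^ p.
  set Y := \int[mu]_(y in Q i) h2 y `^ p.
  have two : (2 `^ p^-1 <= 2 :> R)%R.
    by apply: ler1_powR; [lra|rewrite invf_le1].
  apply: (@le_trans _ _ (((2 `^ p)%:E * (X + Y)) `^ p^-1)).
    apply: le_poweR; [exact: ltW|exact: int0|].
    rewrite /X /Y -ge0_integralD//; [|by move=> *; exact: poweR_ge0|exact: mpow
      |by move=> *; exact: poweR_ge0|exact: mpow].
    rewrite -ge0_integralZl ?lee_fin ?powR_ge0//; last 2 first.
    - by apply: emeasurable_funD; exact: mpow.
    - by move=> x _; rewrite adde_ge0// poweR_ge0.
    apply: ge0_le_integral => //; [by move=> *; exact: poweR_ge0| | |].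
    - by apply: mpow; exact: emeasurable_funD.
    - by apply: measurable_funeM; apply: emeasurable_funD; exact: mpow.
    - by move=> x _; exact: poweR_le_add.
  have X0 : 0 <= X by exact: int0.
  have Y0 : 0 <= Y by exact: int0.
  rewrite poweRM; [|by rewrite lee_fin powR_ge0|exact: adde_ge0].
  rewrite poweR_EFin -powRrM mulfV// powRr1//.
  apply: (@le_trans _ _ (2%:E * ((2 `^ p^-1)%:E * (X `^ p^-1 + Y `^ p^-1)))).
    by apply: lee_wpmul2l => //; exact: poweR_le_add.
  rewrite muleA -EFinM; apply: lee_wpmul2r; first by rewrite adde_ge0// poweR_ge0.
  by rewrite lee_fin; lra.
apply: (le_trans (le_lr_norm _ _ aD)) => //.
apply: (le_trans (lr_normZ_le _ _ _)) => //; first by move=> i; rewrite adde_ge0.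
rewrite (_ : 16%:E = 4%:E * 4%:E); last by rewrite -EFinM; congr EFin; ring.
by rewrite -muleA; apply: lee_wpmul2l => //; exact: lr_normD_le.
Qed.

Lemma mixed_normZ_le h (k : R) : measurable_fun setT h ->
  (forall x, 0 <= h x) -> (0 <= k)%R -> N (fun x => k%:E * h x) <= k%:E * N h.
Proof.
move=> mh h0 k0; apply: le_trans (lr_normZ_le _ _ _) => //.
apply: le_lr_norm => // i; rewrite muleCA; apply: lee_wpmul2l => //.
rewrite (eq_integral (fun y => (k `^ p)%:E * h y `^ p)); last first.
  by move=> y _; rewrite poweRM.
rewrite ge0_integralZl//; [|exact: mpow|by move=> *; exact: poweR_ge0
  |by rewrite lee_fin powR_ge0].
by rewrite poweRM ?lee_fin ?powR_ge0// poweR_EFin -powRrM mulfV// powRr1.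
Qed.

(** Minkowski's integral inequality, up to a constant.  Jensen's inequality with
    exponent [p], followed by Tonelli's theorem, bounds the p-th power of each term
    by an average over [B]; as [p <= r], Jensen's inequality with exponent [r / p]
    does the same for the r-th power, and the sum over the cubes can then be taken
    under the integral. *)
Lemma mixed_norm_average (H : T * T -> \bar R) (B : set T) (V E : R) :
  measurable_fun setT H -> (forall z, 0 <= H z) ->
  measurable B -> mu B = V%:E -> (0 < V)%R -> (0 <= E)%R ->
  (forall y, B y -> N (fun x => H (x, y)) <= E%:E) ->
  N (fun x => \int[mu]_(y in B) H (x, y)) <= (4 * V * E)%:E.
Proof.
move=> mH H0 mB muB V0 E0 NE.
pose h x := \int[mu]_(y in B) H (x, y).
have mHp : measurable_fun setT (fun z => H z `^ p).
  exact: (measurableT_comp (measurable_poweR p) mH).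
have mHx x : measurable_fun B (fun y => H (x, y)).
  apply: (@measurable_funS _ _ _ _ setT) => //.
  exact: (measurableT_comp mH (measurable_pair1 x)).
have mHy y D : measurable_fun D (fun x => H (x, y)).
  apply: (@measurable_funS _ _ _ _ setT) => //.
  exact: (measurableT_comp mH (measurable_pair2 y)).
have mh : measurable_fun setT h by exact: measurable_integral_on1.
pose b i y := \int[mu]_(x in Q i) H (x, y) `^ p.
have mb i : measurable_fun setT (b i).
  apply: (@measurable_integral_on1 _ _ _ _ _ mu (Q i) (fun z => H (z.2, z.1) `^ p)) => //.
  - rewrite (_ : (fun z => _) = (fun z => H z `^ p) \o (fun z : T * T => (z.2, z.1)))//.
    apply: (measurableT_comp mHp).
    by apply: measurable_fun_pair; [exact: measurable_snd|exact: measurable_fst].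
  - by move=> z; exact: poweR_ge0.
have b0 i y : 0 <= b i y by apply: integral_ge0 => x _; exact: poweR_ge0.
pose beta i y := c i `^ p * b i y.
have mbeta i : measurable_fun setT (beta i) by exact: measurable_funeM.
have beta0 i y : 0 <= beta i y by rewrite mule_ge0// poweR_ge0.
have betaE i y : beta i y = a_ (fun x => H (x, y)) i `^ p.
  by rewrite poweRM ?poweR_ge0// poweRVK.
have key i : a_ h i `^ p <= (2 `^ p * V `^ (p - 1))%:E * \int[mu]_(y in B) beta i y.
  rewrite poweRM ?poweR_ge0// poweRVK// /beta ge0_integralZl//; last 2 first.
  - by apply: measurable_funS (mb i).
  - exact: poweR_ge0.
  rewrite [leRHS]muleCA; apply: lee_wpmul2l; first exact: poweR_ge0.
  rewrite /b -(@tonelli_on _ _ _ _ _ mu mu (Q i) B (fun z => H z `^ p))//; last first.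
    by move=> z; exact: poweR_ge0.
  rewrite -ge0_integralZl//; last 3 first.
  - apply: (@measurable_funS _ _ _ _ setT) => //.
    apply: (@measurable_integral_on1 _ _ _ _ _ mu B (fun z => H z `^ p)) => //.
    by move=> z; exact: poweR_ge0.
  - by move=> x _; apply: integral_ge0 => y _; exact: poweR_ge0.
  - by rewrite lee_fin mulr_ge0// powR_ge0.
  apply: ge0_le_integral => //.
  - by move=> x _; exact: poweR_ge0.
  - exact: mpow.
  - apply: measurable_funeM; apply: (@measurable_funS _ _ _ _ setT) => //.
    apply: (@measurable_integral_on1 _ _ _ _ _ mu B (fun z => H z `^ p)) => //.
    by move=> z; exact: poweR_ge0.
  - by move=> x _; apply: poweR_integral_le => // y _.
have aE i y : B y -> a_ (fun x => H (x, y)) i <= E%:E.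
  by move=> By; apply: le_trans (NE y By); exact: mixed_norm_ge_term.
have VE0 : (0 <= 2 * V * E)%R by rewrite !mulr_ge0// ltW.
have VpE : (V `^ p = V `^ (p - 1) * V)%R.
  by rewrite -[X in (_ * X)%R](powRr1 (ltW V0)) -powRD ?subrK// (gt_eqF V0) implybT.
case: r r0 NE pr => [s| |]// s0 NE ps; last first.
  apply: ge_ereal_sup => _ [i _ <-].
  apply: (@le_trans _ _ (2 * V * E)%:E); last by rewrite lee_fin; nra.
  rewrite -[leLHS](@poweRK _ p)// -[leRHS](@poweRK _ p)//.
  apply: le_poweR; [exact: ltW|exact: poweR_ge0|].
  apply: (le_trans (key i)).
  have -> : (2 * V * E)%:E `^ p = (2 `^ p * V `^ (p - 1))%:E * (E `^ p * V)%:E.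
    rewrite poweR_EFin -EFinM; congr EFin.
    by rewrite !powRM ?mulr_ge0 ?(ltW V0)// VpE; ring.
  apply: lee_wpmul2l; first by rewrite lee_fin mulr_ge0// powR_ge0.
  rewrite EFinM -muB -integral_cst//.
  apply: ge0_le_integral => //.
  - exact: measurable_funS (mbeta i).
  - move=> y By; rewrite betaE -poweR_EFin; apply: le_poweR => //; first exact: ltW.
    exact: aE.
rewrite lte_fin in s0; rewrite lee_fin in ps.
have sn0 : (s != 0)%R by rewrite gt_eqF.
pose q := (s / p)%R.
have q1 : (1 <= q)%R by rewrite ler_pdivlMr// mul1r.
have sE : (s = p * q)%R by rewrite /q mulrC divfK.
have pow_s x : 0 <= x -> x `^ s = (x `^ p) `^ q by rewrite sE poweRrM.
(* the constants of the two uses of Jensen's inequality, the first one raised to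
   the power [q] *)
pose C := (2 `^ s * V `^ ((p - 1) * q) * (2 `^ q * V `^ (q - 1)))%R.
have C0 : (0 <= C)%R by rewrite !mulr_ge0// powR_ge0.
have CVE : (C * V = (2 `^ (1 + p^-1) * V) `^ s)%R.
  rewrite powRM ?powR_ge0 ?(ltW V0)// -powRrM.
  have -> : ((1 + p^-1) * s = s + q)%R by rewrite /q; field.
  rewrite powRD ?(pnatr_eq0 _ 2) ?implybT// /C.
  have -> : (V `^ s = V `^ ((p - 1) * q) * V `^ (q - 1) * V)%R.
    rewrite -[X in (_ = _ * X)%R](powRr1 (ltW V0)) -!powRD ?(gt_eqF V0) ?implybT//.
    by congr (_ `^ _)%R; rewrite sE; ring.
  by ring.
rewrite /mixed_norm /=.
have key2 i : a_ h i `^ s <= C%:E * \int[mu]_(y in B) beta i y `^ q.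
  rewrite pow_s//.
  apply: (@le_trans _ _ (((2 `^ p * V `^ (p - 1))%:E * \int[mu]_(y in B) beta i y) `^ q)).
    by apply: le_poweR => //; [lra|exact: poweR_ge0].
  rewrite poweRM; last 2 first.
  - by rewrite lee_fin mulr_ge0// powR_ge0.
  - by apply: integral_ge0 => y _.
  rewrite poweR_EFin powRM ?powR_ge0// -!powRrM -sE /C [in leRHS]EFinM -[leRHS]muleA.
  apply: lee_wpmul2l; first by rewrite lee_fin mulr_ge0// powR_ge0.
  apply: poweR_integral_le => //; exact: measurable_funS (mbeta i).
have mbq i : measurable_fun B (fun y => beta i y `^ q) by exact: mpow.
apply: (@le_trans _ _ (((C * (V * E `^ s))%:E) `^ s^-1)).
  apply: le_poweR; first by rewrite invr_ge0 ltW.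
    by apply: esum_ge0 => i _; exact: poweR_ge0.
  apply: ge_ereal_sup => _ [A [finA _] <-].
  apply: (@le_trans _ _ (\sum_(i \in A) (C%:E * \int[mu]_(y in B) beta i y `^ q))).
    by apply: lee_fsum => // i _; exact: key2.
  rewrite -ge0_mule_fsumr; last first.
    by move=> i; apply: integral_ge0 => y _; exact: poweR_ge0.
  rewrite [leRHS]EFinM; apply: lee_wpmul2l; first by rewrite lee_fin.
  rewrite -ge0_integral_fsum//; last by move=> *; exact: poweR_ge0.
  rewrite [(V * _)%R]mulrC [leRHS]EFinM -muB -integral_cst//.
  apply: ge0_le_integral => //.
  - by move=> y _; apply: fsume_ge0 => i _; exact: poweR_ge0.
  - by apply: emeasurable_fsum.
  - move=> y By.
    rewrite (eq_fsbigr (fun i => a_ (fun x => H (x, y)) i `^ s)); last first.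
      by move=> i _; rewrite betaE pow_s.
    rewrite -poweR_EFin -[leLHS](@poweRVK _ s)//; last first.
      by apply: fsume_ge0 => i _; exact: poweR_ge0.
    apply: le_poweR; [exact: ltW|exact: poweR_ge0|].
    apply: le_trans (NE y By); rewrite /mixed_norm /=.
    apply: le_poweR; first by rewrite invr_ge0 ltW.
      by apply: fsume_ge0 => i _; exact: poweR_ge0.
    by apply: esum_ge; exists A.
rewrite mulrA CVE -powRM ?mulr_ge0 ?powR_ge0 ?(ltW V0)//.
rewrite -poweR_EFin poweRK ?lee_fin ?mulr_ge0 ?powR_ge0 ?(ltW V0)//.
rewrite -!mulrA ler_wpM2r ?mulr_ge0 ?(ltW V0)//.
(* [2 `^ (1 + p^-1) <= 4] *)
have -> : (4 = 2 `^ 2%:R :> R)%R by rewrite powR_mulrn//; ring.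
by apply: ler_powR; [lra|rewrite -lerBrDl; have := invf_le1 p0; rewrite p1; lra].
Qed.

End mixed_norm.

(** * Lebesgue measure, dyadic cubes and finite-dimensional seminorms *)

Section translation_invariance.
Context (R : realType).
Local Open Scope ereal_scope.

Lemma measurable_coord n (i : 'I_n) :
  measurable_fun setT (fun x : 'rV[R]_n => x ord0 i).
Proof. exact: measurable_rV_coord. Qed.

Lemma measurable_fun_rV d (T : measurableType d) n (f : T -> 'rV[R]_n) :
  (forall i, measurable_fun setT (fun x => f x ord0 i)) -> measurable_fun setT f.
Proof. by move=> mf; apply/measurable_fun_rVP => i; exact: mf. Qed.

Lemma measurable_fun_coord d (T : measurableType d) n (f : T -> 'rV[R]_n) i :
  measurable_fun setT f -> measurable_fun setT (fun x => f x ord0 i).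
Proof. by move/measurable_fun_rVP => /(_ i). Qed.

Lemma measurable_shift n (c : 'rV[R]_n) :
  measurable_fun setT (fun x : 'rV[R]_n => (c + x)%R).
Proof.
apply: measurable_fun_rV => i; under eq_fun do rewrite mxE.
by apply: measurable_funD => //; exact: measurable_coord.
Qed.

Lemma lebesgue_measure_shift (c : R) (A : set (measurableTypeR R)) :
  measurable A ->
  pushforward lebesgue_measure ((fun x => c + x)%R : _ -> measurableTypeR R) A
    = lebesgue_measure A.
Proof.
move=> mA; apply/esym.
have mc : measurable_fun setT ((fun x => c + x)%R : R -> measurableTypeR R).
  exact: measurable_funD.
apply: (@lebesgue_measure_unique _ (pushforward lebesgue_measure ((fun x => c + x)%R : _ -> measurableTypeR R))) => //= _ [[a b]] _ <-.
rewrite /pushforward (_ : _ @^-1` _ = [set` `]a - c, b - c]%R]); last first.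
  by apply/seteqP; split=> x /=; rewrite !in_itv/= ltrBlDl lerBrDl.
rewrite !lebesgue_measure_itv/= !lte_fin ltrD2r; case: ifP => // _.
by rewrite -!EFinD; congr EFin; ring.
Qed.

(** By induction on the dimension: splitting off the first coordinate turns a
    translation into a product map, and the product measure is determined by its
    values on rectangles. *)
Lemma lebesgue_rV_shift n (c : 'rV[R]_n) (A : set 'rV[R]_n) :
  measurable A -> lebesgue_rV R n ((fun x => c + x)%R @^-1` A) = lebesgue_rV R n A.
Proof.
elim: n c A => [|n IHn] c A mA.
  congr (lebesgue_rV R 0 _); apply/seteqP.
  have E (x : 'rV[R]_0) : (c + x)%R = x by apply/rowP => -[].
  by split=> x /=; rewrite E.
pose c0 := c ord0 ord0; pose c' : 'rV[R]_n := \row_j c ord0 (lift ord0 j).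
pose tau (p : measurableTypeR R * 'rV[R]_n) : measurableTypeR R * 'rV[R]_n :=
  ((c0 + p.1)%R, (c' + p.2)%R).
have mtau : measurable_fun setT tau.
  apply: measurable_fun_pair.
    apply: (@measurable_funD _ _ _ _ (cst c0) fst) => //; exact: measurable_fst.
  by apply: (measurableT_comp (measurable_shift c')); exact: measurable_snd.
have tauE p : (c + rV_cons p)%R = rV_cons (tau p).
  apply/rowP => i; rewrite mxE; case: (unliftP ord0 i) => [j|] ->.
    by rewrite !rV_consES /= !mxE.
  by rewrite !rV_consE0.
have mB : measurable (@rV_cons R n @^-1` A).
  by rewrite -[X in measurable X]setTI; exact: measurable_rV_cons.
rewrite /= /lebesgue_step /pushforward.
rewrite [RHS](@product_measure_unique _ _ _ _ _ lebesgue_measure (lebesgue_rV R n)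
  (pushforward (lebesgue_measure \x lebesgue_rV R n) tau))//.
  rewrite /pushforward; congr (product_measure1 _ _ _).
  by apply/seteqP; split => p /=; rewrite tauE.
move=> B C mB' mC; rewrite /pushforward.
change ((lebesgue_measure \x lebesgue_rV R n)
  (((fun x => c0 + x)%R @^-1` B) `*` ((fun x => c' + x)%R @^-1` C)) =
  lebesgue_measure B * lebesgue_rV R n C).
rewrite product_measure1E//; last 2 first.
- have mc0 : measurable_fun setT ((fun x => c0 + x)%R : R -> measurableTypeR R).
    exact: measurable_funD.
  by rewrite -[X in measurable X]setTI; exact: mc0.
- by rewrite -[X in measurable X]setTI; exact: measurable_shift.
by congr (_ * _); [exact: lebesgue_measure_shift|exact: IHn].
Qed.

Lemma integral_shift n (c : 'rV[R]_n) (D : set 'rV[R]_n) (f : 'rV[R]_n -> \bar R) :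
  measurable D -> measurable_fun D f -> (forall x, 0 <= f x) ->
  \int[lebesgue_rV R n]_(x in D) f x =
  \int[lebesgue_rV R n]_(x in (fun x => c + x)%R @^-1` D) f (c + x)%R.
Proof.
move=> mD mf f0.
rewrite -(@ge0_integral_pushforward _ _ _ _ _ _ (measurable_shift c) (lebesgue_rV R n) D f)//.
apply: eq_measure_integral; first exact: measurable_shift.
by move=> mc A mA AS; rewrite -[LHS](lebesgue_rV_shift c mA).
Qed.
End translation_invariance.

Section dyadic_grid.
Context (R : realType) (n : nat).
Implicit Types (j : int) (k : 'rV[int]_n) (x y : 'rV[R]_n).

Lemma dyadic_side_gt0 j : 0 < (2 : R) ^ (- j).
Proof. by rewrite exprz_gt0. Qed.

Definition dyadic_index j x : 'rV[int]_n := \row_i Num.floor (x ord0 i / 2 ^ (- j)).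

Lemma dyadic_cubeP j k x : dyadic_cube j k x <-> dyadic_index j x = k.
Proof.
have s0 := dyadic_side_gt0 j.
split=> [h|<- i].
  apply/rowP => i; rewrite mxE; apply/floor_def.
  by have := h i; rewrite ler_pdivlMr// ltr_pdivrMr// ![_ * (2 ^ _)]mulrC.
rewrite mxE ![2 ^ (- j) * _]mulrC -ler_pdivlMr// -ltr_pdivrMr//.
by rewrite floor_le_tmp floorD1_gt.
Qed.

Lemma measurable_box (a b : 'I_n -> R) :
  measurable [set x : 'rV[R]_n | forall i, a i <= x ord0 i < b i].
Proof.
rewrite (_ : [set x | _] = \bigcap_(j in [set: 'I_n])
    (rV_coord j @^-1` [set` `[a j, b j[%R])).
  apply: fin_bigcap_measurable => // j _.
  by rewrite -[X in measurable X]setTI; exact: measurable_rV_coord.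
apply/seteqP; split => [v Bv j _|v Bv j]; first by rewrite /= in_itv; exact: Bv.
by have := Bv j Logic.I; rewrite /= in_itv.
Qed.

Lemma measurable_dyadic j k : measurable (@dyadic_cube R n j k).
Proof. exact: measurable_box. Qed.

Lemma lebesgue_dyadic j k :
  lebesgue_rV R n (dyadic_cube j k) = ((2 ^ (- j)) ^+ n)%:E.
Proof.
rewrite /dyadic_cube lebesgue_rV_box; last first.
  by move=> i; rewrite ler_pM2l ?dyadic_side_gt0// ler_int lerDl.
congr EFin; under eq_bigr do rewrite -mulrBr intrD addrAC subrr add0r mulr1.
by rewrite prodr_const card_ord.
Qed.

End dyadic_grid.

Section finite_colouring.
Context (R : realType).

Lemma real_colouring (M e : R) : 0 < e ->
  exists (K : nat) (c : R -> 'I_K.+1), forall a b,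
    `|a| <= M -> `|b| <= M -> c a = c b -> `|a - b| <= e.
Proof.
move=> e0; pose K := Num.truncn (2 * M / e); exists K.
pose c (a : R) : 'I_K.+1 := inord (Num.truncn ((a + M) / e)); exists c.
move=> a b aM bM cab.
have h x : `|x| <= M -> 0 <= (x + M) / e /\ (Num.truncn ((x + M) / e) <= K)%N.
  rewrite ler_norml => /andP[x1 x2]; split.
    by apply: divr_ge0; lra.
  by apply: le_truncn; rewrite ler_pM2r ?invr_gt0//; lra.
have [a0 aK] := h a aM; have [b0 bK] := h b bM.
have /(congr1 val) := cab; rewrite /= !inordK ?ltnS// => E.
have /andP[a1 a2] := Num.Theory.truncn_itv a0.
have /andP[b1 b2] := Num.Theory.truncn_itv b0.
rewrite E in a1 a2; set N := Num.truncn _ in a1 a2 b1 b2.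
have : `|(a + M) / e - (b + M) / e| <= 1.
  by rewrite -natr1 in a2 b2; rewrite ler_norml; apply/andP; split; lra.
rewrite -mulrBl normrM normfV (gtr0_norm e0) ler_pdivrMr// mul1r.
by rewrite (_ : a + M - (b + M) = a - b)//; ring.
Qed.
End finite_colouring.

Section extended_seminorm.
Context (R : realType) (m : nat).
Local Open Scope ereal_scope.

Definition norm1 (v : 'rV[R]_m) : R := (\sum_j `|v ord0 j|)%R.

Lemma norm1_ge0 v : (0 <= norm1 v)%R. Proof. exact: sumr_ge0. Qed.

(** Among the matrices whose rows have finite values, one of maximal rank has a row
    space containing every vector of finite value.  Its pseudo-inverse bounds the
    coefficients of such a vector on the rows by a multiple of [norm1]. *)
Lemma finite_seminorm_bounded (phi : 'rV[R]_m -> \bar R) :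
  (forall v, 0 <= phi v) ->
  (forall u v, phi (u + v)%R <= 16%:E * (phi u + phi v)) ->
  (forall a v, phi (a *: v)%R <= `|a|%:E * phi v) ->
  exists2 C : R, (0 <= C)%R & forall v, phi v < +oo -> phi v <= (C * norm1 v)%:E.
Proof.
move=> phi0 phiD phiZ.
have phi_0 : phi 0%R = 0.
  apply/eqP; rewrite eq_le phi0 andbT.
  by have := phiZ 0%R 0%R; rewrite scale0r normr0 mul0e.
(* [P d]: some matrix of rank [d] has all its rows of finite value *)
pose P d := `[< exists k (U : 'M[R]_(k, m)),
  (forall i, phi (row i U) < +oo) /\ \rank U = d >].
have P0 : exists d, P d.
  exists 0%N; apply/asboolP; exists 0%N, 0%R; split; first by case.
  by rewrite mxrank0.
have Pm d : P d -> (d <= m)%N.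
  by move/asboolP => [k [U [_ <-]]]; exact: rank_leq_col.
case: (ex_maxnP P0 Pm) => d /asboolP[k [U [Ufin rU]]] dmax.
have sumfin (I : finType) (s : seq I) (w : I -> 'rV[R]_m) (C : R) :
    (0 <= C)%R -> (forall i, phi (w i) <= C%:E) ->
    phi (\sum_(i <- s) w i)%R <= (16 ^+ size s * (size s)%:R * C)%:E.
  move=> C0 wC; elim: s => [|i s IH]; first by rewrite big_nil phi_0 !(mulr0,mul0r).
  rewrite big_cons; apply: (le_trans (phiD _ _)).
  apply: (@le_trans _ _ (16%:E * (C%:E + (16 ^+ size s * (size s)%:R * C)%:E))).
    by apply: lee_wpmul2l => //; apply: leeD.
  rewrite -EFinD -EFinM lee_fin /= exprS -!mulrA ler_pM2l//.
  have -> : ((size s).+1%:R = (size s)%:R + 1 :> R)%R by rewrite natr1.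
  rewrite [in leRHS]mulrDl mul1r mulrDr addrC lerD2l.
  by rewrite -[leLHS]mul1r ler_wpM2r// exprn_ege1// ler1n.
have spanU v : phi v < +oo -> (v <= U)%MS.
  move=> vfin; apply: contraT => vU.
  have Ult : (U < col_mx U v)%MS.
    by rewrite ltmxE col_mx_sub submx_refl (negPf vU) andbT -addsmxE addsmxSl.
  have /dmax : P (\rank (col_mx U v)).
    apply/asboolP; exists (k + 1)%N, (col_mx U v); split=> // i.
    rewrite -(splitK i); case: (fintype.split i) => i' /=; first by rewrite rowKu.
    by rewrite rowKd (ord1 i') row_id.
  by rewrite leqNgt -rU rank_ltmx.
pose B := (\sum_i fine (phi (row i U)))%R.
have phiB i : phi (row i U) <= B%:E.
  rewrite -[phi _]fineK ?ge0_fin_numE// lee_fin /B (bigD1 i)//= lerDl.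
  by apply: sumr_ge0 => ? _; exact: fine_ge0.
have B0 : (0 <= B)%R by apply: sumr_ge0 => ? _; exact: fine_ge0.
pose V := pinvmx U.
pose D := (\sum_i \sum_j `|V i j|)%R.
have D0 : (0 <= D)%R by apply: sumr_ge0 => ? _; apply: sumr_ge0.
exists (16 ^+ size (index_enum 'I_k) * (size (index_enum 'I_k))%:R * (D * B))%R.
  by rewrite !mulr_ge0// exprn_ge0.
move=> v /spanU vU.
have vE : v = (\sum_i (v *m V) ord0 i *: row i U)%R.
  by rewrite -mulmx_sum_row mulmxKpV.
rewrite [in leLHS]vE; apply: (le_trans (sumfin _ _ _ (D * norm1 v * B)%R _ _)).
- by rewrite !mulr_ge0// norm1_ge0.
- move=> i; apply: (le_trans (phiZ _ _)).
  rewrite EFinM; apply: lee_pmul => //; rewrite lee_fin mxE.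
  apply: (le_trans (ler_norm_sum _ _ _)).
  rewrite mulr_sumr; apply: ler_sum => j _.
  rewrite normrM mulrC ler_wpM2r// /D (bigD1 j)//= (bigD1 i)//= -addrA lerDl.
  by rewrite addr_ge0// sumr_ge0// => ? _; exact: sumr_ge0.
by rewrite lee_fin -!mulrA [(norm1 v * B)%R]mulrC.
Qed.
End extended_seminorm.

(** * Measurable fields of norms and averages over cubes *)

Section seminorm_field.
Context (R : realType) (n m : nat).
Local Notation T := 'rV[R]_n.
Local Notation mu := (lebesgue_rV R n).
Variable L : T -> 'M[R]_m.

(** The l^1 norm is chosen because it is a finite sum of absolute values of linear
    forms: measurability and the comparison with averages are checked on each
    form. *)
Definition rho (x : T) (v : 'rV[R]_m) : R := \sum_i `|(v *m L x) ord0 i|.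

Lemma rho_ge0 x v : 0 <= rho x v. Proof. exact: sumr_ge0. Qed.

Lemma rhoD x u v : rho x (u + v) <= rho x u + rho x v.
Proof.
rewrite -big_split; apply: ler_sum => i _ /=.
by rewrite mulmxDl mxE ler_normD.
Qed.

Lemma rhoZ x a v : rho x (a *: v) = `|a| * rho x v.
Proof.
rewrite mulr_sumr; apply: eq_bigr => i _.
by rewrite -scalemxAl mxE normrM.
Qed.

Lemma rhoN x v : rho x (- v) = rho x v.
Proof. by rewrite -scaleN1r rhoZ normrN1 mul1r. Qed.

Lemma rho_sub_le x u v w : rho x (u - v) <= rho x (u - w) + rho x (w - v).
Proof. have -> : u - v = (u - w) + (w - v) by rewrite addrA subrK.
exact: rhoD. Qed.

Hypothesis mL : forall i j, measurable_fun setT (fun x => L x i j).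

Lemma measurable_rho d (S : measurableType d) (u : S -> T) (v : S -> 'rV[R]_m) :
  measurable_fun setT u -> measurable_fun setT v ->
  measurable_fun setT (fun s => rho (u s) (v s)).
Proof.
move=> mu' mv; apply: measurable_sum => i.
apply: measurableT_comp; first exact: normr_measurable.
under eq_fun do rewrite mxE.
apply: measurable_sum => j; apply: measurable_funM.
  exact: measurable_fun_coord.
exact: (measurableT_comp (mL j i) mu').
Qed.

Lemma measurable_rV_add : measurable_fun setT (fun z : T * T => z.1 + z.2).
Proof.
apply: measurable_fun_rV => i; under eq_fun do rewrite mxE.
by apply: measurable_funD; apply: (measurableT_comp (measurable_coord i));
  [exact: measurable_fst|exact: measurable_snd].
Qed.

Lemma measurable_rVB d (S : measurableType d) (u v : S -> 'rV[R]_m) :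
  measurable_fun setT u -> measurable_fun setT v ->
  measurable_fun setT (fun s => u s - v s).
Proof.
move=> mu' mv; apply: measurable_fun_rV => i; under eq_fun do rewrite !mxE.
by apply: measurable_funB; exact: measurable_fun_coord.
Qed.

Definition cube_average (j : int) (k : 'rV[int]_n) (g : T -> 'rV[R]_m) : 'rV[R]_m :=
  \row_i (((2 ^ (- j)) ^+ n)^-1 * \int[mu]_(x in dyadic_cube j k) g x ord0 i).

Definition cube_integrable (g : T -> 'rV[R]_m) := forall j k i,
  mu.-integrable (dyadic_cube j k) (fun x => (g x ord0 i)%:E).

Local Open Scope ereal_scope.

(** For each of the linear forms that make up [rho], this is the triangle
    inequality for integrals. *)
Lemma rho_sub_average x u g j k : measurable_fun setT g -> cube_integrable g ->
  ((2 ^ (- j)) ^+ n * rho x (u - cube_average j k g))%R%:E <=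
  \int[mu]_(z in dyadic_cube j k) (rho x (u - g z))%:E.
Proof.
move=> mg ig; set P := dyadic_cube j k; set V := ((2 ^ (- j)) ^+ n)%R.
have V0 : (0 < V)%R by rewrite exprn_gt0// dyadic_side_gt0.
have mP : measurable P by exact: measurable_dyadic.
have muP : mu P = V%:E by exact: lebesgue_dyadic.
pose w l i z := ((u ord0 l - g z ord0 l) * L x l i)%R.
have icst c : mu.-integrable P (EFin \o cst c).
  apply/integrableP; split; first exact/measurable_EFinP/measurable_cst.
  rewrite /= integral_cst//. by rewrite [X in _ * X]muP -EFinM ltry.
have iB l : mu.-integrable P (fun z => (u ord0 l)%:E - (g z ord0 l)%:E).
  by apply: (integrableB _ (icst (u ord0 l)) (ig j k l)).
have iw l i : mu.-integrable P (fun z => (w l i z)%:E).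
  apply: eq_integrable (integrableZl _ (L x l i) (iB l)) => //.
  by move=> z _; rewrite -EFinB -EFinM mulrC.
have wE l i : \int[mu]_(z in P) (w l i z)%:E =
    (V * ((u ord0 l - cube_average j k g ord0 l) * L x l i))%R%:E.
  transitivity (\int[mu]_(z in P) ((L x l i)%:E * ((u ord0 l)%:E - (g z ord0 l)%:E))).
    by apply: eq_integral => z _; rewrite -EFinB -EFinM mulrC.
  rewrite integralZl// (integralB _ (icst (u ord0 l)) (ig j k l))//=.
  rewrite integral_cst// [X in _ * (_ * X - _)]muP mxE -/P -/V.
  rewrite -[X in _ * (_ - X)]fineK; last by apply: integrable_fin_num => //; exact: ig.
  set I0 := fine _.
  transitivity ((L x l i * (u ord0 l * V - I0))%R%:E); first by rewrite EFinM EFinB EFinM.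
  congr EFin; rewrite /Rintegral -/I0.
  by field; rewrite gt_eqF.
rewrite /rho mulr_sumr.
rewrite (eq_integral (fun z => \sum_i `|((u - g z) *m L x) ord0 i|%:E)); last first.
  by move=> z _; rewrite sumEFin.
have mlin i : measurable_fun setT (fun z => ((u - g z) *m L x) ord0 i).
  under eq_fun do rewrite mxE.
  apply: measurable_sum => l; apply: measurable_funM => //.
  apply: measurable_fun_coord; apply: measurable_rVB => //.
rewrite ge0_integral_sum//; last first.
  move=> i; apply: (@measurable_funS _ _ _ _ setT) => //.
  by apply/measurable_EFinP; apply: measurableT_comp => //; exact: normr_measurable.
rewrite -sumEFin; apply: lee_sum => i _.
rewrite -(gtr0_norm V0) -normrM -abse_EFin.
have -> : (V * ((u - cube_average j k g) *m L x) ord0 i)%R%:E =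
    \int[mu]_(z in P) (((u - g z) *m L x) ord0 i)%:E.
  rewrite (eq_integral (fun z => \sum_l (w l i z)%:E)); last first.
    by move=> z _; rewrite sumEFin mxE; congr EFin; apply: eq_bigr => l _; rewrite !mxE.
  rewrite integral_sum//; under [RHS]eq_bigr do rewrite wE.
  by rewrite sumEFin mxE mulr_sumr; congr EFin; apply: eq_bigr => l _; rewrite !mxE.
apply: le_trans (le_abse_integral _ _ _) _ => //.
by apply: (@measurable_funS _ _ _ _ setT) => //; exact/measurable_EFinP.
Qed.

(** Contains the differences of any two points of the same cube or of adjacent
    cubes of side [2 ^ (- j)]. *)
Definition shift_box (j : int) : set T :=
  [set y : T | forall i, (- (2 * 2 ^ (- j)) <= y ord0 i < 2 * 2 ^ (- j))%R].

Lemma lebesgue_shift_box j : mu (shift_box j) = ((4 * 2 ^ (- j)) ^+ n)%:E.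
Proof.
rewrite /shift_box lebesgue_rV_box; last first.
  by move=> i; have := dyadic_side_gt0 R j; lra.
congr EFin; under eq_bigr do rewrite opprK.
by rewrite prodr_const card_ord; congr (_ ^+ _)%R; ring.
Qed.

Lemma measurable_shift_box j : measurable (shift_box j).
Proof. exact: measurable_box. Qed.

Definition oscillation (j : int) (g : T -> 'rV[R]_m) (x : T) : \bar R :=
  \int[mu]_(y in shift_box j) (rho x (g x - g (x + y)))%:E.

(** The substitution [z = x + y] turns the integral over the cube [k1] into one over
    shifts [y], which lie in [shift_box j] since the cubes [k0] and [k1] touch. *)
Lemma rho_sub_average_le j (k0 k1 : 'rV[int]_n) x g : measurable_fun setT g ->
  cube_integrable g -> dyadic_cube j k0 x ->
  (forall i, (`|k1 ord0 i - k0 ord0 i| <= 1)%R) ->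
  ((2 ^ (- j)) ^+ n * rho x (g x - cube_average j k1 g))%R%:E <=
  oscillation j g x.
Proof.
move=> mg ig k0x k01.
have mrho (h : T -> T) : measurable_fun setT h ->
    measurable_fun setT (fun z => (rho x (g x - g (h z)))%:E).
  move=> mh; apply/measurable_EFinP; apply: measurable_rho => //.
  by apply: measurable_rVB => //; exact: measurableT_comp.
apply: (le_trans (rho_sub_average x (g x) j k1 mg ig)).
rewrite (@integral_shift _ _ x)//; last 3 first.
- exact: measurable_dyadic.
- apply: (@measurable_funS _ _ _ _ setT) => //; exact: (mrho idfun (@measurable_id _ _ _)).
- by move=> z; rewrite lee_fin rho_ge0.
apply: ge0_subset_integral.
- rewrite -[X in measurable X]setTI; apply: measurable_shift => //.
  exact: measurable_dyadic.
- exact: measurable_shift_box.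
- apply: measurable_funS (mrho (fun y => x + y)%R _) => //.
  exact: measurable_shift.
- by move=> y _; rewrite lee_fin rho_ge0.
- move=> y /= yk i; have := yk i; have := k0x i; rewrite mxE.
  have := dyadic_side_gt0 R j; set s : R := (2 ^ (- j))%R => s0.
  have : (`|(k1 ord0 i)%:~R - (k0 ord0 i)%:~R| <= 1 :> R)%R.
    by rewrite -intrB -intr_norm lerz1 k01.
  rewrite !intrD ler_norml => /andP[].
  move: (x ord0 i) (y ord0 i) ((k1 ord0 i)%:~R : R) ((k0 ord0 i)%:~R : R).
  by move=> a b c e h1 h2 /andP[h3 h4] /andP[h5 h6]; apply/andP; split; nra.
Qed.

Lemma measurable_oscillation j g : measurable_fun setT g ->
  measurable_fun setT (oscillation j g).
Proof.
move=> mg.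
apply: (@measurable_integral_on1 _ _ _ _ _ mu (shift_box j)
  (fun z => (rho z.1 (g z.1 - g (z.1 + z.2)%R))%:E)).
- exact: measurable_shift_box.
- apply/measurable_EFinP; apply: measurable_rho; first exact: measurable_fst.
  apply: measurable_rVB; apply: (measurableT_comp mg).
    exact: measurable_fst.
  exact: measurable_rV_add.
- by move=> z; rewrite lee_fin rho_ge0.
Qed.

End seminorm_field.

(** * Finite colourings from equicontinuity *)

(** What the compactness argument requires of a norm.  The constants 16 and 4 are
    those of [mixed_normD_le] and [mixed_norm_average]. *)
Record lattice_quasinorm (R : realType) (n : nat)
    (N : ('rV[R]_n -> \bar R) -> \bar R) : Prop := LatticeQuasinorm {
  lq_ge0 : forall h, (0 <= N h)%E;
  lq_le : forall h1 h2, measurable_fun setT h1 -> measurable_fun setT h2 ->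
    (forall x, (0 <= h1 x)%E) -> (forall x, (h1 x <= h2 x)%E) -> (N h1 <= N h2)%E;
  lq_add : forall h1 h2, measurable_fun setT h1 -> measurable_fun setT h2 ->
    (forall x, (0 <= h1 x)%E) -> (forall x, (0 <= h2 x)%E) ->
    (N (fun x => h1 x + h2 x) <= 16%:E * (N h1 + N h2))%E;
  lq_scale : forall h (k : R), measurable_fun setT h ->
    (forall x, (0 <= h x)%E) -> 0 <= k -> (N (fun x => k%:E * h x) <= k%:E * N h)%E;
  lq_average : forall (H : 'rV[R]_n * 'rV[R]_n -> \bar R) B (V E : R),
    measurable_fun setT H -> (forall z, (0 <= H z)%E) ->
    measurable B -> lebesgue_rV R n B = V%:E -> 0 < V -> 0 <= E ->
    (forall y, B y -> (N (fun x => H (x, y)) <= E%:E)%E) ->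
    (N (fun x => \int[lebesgue_rV R n]_(y in B) H (x, y)) <= (4 * V * E)%:E)%E;
  lq_pos : forall j k h, measurable_fun setT h -> (forall x, (0 <= h x)%E) ->
    (forall x, dyadic_cube j k x -> (0 < h x)%E) -> (0 < N h)%E }.

Section quasinorm.
Context (R : realType) (n : nat) (N : ('rV[R]_n -> \bar R) -> \bar R).
Hypothesis NP : lattice_quasinorm N.
Local Open Scope ereal_scope.
Local Notation T := 'rV[R]_n.
Local Notation Nr h := (N (fun x => (h x)%:E)).

Lemma Nr_le (h1 h2 : T -> R) : measurable_fun setT h1 -> measurable_fun setT h2 ->
  (forall x, (0 <= h1 x)%R) -> (forall x, (h1 x <= h2 x)%R) -> Nr h1 <= Nr h2.
Proof.
move=> m1 m2 h10 h12; apply: (lq_le NP).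
- exact/measurable_EFinP.
- exact/measurable_EFinP.
- by move=> x; rewrite lee_fin.
- by move=> x; rewrite lee_fin.
Qed.

Lemma Nr_add (h1 h2 : T -> R) : measurable_fun setT h1 -> measurable_fun setT h2 ->
  (forall x, (0 <= h1 x)%R) -> (forall x, (0 <= h2 x)%R) ->
  Nr (fun x => (h1 x + h2 x)%R) <= 16%:E * (Nr h1 + Nr h2).
Proof.
move=> m1 m2 h10 h20; apply: (lq_add NP (h1 := fun x => (h1 x)%:E) (h2 := fun x => (h2 x)%:E)).
- exact/measurable_EFinP.
- exact/measurable_EFinP.
- by move=> x; rewrite lee_fin.
- by move=> x; rewrite lee_fin.
Qed.

Lemma Nr_add_le (h1 h2 : T -> R) (e1 e2 : R) :
  measurable_fun setT h1 -> measurable_fun setT h2 ->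
  (forall x, (0 <= h1 x)%R) -> (forall x, (0 <= h2 x)%R) ->
  Nr h1 <= e1%:E -> Nr h2 <= e2%:E ->
  Nr (fun x => (h1 x + h2 x)%R) <= (16 * (e1 + e2))%:E.
Proof.
move=> m1 m2 h10 h20 H1 H2; apply: (le_trans (Nr_add m1 m2 h10 h20)).
by rewrite (EFinM 16) (EFinD e1); apply: lee_wpmul2l => //; exact: leeD.
Qed.

Lemma Nr_scale (h : T -> R) (k : R) : measurable_fun setT h ->
  (forall x, (0 <= h x)%R) -> (0 <= k)%R -> Nr (fun x => (k * h x)%R) <= k%:E * Nr h.
Proof.
move=> mh h0 k0; apply: (lq_scale NP (h := fun x => (h x)%:E)) => //.
exact/measurable_EFinP.
Qed.

Lemma N_zero : N (fun=> 0) <= 0.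
Proof.
have := @Nr_scale (fun=> 0%R) 0%R (measurable_cst _) (fun=> lexx _) (lexx _).
rewrite mul0e.
by rewrite (_ : (fun _ : T => (0 * 0)%:E) = (fun=> 0))//; apply/funext => x; rewrite mul0r.
Qed.

(** The constant of the quasi-triangle inequality is paid once per term, so the
    smallness required of the terms depends on their number. *)
Lemma Nr_sum (K : eqType) (s : seq K) (e : R) : (0 < e)%R ->
  exists2 d : R, (0 < d)%R & forall h : K -> T -> R,
    (forall k, measurable_fun setT (h k)) -> (forall k x, (0 <= h k x)%R) ->
    (forall k, Nr (h k) <= d%:E) -> Nr (fun x => (\sum_(k <- s) h k x)%R) <= e%:E.
Proof.
elim: s e => [|a s IH] e e0.
  exists 1%R => // h _ _ _.
  rewrite (_ : (fun x => _) = (fun=> 0)); last by apply/funext => x; rewrite big_nil.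
  by apply: (le_trans N_zero); rewrite lee_fin ltW.
have [|d d0 Hd] := IH (e / 32)%R; first by rewrite divr_gt0.
exists (Num.min d (e / 32)%R); first by rewrite lt_min d0 divr_gt0.
move=> h mh h0 Hh.
rewrite (_ : (fun x => _) = (fun x => (h a x + \sum_(k <- s) h k x)%R%:E)); last first.
  by apply/funext => x; rewrite big_cons.
apply: (@le_trans _ _ (16 * (e / 32 + e / 32))%:E); last first.
  by rewrite lee_fin le_eqVlt; apply/orP; left; apply/eqP; field.
apply: Nr_add_le => //.
- exact: measurable_sum.
- by move=> x; exact: sumr_ge0.
- by apply: (le_trans (Hh a)); rewrite lee_fin ge_min lexx orbT.
- apply: Hd => // k; apply: (le_trans (Hh k)).
  by rewrite lee_fin ge_min lexx.
Qed.
End quasinorm.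

(** The arithmetic of the final estimate: [x] is the bound of the tails, [z] that
    of the oscillations and [d] that of the differences of averages. *)
Lemma budget_le (R : realType) (e d x z : R) : x <= z ->
  e = 8 * (16 * (16 * (16 * z))) -> e = 4 * (16 * (16 * d)) -> 0 < e ->
  16 * (16 * (x + x) + 16 * (16 * (z + z) + d)) <= e.
Proof. by move=> xz e1 e2 e0; lra. Qed.

Section compactness.
Context (R : realType) (n' m : nat).
Local Notation n := n'.+1.
Local Notation T := 'rV[R]_n.
Local Notation mu := (lebesgue_rV R n).
Variables (N : (T -> \bar R) -> \bar R) (NP : lattice_quasinorm N).
Let N0 : forall h, (0 <= N h)%E := lq_ge0 NP.
Variables (L : T -> 'M[R]_m) (lam : T -> R).
Hypothesis mL : forall i j, measurable_fun setT (fun x => L x i j).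
Hypothesis mlam : measurable_fun setT lam.
Hypothesis lam0 : forall x, 0 < lam x.
Hypothesis lam_le : forall x v, lam x * norm1 v <= rho L x v.
Variables (Idx : Type) (F : set Idx) (G : Idx -> T -> 'rV[R]_m).
Hypothesis mG : forall f, F f -> measurable_fun setT (G f).
Hypothesis iG : forall f, F f -> cube_integrable (G f).
Local Open Scope ereal_scope.
Local Notation Nr h := (N (fun x => (h x)%:E)).
Local Notation rho := (rho L).
Hypothesis fG : forall f, F f -> Nr (fun x => rho x (G f x)) < +oo.

Let mind j (k : 'rV[int]_n) : measurable_fun setT (\1_(@dyadic_cube R n j k) : T -> R).
Proof. by apply: measurable_indic; exact: measurable_dyadic. Qed.

Let mcut (A : set T) (u : T -> 'rV[R]_m) : measurable A -> measurable_fun setT u ->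
  measurable_fun setT (fun x => \1_A x * rho x (u x))%R.
Proof.
move=> mA mu'; apply: measurable_funM; first exact: measurable_indic.
exact: measurable_rho.
Qed.

Let cut0 (A : set T) (u : T -> 'rV[R]_m) x : (0 <= \1_A x * rho x (u x))%R.
Proof. by rewrite mulr_ge0// rho_ge0. Qed.

Section fixed_scale.
Variables (j : int) (E : R).
Hypothesis E0 : (0 < E)%R.
Hypothesis oscE : forall f, F f -> forall y, shift_box j y ->
  Nr (fun x => rho x (G f x - G f (x + y)%R)) <= E%:E.
Local Notation V := ((2 ^ (- j)) ^+ n : R)%R.
Local Notation P := (@dyadic_cube R n j).
Local Notation avg k f := (cube_average j k (G f)).
Definition C1 : R := (4 * 4 ^+ n)%R.

Let C1_ge1 : (1 <= C1)%R.
Proof.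
have : (1 <= 4 ^+ n :> R)%R by rewrite exprn_ege1// ler1n.
by rewrite /C1; lra.
Qed.

Let V0 : (0 < V)%R. Proof. by rewrite exprn_gt0// dyadic_side_gt0. Qed.

(** The norm of a mean over [shift_box j] is at most 4 times the bound of the
    slices; the mean is normalized by the volume of a cube instead of that of the
    box, which is [4 ^+ n] times larger. *)
Lemma N_oscillation f : F f ->
  N (fun x => V^-1%:E * oscillation L j (G f) x) <= (C1 * E)%:E.
Proof.
move=> Ff; have mo := measurable_oscillation mL j (mG Ff).
have o0 x : 0 <= oscillation L j (G f) x.
  by apply: integral_ge0 => y _; rewrite lee_fin rho_ge0.
apply: (le_trans (lq_scale NP mo o0 _)); first by rewrite invr_ge0 ltW.
have -> : (C1 * E = V^-1 * (4 * (4 * 2 ^ (- j)) ^+ n * E))%R.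
  by rewrite /C1 exprMn; field; rewrite gt_eqF.
rewrite [leRHS]EFinM; apply: lee_wpmul2l; first by rewrite lee_fin invr_ge0 ltW.
apply: (@lq_average _ _ _ NP (fun z => (rho z.1 (G f z.1 - G f (z.1 + z.2)%R))%:E)).
- apply/measurable_EFinP; apply: (measurable_rho mL); first exact: measurable_fst.
  apply: measurable_rVB; apply: (measurableT_comp (mG Ff)).
    exact: measurable_fst.
  exact: measurable_rV_add.
- by move=> z; rewrite lee_fin rho_ge0.
- exact: measurable_shift_box.
- exact: lebesgue_shift_box.
- by rewrite exprn_gt0// mulr_gt0// dyadic_side_gt0.
- exact: ltW.
- by move=> y; exact: oscE.
Qed.

Lemma rho_avg_le_osc f (k0 k1 : 'rV[int]_n) x : F f -> P k0 x ->
  (forall i, (`|k1 ord0 i - k0 ord0 i| <= 1)%R) ->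
  (rho x (G f x - avg k1 f))%:E <= V^-1%:E * oscillation L j (G f) x.
Proof.
move=> Ff Px k01.
have := rho_sub_average_le mL (mG Ff) (iG Ff) Px k01.
move/(lee_wpmul2l (_ : 0 <= V^-1%:E)); rewrite lee_fin invr_ge0 (ltW V0) => /(_ isT).
by rewrite -EFinM mulKf// gt_eqF.
Qed.

Lemma N_cube_dev f (k0 k1 : 'rV[int]_n) : F f ->
  (forall i, (`|k1 ord0 i - k0 ord0 i| <= 1)%R) ->
  Nr (fun x => \1_(P k0) x * rho x (G f x - avg k1 f))%R <= (C1 * E)%:E.
Proof.
move=> Ff k01; apply: le_trans (N_oscillation Ff).
apply: (lq_le NP).
- apply/measurable_EFinP; apply: mcut; first exact: measurable_dyadic.
  by apply: measurable_rVB; [exact: mG|exact: measurable_cst].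
- by apply: measurable_funeM; apply: (measurable_oscillation mL); exact: mG.
- by move=> x; rewrite lee_fin mulr_ge0 ?rho_ge0.
- move=> x; rewrite indicE; case: (boolP (x \in P k0)) => [/set_mem Px|_]; last first.
    rewrite mul0r mule_ge0// ?lee_fin ?invr_ge0 ?(ltW V0)//.
    by apply: integral_ge0 => y _; rewrite lee_fin rho_ge0.
  by rewrite mul1r; exact: rho_avg_le_osc Px k01.
Qed.

(** The value can be [+oo]: constants need not have locally finite norm. *)
Definition cube_seminorm k v := Nr (fun x => \1_(P k) x * rho x v)%R.

(** [lam] bounds [rho] below and is positive, so that its restriction to the cube has
    positive norm. *)
Lemma cube_seminorm_lower k : exists2 c : R, (0 < c)%R &
  forall v, (c * norm1 v)%:E <= cube_seminorm k v.
Proof.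
pose h x : R := (\1_(P k) x * lam x)%R.
have mh : measurable_fun setT h by apply: measurable_funM.
have h0 x : (0 <= h x)%R by rewrite /h mulr_ge0// ltW.
have Nh : 0 < Nr h.
  apply: (lq_pos NP (j := j) (k := k)).
  - exact/measurable_EFinP.
  - by move=> x; rewrite lee_fin.
  - by move=> x Px; rewrite lte_fin /h indicE mem_set// mul1r.
have [c c0 cN] : exists2 c : R, (0 < c)%R & c%:E <= Nr h.
  case: (Nr h) Nh => [c| |]//; first by rewrite lte_fin => c0; exists c.
  by exists 1%R => //; rewrite leey.
exists c => // v; have [v0|v0] := eqVneq (norm1 v) 0%R.
  by rewrite v0 mulr0; exact: N0.
have {}v0 : (0 < norm1 v)%R by rewrite lt_neqAle eq_sym v0 norm1_ge0.
have mv : measurable_fun setT (fun x => norm1 v * h x)%R.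
  by apply: measurable_funM => //; exact: measurable_cst.
have : Nr (fun x => norm1 v * h x)%R <= cube_seminorm k v.
  apply: (Nr_le NP) => //.
  - by apply: mcut; [exact: measurable_dyadic|exact: measurable_cst].
  - by move=> x; rewrite mulr_ge0// ltW.
  - move=> x; rewrite /h mulrCA; apply: ler_wpM2l => //.
    by rewrite mulrC; exact: lam_le.
apply: le_trans.
have := Nr_scale NP mv (fun x => mulr_ge0 (ltW v0) (h0 x)) (_ : 0 <= (norm1 v)^-1)%R.
rewrite invr_ge0 (ltW v0) => /(_ isT).
under [X in N X]eq_fun do rewrite mulKf ?gt_eqF//.
move/(le_trans cN)/(lee_wpmul2l (_ : 0 <= (norm1 v)%:E)).
rewrite lee_fin (ltW v0) => /(_ isT).
by rewrite muleA -!EFinM mulfV ?gt_eqF// mul1e mulrC.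
Qed.

Lemma cube_seminormD k u v :
  cube_seminorm k (u + v)%R <= 16%:E * (cube_seminorm k u + cube_seminorm k v).
Proof.
have mk w : measurable_fun setT (fun x => \1_(P k) x * rho x w)%R.
  by apply: mcut; [exact: measurable_dyadic|exact: measurable_cst].
apply: le_trans (Nr_add NP (mk u) (mk v) (cut0 _ _) (cut0 _ _)).
apply: (Nr_le NP) => //.
- exact: measurable_funD.
- by move=> x; exact: cut0.
by move=> x; rewrite -mulrDr; apply: ler_wpM2l => //; exact: rhoD.
Qed.

Lemma cube_seminormZ k a v : cube_seminorm k (a *: v)%R <= `|a|%:E * cube_seminorm k v.
Proof.
have mk w : measurable_fun setT (fun x => \1_(P k) x * rho x w)%R.
  by apply: mcut; [exact: measurable_dyadic|exact: measurable_cst].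
apply: le_trans (Nr_scale NP (mk v) (cut0 _ _) (normr_ge0 a)).
apply: (Nr_le NP) => //.
- by apply: measurable_funM => //; exact: measurable_cst.
- by move=> x; exact: cut0.
by move=> x; rewrite rhoZ mulrCA.
Qed.

Lemma cube_seminorm_avg f k (B : R) : F f ->
  Nr (fun x => \1_(P k) x * rho x (G f x))%R <= B%:E ->
  cube_seminorm k (avg k f) <= (16 * (B + C1 * E))%:E.
Proof.
move=> Ff HB.
have dev : Nr (fun x => \1_(P k) x * rho x (G f x - avg k f))%R <= (C1 * E)%:E.
  by apply: N_cube_dev => // i; rewrite subrr normr0.
have mk u : measurable_fun setT u -> measurable_fun setT (fun x => \1_(P k) x * rho x (u x))%R.
  by apply: mcut; exact: measurable_dyadic.
have mB : measurable_fun setT (fun x => G f x - avg k f)%R.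
  by apply: measurable_rVB; [exact: mG|exact: measurable_cst].
apply: le_trans (Nr_add_le NP (mk _ (mG Ff)) (mk _ mB) (cut0 _ _) (cut0 _ _) HB dev).
apply: (Nr_le NP) => //.
- by apply: mk; exact: measurable_cst.
- by apply: measurable_funD; apply: mk => //; exact: mG.
- by move=> x; exact: cut0.
- move=> x; rewrite -mulrDr; apply: ler_wpM2l => //.
  by rewrite -[X in (X <= _)%R]rhoN -[X in (rho x X <= _)%R]sub0r (le_trans (rho_sub_le _ _ _ _ (G f x)))// sub0r rhoN.
Qed.

Variable a : R.
(** Stated with the sup norm, so that a cube lies in it as soon as one coordinate of
    its index is large. *)
Definition far : set T := [set x : T | exists i, (a <= `|x ord0 i|)%R].
Hypothesis farE : forall f, F f ->
  Nr (fun x => \1_far x * rho x (G f x))%R <= E%:E.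

Lemma measurable_far : measurable far.
Proof.
rewrite (_ : far = \bigcup_(i in [set: 'I_n])
    ((fun x : T => `|x ord0 i|%R) @^-1` [set` `[a, +oo[%R])).
  apply: fin_bigcup_measurable => // i _.
  rewrite -[X in measurable X]setTI.
  have : measurable_fun setT (fun x : T => `|x ord0 i|%R).
    by apply: measurableT_comp; [exact: normr_measurable|exact: measurable_coord].
  by apply.
apply/seteqP; split => [x [i xi]|x [i _]]; first by exists i => //=; rewrite in_itv/= xi.
by rewrite /= in_itv/= andbT => xi; exists i.
Qed.

Let mfar : measurable far := measurable_far.

(** On a cube inside [far] the average is controlled by the smallness at infinity.
    From any other cube such a cube is reached by steps in the first direction, and
    each step changes the average by an amount controlled by the oscillation,
    because [cube_seminorm] dominates [norm1]. *)
Lemma avg_bounded (k : 'rV[int]_n) :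
  exists M : R, forall f, F f -> (norm1 (avg k f) <= M)%R.
Proof.
pose sh (k : 'rV[int]_n) : 'rV[int]_n := (k + delta_mx ord0 ord0)%R.
have base (k' : 'rV[int]_n) : (a <= 2 ^ (- j) * (k' ord0 ord0)%:~R)%R ->
    exists M : R, forall f, F f -> (norm1 (avg k' f) <= M)%R.
  move=> ak; have [c c0 Hc] := cube_seminorm_lower k'.
  exists (c^-1 * (16 * (E + C1 * E)))%R => f Ff.
  rewrite -ler_pdivrMl ?invr_gt0// invrK -lee_fin.
  apply: (le_trans (Hc _)); apply: cube_seminorm_avg => //.
  apply: le_trans (farE Ff); apply: (Nr_le NP) => //.
  - by apply: mcut; [exact: measurable_dyadic|exact: mG].
  - by apply: mcut => //; exact: mG.
  - move=> x; rewrite ler_wpM2r ?rho_ge0// !indicE.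
    case: (boolP (x \in P k')) => [/set_mem Px|_]; last by rewrite ler0n.
    rewrite mem_set//; exists ord0; apply: (le_trans ak).
    by have /andP[+ _] := Px ord0; move/le_trans; apply; exact: ler_norm.
have step (k' : 'rV[int]_n) : (exists M : R, forall f, F f -> (norm1 (avg (sh k') f) <= M)%R) ->
    exists M : R, forall f, F f -> (norm1 (avg k' f) <= M)%R.
  move=> [M HM]; have [c c0 Hc] := cube_seminorm_lower k'.
  exists (M + c^-1 * (16 * (C1 * E + C1 * E)))%R => f Ff.
  have tri : (norm1 (avg k' f) <= norm1 (avg (sh k') f) + norm1 (avg k' f - avg (sh k') f))%R.
    rewrite -big_split; apply: ler_sum => i _ /=.
    by rewrite -{1}(subrK (avg (sh k') f) (avg k' f)) [in leLHS]mxE addrC ler_normD.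
  apply: (le_trans tri); apply: lerD; first exact: HM.
  rewrite -ler_pdivrMl ?invr_gt0// invrK -lee_fin.
  apply: (le_trans (Hc _)).
  have mB u : measurable_fun setT (fun x => \1_(P k') x * rho x (G f x - u))%R.
    apply: mcut; first exact: measurable_dyadic.
    by apply: measurable_rVB; [exact: mG|exact: measurable_cst].
  apply: (@le_trans _ _ (Nr (fun x => \1_(P k') x * rho x (G f x - avg k' f) +
      \1_(P k') x * rho x (G f x - avg (sh k') f))%R)).
    apply: (Nr_le NP) => //.
    - by apply: mcut; [exact: measurable_dyadic|exact: measurable_cst].
    - exact: measurable_funD.
    - by move=> x; exact: cut0.
    - move=> x; rewrite -mulrDr; apply: ler_wpM2l => //.
      apply: (le_trans (rho_sub_le _ _ _ _ (G f x))); rewrite lerD2r.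
      by rewrite -rhoN opprB.
  have k00 i : (`|k' ord0 i - k' ord0 i| <= 1)%R by rewrite subrr normr0.
  have k01 i : (`|sh k' ord0 i - k' ord0 i| <= 1)%R.
    by rewrite !mxE addrAC subrr add0r; case: (_ && _).
  by refine (Nr_add_le NP (mB _) (mB _) _ _ (N_cube_dev Ff k00) (N_cube_dev Ff k01)) => x; rewrite mulr_ge0 ?rho_ge0.
have [p Hp] : exists p : nat, (a <= 2 ^ (- j) * (k ord0 ord0 + p%:Z)%:~R)%R.
  have s0 := dyadic_side_gt0 R j.
  pose b := (a / 2 ^ (- j) - (k ord0 ord0)%:~R)%R : R.
  exists (Num.truncn b).+1.
  rewrite -ler_pdivrMl// mulrC intrD -lerBlDl.
  by apply: ltW; rewrite -pmulrn; exact: truncnS_gt.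
elim: p k Hp => [|p IH] k Hp; first by apply: base; rewrite addr0 in Hp.
apply: step; apply: IH; rewrite /sh !mxE eqxx /=.
by rewrite -addrA -intS.
Qed.

(** The averages are bounded, so rounding their coordinates leaves finitely many
    possibilities.  Two averages with the same rounding are close for [norm1], and
    also for [cube_seminorm]: their difference has finite seminorm, and
    [finite_seminorm_bounded] applies. *)
Lemma cube_colouring (k : 'rV[int]_n) (d : R) : (0 < d)%R ->
  exists (K : nat) (c : Idx -> nat), (forall f, (c f <= K)%N) /\
    forall f g, F f -> F g -> c f = c g ->
      cube_seminorm k (avg k f - avg k g)%R <= d%:E.
Proof.
move=> d0; have [M HM] := avg_bounded k.
have [C C0 HC] := @finite_seminorm_bounded _ _ (cube_seminorm k) (fun v => N0 _)
  (cube_seminormD k) (cube_seminormZ k).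
pose e := (d / ((C + 1) * (m%:R + 1)))%R.
have e0 : (0 < e)%R by rewrite divr_gt0// mulr_gt0// ltr_wpDl.
have [K [c Hc]] := real_colouring M e0.
pose cc f : {ffun 'I_m -> 'I_K.+1} := [ffun i => c (avg k f ord0 i)].
exists #|{ffun 'I_m -> 'I_K.+1}|, (fun f => nat_of_ord (enum_rank (cc f))); split.
  by move=> f; exact: ltnW.
move=> f g Ff Fg /val_inj/enum_rank_inj/ffunP ccE.
have avgfin h : F h -> cube_seminorm k (avg k h) < +oo.
  move=> Fh; have := fG Fh.
  have : 0 <= Nr (fun x => rho x (G h x)) by [].
  case E' : (Nr (fun x => rho x (G h x))) => [B| |]// _ _.
  have /le_lt_trans : cube_seminorm k (avg k h) <= (16 * (B + C1 * E))%:E.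
    apply: cube_seminorm_avg => //; rewrite -E'; apply: (Nr_le NP) => //.
    - by apply: mcut; [exact: measurable_dyadic|exact: mG].
    - by apply: (measurable_rho mL) => //; exact: mG.
    - by move=> x; rewrite ler_piMl ?rho_ge0// indicE; case: (_ \in _).
  by apply; rewrite ltry.
apply: (@le_trans _ _ (C * norm1 (avg k f - avg k g))%:E).
  apply: HC; apply: (le_lt_trans (cube_seminormD _ _ _)).
  have gfin : cube_seminorm k (- avg k g)%R < +oo.
    rewrite -scaleN1r; apply: (le_lt_trans (cube_seminormZ _ _ _)).
    by rewrite normrN1 mul1e; exact: avgfin.
  by apply: lte_mul_pinfty => //; rewrite lte_add_pinfty// avgfin.
rewrite lee_fin.
have norm_le i h : F h -> (`|avg k h ord0 i| <= M)%R.
  move=> Fh; apply: le_trans (HM _ Fh).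
  by rewrite /norm1 (bigD1 i)//= lerDl sumr_ge0.
have : (norm1 (avg k f - avg k g) <= m%:R * e)%R.
  apply: (@le_trans _ _ (\sum_(i < m) e)%R); last first.
    by rewrite sumr_const card_ord mulr_natl lexx.
  apply: ler_sum => i _.
  have -> : ((avg k f - avg k g) ord0 i = avg k f ord0 i - avg k g ord0 i)%R.
    by rewrite [LHS]mxE [X in (_ + X)%R]mxE.
  apply: Hc; [exact: norm_le..|].
  by have := ccE i; rewrite !ffunE.
move/(ler_wpM2l C0)/le_trans; apply.
rewrite /e mulrA mulrA ler_pdivrMr ?mulr_gt0 ?ltr_wpDl//.
have -> : (C * (m%:R * d) = d * (C * m%:R))%R by ring.
apply: ler_wpM2l; first exact: ltW.
by have : (0 <= m%:R :> R)%R by []; nra.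
Qed.

(** Off [far], which the finitely many cubes around the origin cover, [G f - G g] is
    the sum of the deviations of [G f] and [G g] from their averages and of the
    difference of the averages.  The deviations are added up over the cubes before
    the norm is taken, so that the bound [C1 * E] is paid once and not once for
    every cube. *)
Lemma same_colour_close (Lb : nat) : (a <= Lb%:R * 2 ^ (- j))%R ->
  forall d : R, (0 < d)%R ->
  exists (C : finType) (cls : Idx -> C), forall f g, F f -> F g -> cls f = cls g ->
    Nr (fun x => rho x (G f x - G g x)) <=
      (16 * (16 * (E + E) + 16 * (16 * (C1 * E + C1 * E) + d)))%:E.
Proof.
move=> aL d d0; pose K := {ffun 'I_n -> 'I_(2 * Lb)}.
pose kk (q : K) : 'rV[int]_n := (\row_i ((q i : nat)%:Z - Lb%:Z))%R.
(* [d1] is the precision needed on each cube for the sum over the cubes to be at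
     most [d] *)
have [d1 d10 Hsum] := Nr_sum NP (index_enum K) d0.
have /choice[Kf HK] : forall q, exists z : nat * (Idx -> nat),
    (forall f, (z.2 f <= z.1)%N) /\
    forall f g, F f -> F g -> z.2 f = z.2 g ->
      cube_seminorm (kk q) (avg (kk q) f - avg (kk q) g)%R <= d1%:E.
  by move=> q; have [B [c Hc]] := cube_colouring (kk q) d10; exists (B, c).
(* a common bound for the colours of all the cubes *)
pose B := (\sum_q (Kf q).1)%N.
exists {ffun K -> 'I_B.+1}, (fun f => [ffun q => inord ((Kf q).2 f)]).
move=> f g Ff Fg /ffunP clsE.
have qclose q : cube_seminorm (kk q) (avg (kk q) f - avg (kk q) g)%R <= d1%:E.
  have [Hb Hc] := HK q; apply: Hc => //.
  have /(congr1 val) := clsE q; rewrite !ffunE /= !inordK// ltnS.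
    by apply: leq_trans (Hb g) _; rewrite /B (bigD1 q)//= leq_addr.
  by apply: leq_trans (Hb f) _; rewrite /B (bigD1 q)//= leq_addr.
pose al h x : R := (\1_far x * rho x (G h x))%R.
pose be h x : R := (\sum_q \1_(P (kk q)) x * rho x (G h x - avg (kk q) h))%R.
pose ga q x : R := (\1_(P (kk q)) x * rho x (avg (kk q) f - avg (kk q) g))%R.
have mB h q : F h -> measurable_fun setT (fun x => \1_(P (kk q)) x * rho x (G h x - avg (kk q) h))%R.
  move=> Fh; apply: mcut; first exact: measurable_dyadic.
  by apply: measurable_rVB; [exact: mG|exact: measurable_cst].
have mal h : F h -> measurable_fun setT (al h) by move=> Fh; apply: mcut => //; exact: mG.
have mbe h : F h -> measurable_fun setT (be h).
  by move=> Fh; apply: measurable_sum => q; exact: mB.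
have mga q : measurable_fun setT (ga q).
  by apply: mcut; [exact: measurable_dyadic|exact: measurable_cst].
have al0 h x : (0 <= al h x)%R by rewrite /al mulr_ge0// rho_ge0.
have be0 h x : (0 <= be h x)%R.
  by apply: sumr_ge0 => q _; rewrite mulr_ge0// rho_ge0.
have ga0 q x : (0 <= ga q x)%R by rewrite /ga mulr_ge0// rho_ge0.
have kk_inj x q q' : P (kk q) x -> P (kk q') x -> q = q'.
  move=> /dyadic_cubeP e1 /dyadic_cubeP; rewrite e1 => /rowP kE.
  apply/ffunP => i; apply: val_inj.
  by have := kE i; rewrite /kk !mxE => /addIr [].
have bound h : F h -> Nr (be h) <= (C1 * E)%:E.
  move=> Fh; apply: le_trans (N_oscillation Fh); apply: (lq_le NP).
  - by apply/measurable_EFinP; exact: mbe.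
  - by apply: measurable_funeM; apply: (measurable_oscillation mL); exact: mG.
  - by move=> x; rewrite lee_fin.
  - move=> x; have [[q Pq]|no] := pselect (exists q, P (kk q) x).
      rewrite /be (bigD1 q)//= indicE mem_set// mul1r big1 ?addr0.
        by apply: rho_avg_le_osc Pq _ => // i; rewrite subrr normr0.
      move=> q' q'q; rewrite indicE memNset ?mul0r// => Pq'.
      by move/eqP: q'q; apply; exact: kk_inj Pq' Pq.
    rewrite /be big1; last first.
      by move=> q _; rewrite indicE memNset ?mul0r// => Pq; apply: no; exists q.
    rewrite mule_ge0// ?lee_fin ?invr_ge0 ?(ltW V0)//.
    by apply: integral_ge0 => y _; rewrite lee_fin rho_ge0.
(* either [x] is far, or it lies in one of the cubes [kk q] *)
have cover x : (rho x (G f x - G g x) <=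
    (al f x + al g x) + ((be f x + be g x) + \sum_q ga q x))%R.
  have S0 : (0 <= \sum_q ga q x)%R by exact: sumr_ge0.
  have [fx|nfx] := pselect (far x).
    apply: (@le_trans _ _ (al f x + al g x)%R); last first.
      rewrite lerDl.
      exact: (addr_ge0 (addr_ge0 (be0 f x) (be0 g x)) S0).
    rewrite /al !indicE mem_set// !mul1r -(rhoN _ _ (G g x)); exact: rhoD.
  have [q Pq] : exists q, P (kk q) x.
    have s0 := dyadic_side_gt0 R j.
    pose b i : int := (Num.floor (x ord0 i / 2 ^ (- j)) + Lb%:Z)%R.
    have bb i : (0 <= b i < (2 * Lb)%N%:Z)%R.
      have : (`|x ord0 i| < Lb%:R * 2 ^ (- j))%R.
        apply: lt_le_trans aL; rewrite ltNge; apply/negP => ai.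
        by apply: nfx; exists i.
      rewrite ltr_norml => /andP[h1 h2]; rewrite /b mul2n -addnn PoszD ltrD2r.
      rewrite floor_lt_int -lerBlDr sub0r floor_ge_int_tmp ltr_pdivrMr// ler_pdivlMr//.
      by rewrite mulrNz mulNr -!pmulrn h2 ltW.
    have pf i : (`|b i|%N < 2 * Lb)%N.
      by have /andP[b0 b1] := bb i; rewrite -ltz_nat gez0_abs.
    exists [ffun i => Ordinal (pf i)]; apply/dyadic_cubeP/rowP => i.
    have /andP[b0 _] := bb i.
    by rewrite /kk !mxE ffunE /= gez0_abs// /b addrK.
  apply: (@le_trans _ _ (be f x + be g x + \sum_q ga q x)%R); last first.
    by rewrite lerDr addr_ge0.
  have be_q h : (rho x (G h x - avg (kk q) h) <= be h x)%R.
    rewrite /be (bigD1 q)//= indicE mem_set// mul1r lerDl.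
    by apply: sumr_ge0 => q' _; rewrite mulr_ge0// rho_ge0.
  have ga_q : (rho x (avg (kk q) f - avg (kk q) g) <= \sum_q ga q x)%R.
    by rewrite (bigD1 q)//= {1}/ga indicE mem_set// mul1r lerDl sumr_ge0.
  apply: (@le_trans _ _ (rho x (G f x - avg (kk q) f) + rho x (G g x - avg (kk q) g)
     + rho x (avg (kk q) f - avg (kk q) g))%R); last exact: (lerD (lerD (be_q f) (be_q g)) ga_q).
  apply: (le_trans (rho_sub_le _ _ _ _ (avg (kk q) f))); rewrite -addrA lerD2l addrC.
  apply: (le_trans (rho_sub_le _ _ _ _ (avg (kk q) g))); rewrite lerD2l.
  by rewrite -rhoN opprB.
apply: (@le_trans _ _ (Nr (fun x => (al f x + al g x) + ((be f x + be g x) + \sum_q ga q x))%R)).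
  apply: (Nr_le NP) => //.
  - apply: (measurable_rho mL) => //; apply: measurable_rVB; exact: mG.
  - apply: measurable_funD; first by apply: measurable_funD; exact: mal.
    apply: measurable_funD; first by apply: measurable_funD; exact: mbe.
    exact: measurable_sum.
  - by move=> x; exact: rho_ge0.
apply: (Nr_add_le NP).
- by apply: measurable_funD; exact: mal.
- apply: measurable_funD; first by apply: measurable_funD; exact: mbe.
  exact: measurable_sum.
- by move=> x; exact: addr_ge0.
- by move=> x; rewrite !addr_ge0//; exact: sumr_ge0.
- by apply: (Nr_add_le NP) => //; [exact: mal|exact: mal|exact: farE|exact: farE].
apply: (Nr_add_le NP).
- by apply: measurable_funD; exact: mbe.
- exact: measurable_sum.
- by move=> x; exact: addr_ge0.
- by move=> x; exact: sumr_ge0.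
- by apply: (Nr_add_le NP) => //; [exact: mbe|exact: mbe|exact: bound|exact: bound].
by apply: Hsum.
Qed.
End fixed_scale.

(** The tolerance [E] is fixed first, from [e] alone; it determines the scale and
    the region [far].  The number of cubes depends on both and only affects the
    precision to which the averages are rounded, which is free. *)
Theorem equicontinuous_colouring :
  (forall e : R, (0 < e)%R -> exists a : R, forall f, F f ->
    Nr (fun x => \1_(far a) x * rho x (G f x))%R <= e%:E) ->
  (forall e : R, (0 < e)%R -> exists2 a : R, (0 < a)%R & forall f, F f ->
    forall y : T, (forall i, (`|y ord0 i| <= a)%R) ->
    Nr (fun x => rho x (G f x - G f (x - y)%R)) <= e%:E) ->
  forall e : R, (0 < e)%R ->
  exists (C : finType) (cls : Idx -> C), forall f g, F f -> F g -> cls f = cls g ->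
    Nr (fun x => rho x (G f x - G g x)) <= e%:E.
Proof.
move=> van equi e e0.
have C1_ge1 : (1 <= C1)%R.
  have : (1 <= 4 ^+ n :> R)%R by rewrite exprn_ege1// ler1n.
  by rewrite /C1; lra.
have C1_gt0 : (0 < C1)%R by apply: lt_le_trans C1_ge1.
(* chosen so that the bound of [same_colour_close] is at most [e] *)
pose E := (e / 16 / 16 / 16 / 8 / C1)%R.
have E0 : (0 < E)%R by rewrite !divr_gt0.
have [a1 Ha1] := van E E0.
have [a2 a20 Ha2] := equi E E0.
have [j Hj] : exists j : int, (2 * 2 ^ (- j) <= a2)%R.
  pose p := (Num.truncn (2 / a2)).+1; exists p%:Z.
  rewrite -invr_expz -exprnP ler_pdivrMr ?exprn_gt0//.
  rewrite mulrC -ler_pdivrMr//; apply: (@le_trans _ _ p%:R).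
    by apply: ltW; exact: truncnS_gt.
  by rewrite -natrX ler_nat; apply: ltnW; exact: ltn_expl.
have s0 := dyadic_side_gt0 R j.
have osc f : F f -> forall y, shift_box j y ->
    Nr (fun x => rho x (G f x - G f (x + y)%R)) <= E%:E.
  move=> Ff y Hy; have := Ha2 f Ff (- y)%R; rewrite opprK; apply=> i.
  rewrite mxE normrN ler_norml; have /andP[h1 h2] := Hy i.
  by apply/andP; split; lra.
pose Lb := (Num.truncn (a1 / 2 ^ (- j))).+1.
have aL : (a1 <= Lb%:R * 2 ^ (- j))%R.
  by rewrite -ler_pdivrMr//; apply: ltW; exact: truncnS_gt.
have d0 : (0 < e / 16 / 16 / 4)%R by rewrite !divr_gt0.
have [C [cls Hcls]] := same_colour_close E0 osc Ha1 aL d0.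
exists C, cls => f g Ff Fg fg; apply: (le_trans (Hcls f g Ff Fg fg)).
rewrite lee_fin; apply: budget_le => //.
- by rewrite ler_peMl// ltW.
- by rewrite /E; field; rewrite gt_eqF.
- by field.
Qed.
End compactness.

(** * Null sets and Borel representatives *)

Section ae_integral.
Context d (T : measurableType d) (R : realType) (mu : {measure set T -> \bar R}).
Local Open Scope ereal_scope.

(** The integral of a nonnegative function is the supremum of the integrals of the
    simple functions below it, and cutting off such a simple function on a null
    set does not change its integral.  So the comparison holds for arbitrary
    functions. *)
Lemma ge0_le_integral_off (M : set T) (f g : T -> \bar R) :
  measurable M -> mu M = 0 -> (forall x, 0 <= f x) -> (forall x, 0 <= g x) ->
  (forall x, ~ M x -> f x <= g x) -> \int[mu]_x f x <= \int[mu]_x g x.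
Proof.
move=> mM M0 f0 g0 fg; rewrite !ge0_integralTE//=.
apply: ge_ereal_sup => _ [h /= hf <-].
apply: le_ereal_sup_tmp; exists (sintegral mu (proj_nnsfun h (measurableC mM))); last first.
  rewrite -!integralT_nnsfun.
  rewrite (ge0_negligible_integral (mu := mu) (N := M))//; last 2 first.
  - exact/measurable_EFinP.
  - by move=> x _; rewrite lee_fin.
  rewrite integral_mkcond le_eqVlt; apply/orP; left; apply/eqP.
  apply: eq_integral => x _; rewrite patchE /= mindicE setTD.
  by case: (x \in ~` M); rewrite ?mulr1 ?mulr0.
exists (proj_nnsfun h (measurableC mM)) => // x /=.
rewrite mindicE; case: (boolP (x \in ~` M)) => [/set_mem Mx|_].
  by rewrite mulr1 (le_trans (hf x))// fg.
by rewrite mulr0.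
Qed.

Lemma integral_eq_off (M D : set T) (f g : T -> \bar R) :
  measurable M -> mu M = 0 -> (forall x, D x -> ~ M x -> f x = g x) ->
  \int[mu]_(x in D) f x = \int[mu]_(x in D) g x.
Proof.
move=> mM M0 fg.
have ge0_case (h k : T -> \bar R) : (forall x, 0 <= h x) -> (forall x, 0 <= k x) ->
    (forall x, ~ M x -> h x = k x) -> \int[mu]_x h x = \int[mu]_x k x.
  move=> h0 k0 hk; apply/eqP; rewrite eq_le; apply/andP; split;
    by apply: (ge0_le_integral_off mM M0) => // x Mx; rewrite hk.
rewrite [LHS]integral_mkcond [RHS]integral_mkcond [LHS]integralE [RHS]integralE.
have E x : ~ M x -> (f \_ D) x = (g \_ D) x.
  by move=> Mx; rewrite !patchE; case: ifPn => // /set_mem Dx; exact: fg.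
congr (_ - _); apply: ge0_case => // x Mx.
- by rewrite !funeposE E.
- by rewrite !funenegE E.
Qed.
End ae_integral.

Section borel_representative.
Context (R : realType) (n : nat).
Local Notation T := 'rV[R]_n.
Local Notation mu := (lebesgue_rV R n).
Local Open Scope ereal_scope.

Definition borel_null (M : set T) := measurable M /\ mu M = 0.

Lemma borel_nullU (M M' : set T) : borel_null M -> borel_null M' -> borel_null (M `|` M').
Proof.
move=> [mM M0] [mM' M'0]; split; first exact: measurableU.
by apply/eqP; rewrite -measure_le0 (le_trans (measureU2 _ mM mM'))// [X in X + _]M0 [X in _ + X]M'0 adde0.
Qed.

Lemma borel_null_bigcup (M : (set T)^nat) : (forall k, borel_null (M k)) ->
  borel_null (\bigcup_k M k).
Proof.
move=> nM; have mM : measurable (\bigcup_k M k).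
  by apply: bigcupT_measurable => k; have [] := nM k.
split=> //; apply/negligibleP => //.
by apply: negligible_bigcup => k; have [mk /(negligibleP _ mk)] := nM k.
Qed.

Lemma borel_null_countable (I : countType) (M : I -> set T) :
  (forall k, borel_null (M k)) -> borel_null (\bigcup_k M k).
Proof.
move=> nM.
rewrite (_ : \bigcup_k M k =
    \bigcup_k (if @pickle_inv I k is Some i then M i else set0)).
  apply: borel_null_bigcup => k; case: pickle_inv => [i|]; first exact: nM.
  by split; [exact: measurable0|exact: measure0].
apply/seteqP; split => x [k _].
  by move=> Mx; exists (pickle k) => //; rewrite pickleK_inv.
by case: pickle_inv => // i Mx; exists i.
Qed.

Lemma borel_null_of (A : set T) : mu.-negligible A ->
  exists2 M, borel_null M & A `<=` M.
Proof. by move=> [M [mM M0 AM]]; exists M. Qed.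

(** Every superlevel set with a rational level is Borel up to a null set; [M] is the
    union of these null sets.  Larger null sets are allowed so that several
    functions can be redefined on a common one. *)
Lemma borel_representative (g : T -> R) : lebesgue_measurable_fun g ->
  exists2 M, borel_null M & forall M', borel_null M' -> M `<=` M' ->
    measurable_fun setT (g \_ (~` M')).
Proof.
move=> mg.
have h (q : rat) : exists z : set T * set T,
    [/\ measurable z.1, borel_null z.2 & forall x, ~ z.2 x ->
      (g @^-1` [set` `]ratr q, +oo[%R]) x <-> z.1 x].
  have mq : measurable ([set` `](ratr q : R), +oo[%R] : set (measurableTypeR R)).
    exact: measurable_itv.
  have [A mA [N negN AN]] := mg _ mq.
  have [M nM NM] := borel_null_of negN.
  exists (A, M); split => // x Mx; split=> [gx|Ax]; last first.
    by have : (A `|` N) x by [left]; rewrite AN.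
  by have : (A `|` N) x by [rewrite AN]; case=> // /NM.
have [z Hz] := choice h.
pose M := \bigcup_q (z q).2.
have nM : borel_null M by apply: borel_null_countable => q; have [] := Hz q.
exists M => // M' [mM' M'0] MM'.
have Mz q x : ~ M' x -> ~ (z q).2 x.
  move=> Mx zx; by apply: Mx; apply: MM'; exists q.
(* [S r] is the superlevel set of level [r], apart from [M'] *)
pose S (r : R) := \bigcup_(q in [set q : rat | (r < ratr q)%R]) ((z q).1 `\` M').
have mS r : measurable (S r).
  rewrite /S bigcup_mkcond; apply: bigcupT_measurable_rat => q; case: ifP => // _.
  by apply: measurableD => //; have [] := Hz q.
have SE r x : S r x <-> (r < g x)%R /\ ~ M' x.
  split=> [[q /= rq [zx Mx]]|[rg Mx]].
    split => //; have [_ _ /(_ _ (Mz q x Mx))[_ /(_ zx)]] := Hz q.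
    by rewrite /= in_itv/= andbT; exact: lt_trans.
  have [q] := rat_in_itvoo rg; rewrite in_itv/= => /andP[rq qg].
  exists q => //; split => //; have [_ _ /(_ _ (Mz q x Mx))[+ _]] := Hz q.
  by apply; rewrite /= in_itv/= qg.
apply: (measurability _ (RGenOInfty.measurableE R)) => //.
move=> _ [_ [r ->] <-]; rewrite setTI.
have [r0|r0] := leP 0%R r.
  rewrite (_ : _ @^-1` _ = S r)//; apply/seteqP; split => x /=.
    rewrite in_itv/= andbT patchE; case: ifPn => [/set_mem Mx rg|_].
      by apply/SE.
    by rewrite ltNge r0.
  by move=> /SE[rg Mx]; rewrite in_itv/= andbT patchE mem_set.
rewrite (_ : _ @^-1` _ = S r `|` M'); first exact: measurableU.
apply/seteqP; split => x /=.
  rewrite in_itv/= andbT patchE; case: ifPn => [/set_mem Mx rg|].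
    by left; apply/SE.
  by rewrite notin_setE => /contrapT; right.
move=> [/SE[rg Mx]|Mx]; rewrite in_itv/= andbT patchE; first by rewrite mem_set.
by rewrite memNset//; exact.
Qed.
End borel_representative.

(** * Smooth bumps *)

Section flat_function.
Context (R : realType).

(** The function exp (- 1 / s), flat at 0, with a factor [s^-1 ^+ m] that makes the
    family stable under differentiation up to linear combinations. *)
Definition flat (m : nat) (s : R) : R :=
  if 0 < s then s^-1 ^+ m * expR (- s^-1) else 0.

Lemma flat_le0 m s : s <= 0 -> flat m s = 0.
Proof. by rewrite /flat ltNge => ->. Qed.

Lemma flat_gt0 m s : 0 < s -> flat m s = s^-1 ^+ m * expR (- s^-1).
Proof. by rewrite /flat => ->. Qed.

Lemma flat_ge0 m s : 0 <= flat m s.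
Proof.
rewrite /flat; case: ifP => // s0.
by rewrite mulr_ge0 ?expR_ge0// exprn_ge0// invr_ge0 ltW.
Qed.

Lemma flat0_le1 s : flat 0 s <= 1.
Proof.
rewrite /flat; case: ifP => // s0; rewrite expr0 mul1r.
by rewrite -expR0 ler_expR oppr_le0 invr_ge0 ltW.
Qed.

(** The exponential of [s^-1] is at least its Taylor term of order [m + 1]. *)
Lemma flat_le m s : 0 <= s -> flat m s <= (m.+1)`!%:R * s.
Proof.
rewrite le_eqVlt => /predU1P[<-|s0]; first by rewrite flat_le0// mulr0.
rewrite flat_gt0// expRN.
have si0 : 0 < s^-1 by rewrite invr_gt0.
have := expR_ge1Dxn m (ltW si0); set F : R := (m.+1)`!%:R => H.
have F0 : 0 < F by rewrite ltr0n fact_gt0.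
have {}H : s^-1 ^+ m.+1 / F <= expR s^-1.
  by apply: le_trans H; rewrite lerDr.
rewrite ler_pdivrMr ?expR_gt0//.
apply: (@le_trans _ _ (F * s * (s^-1 ^+ m.+1 / F))).
  rewrite exprS le_eqVlt; apply/orP; left; apply/eqP.
  by field; rewrite !gt_eqF.
by apply: ler_wpM2l => //; rewrite mulr_ge0// ltW.
Qed.

(** At 0 the difference quotient of [flat m] is [flat m.+1] to the right and 0 to
    the left, and [flat_le] makes it tend to 0. *)
Lemma is_derive_flat (m : nat) (s : R) :
  is_derive s (1 : R) (flat m) (- m%:R * flat m.+1 s + flat m.+2 s).
Proof.
have [s0|s0|->] := ltgtP s 0.
- rewrite !flat_le0 ?(ltW s0)// mulr0 addr0.
  have H : \near s, (cst 0 : R -> R) s = flat m s.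
    near=> x; rewrite flat_le0//; apply: ltW; near: x.
    exact: lt_nbhsl.
  exact: near_eq_is_derive H (is_derive_cst _ _ _).
- have sn0 : s != 0 by rewrite gt_eqF.
  have H : \near s, s^-1 ^+ m * expR (- s^-1) = flat m s.
    near=> x; rewrite flat_gt0//; near: x; exact: lt_nbhsr.
  apply: near_eq_is_derive H _.
  have dV : is_derive s 1 (fun x : R => x^-1) (- s ^- 2).
    apply: is_derive_eq; first exact: (@realfun.is_deriveV R id s 1 1 sn0 (is_derive_id s (1 : R))).
    by rewrite /= [_ *: _]mulr1.
  have dX : is_derive s 1 (fun x : R => x^-1 ^+ m) (m%:R * s^-1 ^+ m.-1 * - s ^- 2).
    have := is_deriveX m dV.
    by rewrite (_ : (fun x : R => x^-1) ^+ m = (fun x : R => x^-1 ^+ m)) ?exprfctE.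
  have dE : is_derive s 1 (fun x : R => expR (- x^-1)) (s ^- 2 * expR (- s^-1)).
    have dN : is_derive s 1 (fun x : R => - x^-1) (s ^- 2).
      by apply: is_derive_eq (is_deriveN dV) _; rewrite opprK.
    by apply: is_derive_eq (is_derive1_comp (is_derive_expR _) dN) _; rewrite mulrC.
  apply: is_derive_eq (is_deriveM dX dE) _.
  rewrite !flat_gt0// /GRing.scale/= -exprVn.
  case: m {dX} => [|m] /=; first by rewrite !expr0 expr2 !mul0r mulr0 oppr0 mul0r; ring.
  by rewrite !exprS; ring.
- have lim0 : (fun h : R => h^-1 *: ((flat m \o shift 0) (h *: (1:R)) - flat m 0)) @ 0^' --> (0 : R).
    apply/cvgrPdist_le => e e0.
    have F0 : 0 < (m.+2)`!%:R :> R by rewrite ltr0n fact_gt0.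
    near=> h.
    have hn0 : h != 0 by near: h; exact: nbhs_dnbhs_neq.
    rewrite /= addr0 [_ *: 1]mulr1 (flat_le0 _ (lexx 0)) subr0 sub0r normrN.
    have [h0|h0] := leP h 0; first by rewrite flat_le0// scaler0 normr0 ltW.
    have -> : h^-1 *: flat m h = flat m.+1 h.
      by rewrite !flat_gt0// exprS -mulrA.
    rewrite ger0_norm ?flat_ge0//; apply: (le_trans (flat_le _ (ltW h0))).
    rewrite -ler_pdivlMl// mulrC -(gtr0_norm h0).
    near: h; apply: dnbhs0_le; exact: divr_gt0.
  rewrite !flat_le0// mulr0 addr0; apply: DeriveDef; last exact: cvg_lim lim0.
  by apply/cvg_ex; exists 0.
Unshelve. all: by end_near. Qed.

Lemma continuous_flat m : continuous (flat m).
Proof.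
move=> s; apply: differentiable_continuous; apply/derivable1_diffP.
by have [] := is_derive_flat m s.
Qed.

Lemma flat0_scale_cvg (s : R) :
  flat 0 (k.+1%:R * s) @[k --> \oo] --> (((0 < s)%R)%:R : R).
Proof.
have [s0|s0] := ltP 0 s; last first.
  rewrite (_ : (fun k => _) = cst 0); first exact: cvg_cst.
  by apply/funext => k; rewrite flat_le0// mulr_ge0_le0.
rewrite (_ : (fun k => _) = (fun k => expR (- (k.+1%:R^-1 * s^-1)))); last first.
  by apply/funext => k; rewrite flat_gt0 ?mulr_gt0// expr0 mul1r invfM.
rewrite [X in _ --> X](_ : _ = expR (- (0 * s^-1))); last by rewrite mul0r oppr0 expR0.
apply: continuous_cvg; first exact: continuous_expR.
by apply: cvgN; apply: cvgM; [exact: cvg_harmonic|exact: cvg_cst].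
Qed.
End flat_function.

Section smooth_bumps.
Context (R : realType) (n : nat).
Local Notation T := 'rV[R]_n.

(** An algebra stable under partial derivatives, which yields smoothness to every
    order at once. *)
Inductive flat_algebra : (T -> R) -> Prop :=
| FlatBase m c d i : flat_algebra (fun x => flat m (c * x ord0 i + d))
| FlatCst a : flat_algebra (fun=> a)
| FlatAdd f g : flat_algebra f -> flat_algebra g -> flat_algebra (fun x => f x + g x)
| FlatMul f g : flat_algebra f -> flat_algebra g -> flat_algebra (fun x => f x * g x).

Lemma is_derive_line (f : T -> R) x v df :
  is_derive (0 : R) 1 (fun h : R => f (h *: v + x)) df -> is_derive x v f df.
Proof.
move=> [d e]; apply: DeriveDef; first exact/derivable1P.
rewrite -e /derive.
suff -> : (fun h : R => h^-1 *: ((f \o shift x) (h *: v) - f x)) =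
  (fun h => h^-1 *: (((fun h0 : R => f (h0 *: v + x)) \o shift 0) (h *: 1) -
    (fun h0 => f (h0 *: v + x)) 0)) by [].
apply/funext => h /=; by rewrite addr0 scale0r add0r [_ *: 1]mulr1.
Qed.

Lemma is_derive_flat_coord m c d i x j :
  is_derive x (delta_mx ord0 j) (fun x : T => flat m (c * x ord0 i + d))
   ((i == j)%:R * c * (- m%:R * flat m.+1 (c * x ord0 i + d) +
      flat m.+2 (c * x ord0 i + d))).
Proof.
apply: is_derive_line.
pose b : R := (i == j)%:R * c; pose e := c * x ord0 i + d.
rewrite (_ : (fun h : R => _) = flat m \o (fun h : R => b * h + e)); last first.
  apply/funext => h /=; rewrite !mxE /= /b /e eq_sym; congr (flat m _).
  by rewrite [j == i]eq_sym; ring.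
have dl : is_derive (0 : R) 1 (fun h : R => b * h + e) b.
  apply: is_derive_eq (is_deriveD (is_deriveZ b (is_derive_id _ _)) (is_derive_cst e _ _)) _.
  by rewrite addr0 [_ *: _]mulr1.
apply: is_derive_eq (is_derive1_comp (is_derive_flat m _) dl) _.
by rewrite mulr0 add0r [RHS]mulrC.
Qed.

Lemma flat_algebra_derive f : flat_algebra f -> forall j, exists2 g,
  flat_algebra g & forall x, is_derive x (delta_mx ord0 j) f (g x).
Proof.
elim=> [m c d i|a|{}f g Hf IHf Hg IHg|{}f g Hf IHf Hg IHg] j.
- exists (fun x => (i == j)%:R * c * (- m%:R * flat m.+1 (c * x ord0 i + d) +
      flat m.+2 (c * x ord0 i + d))); last by move=> x; exact: is_derive_flat_coord.
  apply: FlatMul; first exact: FlatCst.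
  by apply: FlatAdd; [apply: FlatMul; [exact: FlatCst|exact: FlatBase]|exact: FlatBase].
- by exists (fun=> 0); [exact: FlatCst|move=> x; exact: is_derive_cst].
- have [f' Hf' df] := IHf j; have [g' Hg' dg] := IHg j.
  by exists (fun x => f' x + g' x); [exact: FlatAdd|move=> x; exact: is_deriveD].
- have [f' Hf' df] := IHf j; have [g' Hg' dg] := IHg j.
  exists (fun x => f x * g' x + g x * f' x).
    by apply: FlatAdd; exact: FlatMul.
  by move=> x; exact: is_deriveM.
Qed.

Lemma flat_algebra_continuous f : flat_algebra f -> continuous f.
Proof.
elim=> [m c d i|a|{}f g Hf IHf Hg IHg|{}f g Hf IHf Hg IHg] x.
- apply: (@continuous_comp _ _ _ (fun x : T => c * x ord0 i + d) (flat m)).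
    apply: continuousD; last exact: cst_continuous.
    by apply: continuousM; [exact: cst_continuous|exact: coord_continuous].
  exact: continuous_flat.
- exact: cst_continuous.
- by apply: continuousD; [exact: IHf|exact: IHg].
- by apply: continuousM; [exact: IHf|exact: IHg].
Qed.

Lemma flat_algebra_smooth k f : flat_algebra f -> class_C k f.
Proof.
elim: k f => [|k IH] f Hf /=; first exact: flat_algebra_continuous.
move=> i; have [g Hg dg] := flat_algebra_derive Hf i.
split; first by move=> x; have [] := dg x.
rewrite (_ : partial i f = g); first exact: IH.
by apply/funext => x; rewrite /partial; have [] := dg x.
Qed.

(** A smooth approximation of the indicator function of an open box. *)
Definition box_bump (a b : 'I_n -> R) (k : nat) (x : T) : R :=
  \prod_i (flat 0 (k.+1%:R * (x ord0 i - a i)) * flat 0 (k.+1%:R * (b i - x ord0 i))).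

Lemma box_bump_algebra a b k : flat_algebra (box_bump a b k).
Proof.
rewrite /box_bump; elim: (index_enum _) => [|i s IH].
  rewrite (_ : (fun x => _) = (fun=> 1)); first exact: FlatCst.
  by apply/funext => x; rewrite big_nil.
rewrite (_ : (fun x => _) = (fun x : T => flat 0 (k.+1%:R * x ord0 i + - (k.+1%:R * a i)) *
   flat 0 (- k.+1%:R * x ord0 i + k.+1%:R * b i) *
   \prod_(i <- s) (flat 0 (k.+1%:R * (x ord0 i - a i)) * flat 0 (k.+1%:R * (b i - x ord0 i))))).
  apply: FlatMul => //; apply: FlatMul; exact: FlatBase.
apply/funext => x; rewrite big_cons; congr (flat 0 _ * flat 0 _ * _); ring.
Qed.

Lemma box_bump_ge0 a b k x : 0 <= box_bump a b k x.
Proof. by apply: prodr_ge0 => i _; rewrite mulr_ge0// flat_ge0. Qed.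

Lemma box_bump_le1 a b k x : box_bump a b k x <= 1.
Proof.
apply: prodr_ile1 => i _; rewrite mulr_ge0 ?flat_ge0//=.
by rewrite -[leRHS]mulr1 ler_pM ?flat_ge0 ?flat0_le1.
Qed.

Lemma box_bump_support a b k x : box_bump a b k x != 0 ->
  forall i, a i < x ord0 i < b i.
Proof.
move=> h i; apply: contraNT h => xi; rewrite /box_bump (bigD1 i)//=.
move: xi; rewrite negb_and -!leNgt => /orP[xi|xi].
  by rewrite flat_le0 ?mul0r// mulr_ge0_le0// subr_le0.
by rewrite [X in _ * X * _]flat_le0 ?mulr0 ?mul0r// mulr_ge0_le0// subr_le0.
Qed.

Lemma box_bump_cvg a b x : box_bump a b k x @[k --> \oo] -->
  (\1_[set x : T | forall i, a i < x ord0 i < b i] x : R).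
Proof.
rewrite [X in _ --> X](_ : _ = \prod_i (((0 < x ord0 i - a i)%R)%:R * ((0 < b i - x ord0 i)%R)%:R)).
  rewrite /box_bump; elim: (index_enum _) => [|i s IH].
    under eq_fun do rewrite big_nil; rewrite big_nil; exact: cvg_cst.
  under eq_fun do rewrite big_cons; rewrite big_cons.
  by apply: cvgM => //; apply: cvgM; exact: flat0_scale_cvg.
rewrite indicE; case: (boolP (x \in _)) => [/set_mem /= h|].
  by rewrite big1// => i _; have /andP[h1 h2] := h i; rewrite !subr_gt0 h1 h2 mulr1.
rewrite notin_setE /= => /existsNP[i /negP h]; rewrite (bigD1 i)//= !subr_gt0.
by move: h; rewrite negb_and => /orP[]/negbTE ->; rewrite ?mul0r ?mulr0 ?mul0r.
Qed.

Lemma compact_closed_box (a b : 'I_n -> R) :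
  compact [set x : T | forall i, a i <= x ord0 i <= b i].
Proof.
have := @rV_compact R n (fun i => [set` `[a i, b i]%R]) (fun i => @segment_compact _ _ _).
by congr compact; apply/seteqP; split => x /= h i; have := h i; rewrite /= in_itv.
Qed.

Lemma closed_box (a b : 'I_n -> R) :
  closed [set x : T | forall i, a i <= x ord0 i <= b i].
Proof. apply: compact_closed; [exact: norm_hausdorff|exact: compact_closed_box]. Qed.

Lemma box_bump_test a b k : test_function (box_bump a b k).
Proof.
split; first by move=> l; apply: flat_algebra_smooth; exact: box_bump_algebra.
have cA : closed (closure [set x : T | box_bump a b k x != 0]) by exact: closed_closure.
apply: (subclosed_compact cA (@compact_closed_box a b)).
rewrite [X in _ `<=` X](closure_id _).1; last exact: closed_box.
apply: closure_subset => x /box_bump_support h i.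
by have /andP[h1 h2] := h i; rewrite !ltW.
Qed.
End smooth_bumps.

(** * Borel sets and locally integrable functions *)

Section density_measure.
Context d (T : measurableType d) (R : realType) (mu : {measure set T -> \bar R}).
Local Open Scope ereal_scope.
(** The hypotheses on the density are arguments, so that the structure of measure is
    inferred from the term. *)
Definition density_measure (f : T -> \bar R) (_ : measurable_fun setT f)
  (_ : forall x, 0 <= f x) (A : set T) : \bar R := \int[mu]_(x in A) f x.

Variables (f : T -> \bar R) (mf : measurable_fun setT f) (f0 : forall x, 0 <= f x).
Local Notation dm := (density_measure mf f0).

Let density0 : dm set0 = 0.
Proof. exact: integral_set0. Qed.

Let density_ge0 A : 0 <= dm A.
Proof. by apply: integral_ge0 => x _. Qed.

Let density_sigma_additive : semi_sigma_additive dm.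
Proof. exact: semi_sigma_additive_nng_induced. Qed.

HB.instance Definition _ := isMeasure.Build _ _ _ dm
  density0 density_ge0 density_sigma_additive.
End density_measure.

Lemma measurable_absE d (S : measurableType d) (R : realType) (D : set S) (u : S -> R) :
  measurable_fun setT u -> measurable_fun D (fun x => `|u x|%:E).
Proof.
move=> mu; apply: (@measurable_funS _ _ _ _ setT) => //; apply/measurable_EFinP.
by apply: measurableT_comp => //; exact: normr_measurable.
Qed.

Section borel_sets.
Context (R : realType) (n : nat).
Local Notation T := 'rV[R]_n.
Local Notation mu := (lebesgue_rV R n).

Definition open_box (a b : 'I_n -> R) : set T :=
  [set x : T | forall i, a i < x ord0 i < b i].

Lemma measurable_open_box a b : measurable (open_box a b).
Proof.
rewrite (_ : open_box a b = \bigcap_(j in [set: 'I_n])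
    (rV_coord j @^-1` [set` `]a j, b j[%R])).
  apply: fin_bigcap_measurable => // j _.
  by rewrite -[X in measurable X]setTI; exact: measurable_rV_coord.
apply/seteqP; split => [v Bv j _|v Bv j]; first by rewrite /= in_itv; exact: Bv.
by have := Bv j Logic.I; rewrite /= in_itv.
Qed.

Definition open_boxes : set (set T) := [set A | exists a b, A = open_box a b].

Lemma open_boxesI : setI_closed open_boxes.
Proof.
move=> _ _ [a [b ->]] [a' [b' ->]].
exists (fun i => Num.max (a i) (a' i)), (fun i => Num.min (b i) (b' i)).
apply/seteqP; split => [x [h h'] i|x h].
  rewrite gt_max lt_min; have /andP[-> ->] := h i.
  by have /andP[-> ->] := h' i.
by split=> i; have := h i; rewrite gt_max lt_min => /andP[/andP[? ?] /andP[? ?]]; apply/andP.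
Qed.

Lemma coord_bound (x : T) : exists N : nat, forall i, `|x ord0 i| < N%:R.
Proof.
exists (Num.truncn (\sum_i `|x ord0 i|)).+1 => i.
apply: le_lt_trans (truncnS_gt _); rewrite (bigD1 i)//= lerDl.
exact: sumr_ge0.
Qed.

(** Open boxes are stable under intersection, which makes them fit for the uniqueness
    theorem for measures. *)
Lemma rV_measurable_open_boxes : (@measurable _ T) = <<s open_boxes>>.
Proof.
apply/seteqP; split => [A mA|]; last first.
  apply: smallest_sub; first exact: sigma_algebra_measurable.
  by move=> _ [a [b ->]]; exact: measurable_open_box.
pose T' := g_sigma_algebraType open_boxes.
suff: measurable_fun setT (idfun : T' -> T).
  by move=> /(_ measurableT _ mA); rewrite setTI.
apply/measurable_fun_rVP => i.
apply: (measurability _ (RGenOInfty.measurableE R)) => //.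
move=> _ [_ [r ->] <-]; rewrite setTI.
rewrite (_ : _ @^-1` _ = \bigcup_(N in [set: nat])
    open_box (fun j => if j == i then r else - N%:R) (fun=> N%:R)).
  apply: bigcupT_measurable => N; apply: sub_sigma_algebra.
  by exists (fun j => if j == i then r else - N%:R), (fun=> N%:R).
apply/seteqP; split => x /=; rewrite /rV_coord in_itv/= andbT.
  move=> rx; have [N HN] := coord_bound x; exists N => // j.
  have := HN j; rewrite ltr_norml => /andP[h1 h2]; rewrite h2 andbT.
  by case: eqP => // ->.
by move=> [N _ /(_ i)]; rewrite eqxx => /andP[].
Qed.

(** An open set is the union of the dyadic cubes contained in it, a countable
    family. *)
Lemma measurable_continuous (f : T -> R) : continuous f -> measurable_fun setT f.
Proof.
move=> cf; apply: (measurability _ (RGenOInfty.measurableE R)) => //.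
move=> _ [_ [r ->] <-]; rewrite setTI.
set U := f @^-1` _.
have oU : open U.
  by apply: open_comp => [x _|]; [exact: cf|exact: interval_open].
pose P (z : nat * 'rV[int]_n) := dyadic_cube z.1%:Z z.2 `<=` U.
rewrite (_ : U = \bigcup_z (if `[< P z >] then dyadic_cube z.1%:Z z.2 else set0)).
  apply: countable_bigcupT_measurable => [|z]; first exact: countableP.
  case: ifP => // _.
  exact: measurable_dyadic.
apply/seteqP; split => [x Ux|x [z _]]; last first.
  by case: asboolP => // Pz zx; exact: Pz.
have /nbhs_ballP[e /= e0 eU] : nbhs x U by exact: open_nbhs_nbhs.
pose p := (Num.truncn e^-1).+1.
have pe : 2 ^ (- p%:Z) < e.
  rewrite -invr_expz -exprnP -[ltRHS]invrK ltf_pV2 ?posrE ?exprn_gt0 ?invr_gt0//.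
  apply: lt_le_trans (truncnS_gt _) _.
  by rewrite -natrX ler_nat; apply: ltnW; exact: ltn_expl.
have s0 := dyadic_side_gt0 R p.
exists (p, dyadic_index p%:Z x) => //.
have xx : dyadic_cube p%:Z (dyadic_index p%:Z x) x by apply/dyadic_cubeP.
rewrite ifT//; apply/asboolP => y /= yx; apply: eU; split => // i j.
rewrite (ord1 i) /ball/=; have := xx j; have := yx j.
rewrite intrD mulrDr mulr1 => /andP[h1 h2] /andP[h3 h4].
by apply: lt_trans pe; rewrite ltr_norml; apply/andP; split; lra.
Qed.
End borel_sets.

Section test_functions.
Context (R : realType) (n : nat).
Local Notation T := 'rV[R]_n.
Local Notation mu := (lebesgue_rV R n).

Definition big_cube (N : nat) : set T :=
  [set x : T | forall i, - N%:R <= x ord0 i < N%:R].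

Lemma measurable_big_cube N : measurable (big_cube N).
Proof. exact: measurable_box. Qed.

Lemma compact_big_cube (K : set T) : compact K -> exists N, K `<=` big_cube N.
Proof.
move=> /compact_bounded [M [_ HM]]; exists (Num.truncn (M + 1)).+1 => x Kx i.
have xM : `|x| <= M + 1 by apply: HM Kx; rewrite ltrDl.
have xi : `|x ord0 i| < (Num.truncn (M + 1)).+1%:R.
  apply: le_lt_trans (truncnS_gt _); apply: le_trans xM.
  have -> : `|x| = mx_norm x by [].
  rewrite mx_normrE; exact: (le_bigmax _ (fun ij : 'I_1 * 'I_n => `|x ij.1 ij.2|) (ord0, i)).
by move: xi; rewrite ltr_norml => /andP[/ltW -> ->].
Qed.

Lemma big_cube_compact N : exists2 K : set T, compact K & big_cube N `<=` K.
Proof.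
exists [set x : T | forall i, - N%:R <= x ord0 i <= N%:R].
  exact: (@compact_closed_box _ _ (fun=> - N%:R) (fun=> N%:R)).
by move=> x h i; have /andP[-> /ltW ->] := h i.
Qed.

Lemma test_continuous (phi : T -> R) : test_function phi -> continuous phi.
Proof. by move=> [/(_ 0%N)]. Qed.

Lemma test_partial i (phi : T -> R) : test_function phi -> test_function (partial i phi).
Proof.
move=> [smooth csupp]; split; first by move=> k; have [] := smooth k.+1 i.
have cA : closed (closure [set x : T | partial i phi x != 0]) by exact: closed_closure.
apply: (subclosed_compact cA csupp).
rewrite [X in _ `<=` X](closure_id _).1; last exact: closed_closure.
apply: closure_subset => x /= px; apply: contrapT => xS; move/eqP : px; apply.
have oS : open (~` closure [set x : T | phi x != 0]).
  by apply: closed_openC; exact: closed_closure.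
have : \forall y \near x, phi y = 0.
  have : nbhs x (~` closure [set x : T | phi x != 0]) by exact: open_nbhs_nbhs.
  apply: filterS => y Sy; apply/eqP; apply: contrapT => /negP py.
  by apply: Sy; apply: subset_closure.
move=> phi0; rewrite /partial -(@derive_cst _ _ _ (0 : R) x (delta_mx ord0 i)).
by apply: near_eq_derive.
Qed.

Lemma test_bounded (phi : T -> R) : test_function phi ->
  exists (N : nat) (C : R), (forall x, phi x != 0 -> big_cube N x) /\
    forall x, `|phi x| <= C.
Proof.
move=> tphi; have [_ csupp] := tphi; have cphi := test_continuous tphi.
have [N HN] := compact_big_cube csupp.
have : compact (phi @` closure [set x : T | phi x != 0]).
  by apply: continuous_compact => //; exact: continuous_subspaceT.
move=> /compact_bounded [M [_ HM]]; exists N, (`|M| + 1); split.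
  by move=> x px; apply: HN; exact: subset_closure.
move=> x; have [->|px] := eqVneq (phi x) 0; first by rewrite normr0 addr_ge0.
apply: HM; first by rewrite (le_lt_trans (ler_norm _))// ltrDl.
by exists x => //; exact: subset_closure.
Qed.

Definition box_integrable (u : T -> R) :=
  forall N, (\int[mu]_(x in big_cube N) `|u x|%:E < +oo)%E.

Lemma integrable_test (u phi : T -> R) : measurable_fun setT u ->
  box_integrable u -> test_function phi ->
  mu.-integrable setT (fun x => (u x * phi x)%:E).
Proof.
move=> mu' lu tphi; have [N [C [supp bd]]] := test_bounded tphi.
have mphi := measurable_continuous (test_continuous tphi).
have mN := @measurable_big_cube N.
have C0 : 0 <= C by exact: le_trans (normr_ge0 _) (bd 0).
apply/integrableP; split; first by apply/measurable_EFinP; exact: measurable_funM.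
apply: (@le_lt_trans _ _ (\int[mu]_x (C%:E * (fun x => `|u x|%:E) \_ (big_cube N) x))%E).
  apply: ge0_le_integral => //.
  - apply: measurableT_comp => //; apply/measurable_EFinP; exact: measurable_funM.
  - apply: measurable_funeM; apply/(measurable_restrictT _ _).1 => //.
    exact: measurable_absE.
  - move=> x _; rewrite patchE abse_EFin normrM.
    case: (boolP (x \in big_cube N)) => [_|]; last first.
      rewrite notin_setE => /= xN; have [->|/supp//] := eqVneq (phi x) 0.
      by rewrite normr0 mulr0 mule0.
    by rewrite -EFinM lee_fin mulrC ler_wpM2r.
rewrite ge0_integralZl//; last 2 first.
- apply/(measurable_restrictT _ _).1 => //; exact: measurable_absE.
- by move=> x _; rewrite patchE; case: ifP.
by rewrite -integral_mkcond; apply: lte_mul_pinfty.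
Qed.

Lemma integral_open_box0 (h : T -> R) (a b : 'I_n -> R) :
  measurable_fun setT h -> box_integrable h ->
  (forall phi, test_function phi -> (\int[mu]_x (h x * phi x)%:E = 0)%E) ->
  (\int[mu]_x (h x * \1_(open_box a b) x)%:E = 0)%E.
Proof.
move=> mh lh Hh.
pose f_ k x := (h x * box_bump a b k x)%:E.
pose f x := (h x * \1_(open_box a b) x)%:E.
have [N HN] : exists N, open_box a b `<=` big_cube N.
  have [N HN] := compact_big_cube (@compact_closed_box _ _ a b).
  by exists N => x Qx; apply: HN => i; have /andP[/ltW -> /ltW ->] := Qx i.
pose g := (fun x => `|h x|%:E) \_ (big_cube N).
have mg : measurable_fun setT g.
  apply/(measurable_restrictT _ _).1; first exact: measurable_big_cube.
  exact: measurable_absE.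
suff [_ _ /cvg_lim <-//] : [/\ mu.-integrable setT f,
    [sequence \int[mu]_x `|f_ n x - f x|]_n @ \oo --> 0 &
    [sequence \int[mu]_x (f_ n x)]_n @ \oo --> \int[mu]_x (f x) ]%E.
  have -> : [sequence (\int[mu]_x f_ k x)%E]_k = cst 0%E.
    by apply/funext => k /=; apply: Hh; exact: box_bump_test.
  exact: lim_cst.
apply: (@dominated_convergence _ _ _ mu setT measurableT f_ f g).
- move=> k; apply/measurable_EFinP; apply: measurable_funM => //.
  by apply: measurable_continuous; apply: test_continuous; exact: box_bump_test.
- apply/measurable_EFinP; apply: measurable_funM => //.
  by apply: measurable_indic; exact: measurable_open_box.
- apply: aeW => x _; apply: cvg_EFin; first exact: nearW.
  by apply: cvgM; [exact: cvg_cst|exact: box_bump_cvg].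
- apply/integrableP; split => //.
  have -> : (fun x => `|g x|)%E = g.
    by apply/funext => x; rewrite /g patchE; case: ifP => _; rewrite ?abse_EFin ?normr_id// /point /= normr0.
  by rewrite /g -integral_mkcond.
- apply: aeW => x k _; rewrite /f_ /g patchE abse_EFin normrM.
  rewrite [`|box_bump _ _ _ _|]ger0_norm ?box_bump_ge0//.
  case: (boolP (x \in big_cube N)) => [_|].
    by rewrite lee_fin ler_piMr ?box_bump_le1.
  rewrite notin_setE => xN; have [->|/box_bump_support/HN//] := eqVneq (box_bump a b k x) 0.
  by rewrite mulr0.
Qed.

(** The bumps converge to the indicator functions of boxes, so [h] has integral 0
    over every box.  On a large box the positive and negative parts of [h] are then
    the densities of two finite measures that agree on boxes, hence on Borel sets,
    and must be equal almost everywhere. *)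
Lemma weakly_zero (h : T -> R) :
  measurable_fun setT h -> box_integrable h ->
  (forall phi, test_function phi -> (\int[mu]_x (h x * phi x)%:E = 0)%E) ->
  exists2 M, borel_null M & forall x, ~ M x -> h x = 0.
Proof.
move=> mh lh Hh.
pose D (N : nat) : set T := open_box (fun=> - N%:R) (fun=> N%:R).
have mD N : measurable (D N) by exact: measurable_open_box.
have DN N : D N `<=` big_cube N.
  by move=> x Dx i; have /andP[/ltW -> ->] := Dx i.
pose hD N x := (h x * \1_(D N) x)%:E.
have mhD N : measurable_fun setT (hD N).
  by apply/measurable_EFinP; apply: measurable_funM => //; exact: measurable_indic.
have ihD N : mu.-integrable setT (hD N).
  apply/integrableP; split => //; apply: le_lt_trans (lh N).
  rewrite [leRHS]integral_mkcond; apply: ge0_le_integral => //.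
  - exact: measurableT_comp.
  - apply/(measurable_restrictT _ _).1; first exact: measurable_big_cube.
    exact: measurable_absE.
  - move=> x _; rewrite /hD abse_EFin normrM patchE indicE.
    case: (boolP (x \in D N)) => [/set_mem/DN Dx|_]; first by rewrite mem_set// normr1 mulr1.
    by rewrite normr0 mulr0; case: ifP => // _; rewrite lee_fin.
have mfp N := measurable_funepos (mhD N).
have mfn N := measurable_funeneg (mhD N).
have fp0 N x : (0 <= (hD N)^\+ x)%E by exact: funepos_ge0.
have fn0 N x : (0 <= (hD N)^\- x)%E by exact: funeneg_ge0.
have ip N : mu.-integrable setT (hD N)^\+%E by exact: integrable_funepos.
have im N : mu.-integrable setT (hD N)^\-%E by exact: integrable_funeneg.
have fin (f : T -> \bar R) A : measurable A -> mu.-integrable setT f ->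
    (\int[mu]_(x in A) f x)%E \is a fin_num.
  by move=> mA fi; apply: integrable_fin_num => //; exact: integrableS fi.
have box N a b : (\int[mu]_(x in open_box a b) (hD N)^\+ x =
                  \int[mu]_(x in open_box a b) (hD N)^\- x)%E.
  have mA := @measurable_open_box _ _ a b.
  have [a' [b' abE]] := @open_boxesI R n _ _ (ex_intro _ a (ex_intro _ b erefl))
    (ex_intro _ (fun=> - N%:R) (ex_intro _ (fun=> N%:R) erefl)).
  have : (\int[mu]_(x in open_box a b) (hD N) x = 0)%E.
    rewrite -[RHS](integral_open_box0 a' b' mh lh Hh) integral_mkcond.
    apply: eq_integral => x _; rewrite patchE /hD -abE indicI /=.
    rewrite !indicE; case: (x \in open_box a b); first by rewrite mul1r.
    by rewrite mul0r mulr0.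
  rewrite integralE; have := fin _ _ mA (ip N); have := fin _ _ mA (im N).
  case: (\int[mu]_(x in _) _)%E => // r _; case: (\int[mu]_(x in _) _)%E => // s _.
  by rewrite -EFinB => -[/eqP]; rewrite subr_eq0 => /eqP ->.
have key N A : measurable A -> (\int[mu]_(x in A) (hD N)^\+ x = \int[mu]_(x in A) (hD N)^\- x)%E.
  move=> mA.
  apply: (@measure_unique _ R T (@open_boxes R n) (fun k => open_box (fun=> - k%:R) (fun=> k%:R))
    (@rV_measurable_open_boxes R n) (@open_boxesI R n) _ _
    (density_measure mu (mfp N) (fp0 N)) (density_measure mu (mfn N) (fn0 N)) _ _ A mA).
  - by move=> k; exists (fun=> - k%:R), (fun=> k%:R).
  - rewrite -subTset => x _; have [k Hk] := coord_bound x; exists k => // i.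
    by have := Hk i; rewrite ltr_norml.
  - by move=> _ [a [b ->]]; exact: box.
  - move=> k; rewrite /density_measure ltey_eq.
    by rewrite (fin _ _ (@measurable_open_box _ _ _ _) (ip N)).
have zero N : exists M, borel_null M /\ forall x, ~ M x -> hD N x = 0%E.
  have : ae_eq mu setT (hD N)^\+%E (hD N)^\-%E.
    by apply: integral_ae_eq => // E _ mE; exact: key.
  move=> [M [mM M0 HM]]; exists M; split=> // x Mx.
  have : (hD N)^\+%E x = (hD N)^\-%E x.
    by apply: contrapT => E; apply: Mx; apply: HM => /= /(_ Logic.I).
  rewrite funeposE funenegE /hD; set r := (h x * _)%R.
  rewrite -EFinN -!EFin_max => -[E]; congr EFin.
  have [r0|r0] := leP r 0.
    by move: E; rewrite (max_r r0) max_l ?oppr_ge0// => /eqP; rewrite eq_sym oppr_eq0 => /eqP.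
  by move: E; rewrite (max_l (ltW r0)) max_r// oppr_le0 ltW.
have [M HM] := choice zero.
exists (\bigcup_N M N); first by apply: borel_null_bigcup => N; have [] := HM N.
move=> x Mx; have [N HN] := coord_bound x.
have [_ /(_ x)] := HM N; rewrite /hD indicE mem_set ?mulr1.
  by move=> H; have [] : (h x)%:E = 0%E by apply: H => Mnx; apply: Mx; exists N.
by move=> i; have := HN i; rewrite ltr_norml.
Qed.
End test_functions.

(** * Weak gradients *)

Section complex_components.
Context (R : realType).
Implicit Types z w : R[i].

Lemma Re_sub z w : complex.Re (z - w) = complex.Re z - complex.Re w.
Proof. by case: z w => [a b] [c e]. Qed.

Lemma Im_sub z w : complex.Im (z - w) = complex.Im z - complex.Im w.
Proof. by case: z w => [a b] [c e]. Qed.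

Lemma Re_mul_real z (a : R) : complex.Re (z * real_complex R a) = complex.Re z * a.
Proof. by case: z => [b c] /=; rewrite mulr0 subr0. Qed.

Lemma Im_mul_real z (a : R) : complex.Im (z * real_complex R a) = complex.Im z * a.
Proof. by case: z => [b c] /=; rewrite mulr0 add0r. Qed.

Lemma normc_Re_le z : `|complex.Re z| <= Normc.normc z.
Proof.
case: z => [a b] /=; rewrite -sqrtr_sqr; apply: ler_wsqrtr.
by rewrite lerDl sqr_ge0.
Qed.

Lemma normc_Im_le z : `|complex.Im z| <= Normc.normc z.
Proof.
case: z => [a b] /=; rewrite -sqrtr_sqr; apply: ler_wsqrtr.
by rewrite lerDr sqr_ge0.
Qed.

Lemma normc_le z : Normc.normc z <= `|complex.Re z| + `|complex.Im z|.
Proof.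
case: z => [a b] /=.
rewrite -[leRHS]ger0_norm ?addr_ge0// -sqrtr_sqr; apply: ler_wsqrtr.
rewrite sqrrD !real_normK ?num_real// -addrA [X in _ <= _ + X]addrC addrA lerDl.
by rewrite mulrn_wge0// mulr_ge0.
Qed.

Lemma normc_ge0 z : 0 <= Normc.normc z.
Proof. by case: z => a b /=; exact: sqrtr_ge0. Qed.
End complex_components.

Section measurability_off.
Context (R : realType) (n : nat).
Local Notation T := 'rV[R]_n.
Local Notation mu := (lebesgue_rV R n).
Local Open Scope ereal_scope.

Lemma lebesgue_measurable_off (M : set T) (g u : T -> R) :
  borel_null M -> measurable_fun setT u -> (forall x, ~ M x -> g x = u x) ->
  lebesgue_measurable_fun g.
Proof.
move=> [mM M0] mu' gu B mB.
exists ((u @^-1` B) `\` M).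
  by apply: measurableD => //; rewrite -[X in measurable X]setTI; exact: mu'.
exists ((g @^-1` B) `&` M); first by exists M; split => // x [].
apply/seteqP; split => [x [[/= uB Mx]|[]//]|x gB]; first by rewrite /= gu.
have [Mx|Mx] := pselect (M x); first by right.
by left; split => //=; rewrite -gu.
Qed.

Lemma le_integral_off (M D D' : set T) (f g : T -> \bar R) : borel_null M ->
  (forall x, D x -> 0 <= f x) -> (forall x, D' x -> 0 <= g x) ->
  (forall x, ~ M x -> D x -> D' x /\ f x <= g x) ->
  \int[mu]_(x in D) f x <= \int[mu]_(x in D') g x.
Proof.
move=> [mM M0] f0 g0 fg; rewrite [leLHS]integral_mkcond [leRHS]integral_mkcond.
have fD0 x : 0 <= (f \_ D) x by rewrite patchE; case: ifPn => // /set_mem/f0.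
have gD0 x : 0 <= (g \_ D') x by rewrite patchE; case: ifPn => // /set_mem/g0.
apply: (ge0_le_integral_off mM M0) => // x Mx; rewrite patchE.
case: ifPn => // /set_mem Dx; have [D'x fgx] := fg x Mx Dx.
by rewrite patchE mem_set.
Qed.

Lemma Rintegral_off (M : set T) (f g : T -> R) : borel_null M ->
  (forall x, ~ M x -> f x = g x) -> (\int[mu]_x f x = \int[mu]_x g x)%R.
Proof.
move=> [mM M0] fg; rewrite /Rintegral; congr fine.
by apply: (integral_eq_off mM M0) => x _ Mx; rewrite fg.
Qed.
End measurability_off.

Section weak_gradients.
Context (R : realType) (n : nat).
Local Notation T := 'rV[R]_n.
Local Notation mu := (lebesgue_rV R n).

(** Integration theorems apply to Borel functions; the two parts of a Lebesgue
    measurable function are replaced by [u] and [v] at the cost of the null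
    set [M]. *)
Definition borel_parts (f : T -> R[i]) (M : set T) (u v : T -> R) :=
  [/\ borel_null M, measurable_fun setT u /\ box_integrable u,
      measurable_fun setT v /\ box_integrable v &
      forall x, ~ M x -> complex.Re (f x) = u x /\ complex.Im (f x) = v x].

Lemma loc_integrable_parts f : loc_integrable f -> exists M u v, borel_parts f M u v.
Proof.
move=> [[mre mim] fint].
have [M1 nM1 H1] := borel_representative mre.
have [M2 nM2 H2] := borel_representative mim.
have nM := borel_nullU nM1 nM2.
have loc (g : T -> R) : (forall x, `|g x| <= Normc.normc (f x)) ->
    box_integrable (g \_ (~` (M1 `|` M2))).
  move=> gf N; have [K cK NK] := @big_cube_compact R n N.
  apply: le_lt_trans (fint K cK); apply: (le_integral_off nM) => //.
    by move=> x _; rewrite lee_fin normc_ge0.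
  by move=> x Mx /NK Kx; split => //; rewrite lee_fin patchE mem_set.
exists (M1 `|` M2), ((fun x => complex.Re (f x)) \_ (~` (M1 `|` M2))),
  ((fun x => complex.Im (f x)) \_ (~` (M1 `|` M2))); split => //.
- split; first by apply: H1 => // x; left.
  by apply: loc => x; exact: normc_Re_le.
- split; first by apply: H2 => // x; right.
  by apply: loc => x; exact: normc_Im_le.
- by move=> x Mx; rewrite !patchE mem_set.
Qed.

Lemma box_integrable_abs u N : measurable_fun setT u -> @box_integrable R n u ->
  mu.-integrable (big_cube N) (fun x => (u x)%:E).
Proof.
move=> mu' lu; apply/integrableP; split; last exact: lu.
by apply: (@measurable_funS _ _ _ _ setT) => //; exact/measurable_EFinP.
Qed.

Lemma borel_parts_loc f M u v : borel_parts f M u v -> loc_integrable f.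
Proof.
move=> [nM [mu' lu] [mv lv] fuv]; split.
  split; first by apply: (lebesgue_measurable_off nM mu') => x /fuv[].
  by apply: (lebesgue_measurable_off nM mv) => x /fuv[].
move=> K /compact_big_cube[N KN].
have mN := @measurable_big_cube R n N.
apply: (@le_lt_trans _ _ (\int[mu]_(x in big_cube N) (`|u x|%:E + `|v x|%:E))%E).
  apply: (le_integral_off nM) => [x _|x _|].
  - by rewrite lee_fin normc_ge0.
  - by rewrite -EFinD lee_fin addr_ge0.
  move=> x Mx /KN Nx; split=> //; have [<- <-] := fuv x Mx.
  by rewrite -EFinD lee_fin normc_le.
rewrite ge0_integralD//; [|exact: measurable_absE|exact: measurable_absE].
by apply: lte_add_pinfty.
Qed.

Definition weak_partials (u : T -> R) (g : 'I_n -> T -> R) :=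
  forall i phi, test_function phi ->
    (\int[mu]_x (u x * partial i phi x) = - \int[mu]_x (g i x * phi x))%R.

Definition gradient_parts (f : T -> R[i]) (G : T -> 'cV[R[i]]_n) (M : set T)
    (u v : T -> R) (gu gv : 'I_n -> T -> R) :=
  [/\ borel_parts f M u v,
      forall i, borel_parts (fun x => G x i ord0) M (gu i) (gv i),
      weak_partials u gu & weak_partials v gv].

Lemma borel_parts_integral f M u v phi : borel_parts f M u v ->
  cintegral (fun x => f x * real_complex R (phi x)) =
  Complex (\int[mu]_x (u x * phi x))%R (\int[mu]_x (v x * phi x))%R.
Proof.
move=> [nM _ _ fuv]; congr Complex; apply: (Rintegral_off nM) => x Mx;
  have [fu fv] := fuv x Mx.
  by rewrite Re_mul_real fu.
by rewrite Im_mul_real fv.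
Qed.

Lemma borel_partsS f M M' u v : borel_parts f M u v -> borel_null M' -> M `<=` M' ->
  borel_parts f M' u v.
Proof. by move=> [nM Hu Hv fuv] nM' MM'; split => // x Mx; apply: fuv => /MM'. Qed.

Lemma weak_gradient_parts f G : is_weak_gradient f G ->
  exists M u v gu gv, gradient_parts f G M u v gu gv.
Proof.
move=> [lf wG].
have [M0 [u [v H0]]] := loc_integrable_parts lf.
have /choice[z Hz] : forall i, exists z : set T * ((T -> R) * (T -> R)),
    borel_parts (fun x => G x i ord0) z.1 z.2.1 z.2.2.
  move=> i; have [/loc_integrable_parts[M [gu [gv H]]] _] := wG i.
  by exists (M, (gu, gv)).
pose M := M0 `|` \bigcup_i (z i).1.
have nM : borel_null M.
  apply: borel_nullU; first by case: H0.
  by apply: borel_null_countable => i; case: (Hz i).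
have P0 : borel_parts f M u v by apply: borel_partsS H0 nM _ => x; left.
have Pz i : borel_parts (fun x => G x i ord0) M (z i).2.1 (z i).2.2.
  by apply: borel_partsS (Hz i) nM _ => x ?; right; exists i.
exists M, u, v, (fun i => (z i).2.1), (fun i => (z i).2.2); split => //.
- move=> i phi tphi; have [_ /(_ _ tphi)] := wG i.
  by rewrite (borel_parts_integral _ P0) (borel_parts_integral _ (Pz i)) => -[].
- move=> i phi tphi; have [_ /(_ _ tphi)] := wG i.
  by rewrite (borel_parts_integral _ P0) (borel_parts_integral _ (Pz i)) => -[].
Qed.

Lemma gradient_parts_weak f G M u v gu gv : gradient_parts f G M u v gu gv ->
  is_weak_gradient f G.
Proof.
move=> [P0 Pz wu wv]; split; first exact: borel_parts_loc P0.
move=> i; split; first exact: borel_parts_loc (Pz i).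
move=> phi tphi.
by rewrite (borel_parts_integral _ P0) (borel_parts_integral _ (Pz i)) wu// wv.
Qed.

Lemma Rintegral_subM (g h phi : T -> R) : measurable_fun setT g ->
  box_integrable g -> measurable_fun setT h -> box_integrable h ->
  test_function phi ->
  (\int[mu]_x ((g x - h x) * phi x) = \int[mu]_x (g x * phi x) - \int[mu]_x (h x * phi x))%R.
Proof.
move=> mg lg mh lh tphi; rewrite -RintegralB//; last 2 first.
- exact: integrable_test.
- exact: integrable_test.
by apply: eq_Rintegral => x _; rewrite mulrBl.
Qed.

Lemma box_integrableB (g h : T -> R) : measurable_fun setT g ->
  box_integrable g -> measurable_fun setT h -> box_integrable h ->
  box_integrable (fun x => g x - h x).
Proof.
move=> mg lg mh lh N.
have ig := box_integrable_abs N mg lg.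
have ih := box_integrable_abs N mh lh.
have /integrableP[_] := integrableB (@measurable_big_cube R n N) ig ih.
by under eq_integral do rewrite -EFinB abse_EFin.
Qed.

Lemma weak_partials_unique (u u' g g' : T -> R) M i : borel_null M ->
  (forall x, ~ M x -> u x = u' x) ->
  measurable_fun setT g -> box_integrable g ->
  measurable_fun setT g' -> box_integrable g' ->
  (forall phi, test_function phi ->
    (\int[mu]_x (u x * partial i phi x) = - \int[mu]_x (g x * phi x))%R) ->
  (forall phi, test_function phi ->
    (\int[mu]_x (u' x * partial i phi x) = - \int[mu]_x (g' x * phi x))%R) ->
  exists2 M', borel_null M' & forall x, ~ M' x -> g x = g' x.
Proof.
move=> nM uu mg lg mg' lg' H H'.
have mB : measurable_fun setT (fun x => g x - g' x) by exact: measurable_funB.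
have lB := box_integrableB mg lg mg' lg'.
have [|M' nM' HM'] := weakly_zero mB lB.
  move=> phi tphi.
  have fi := integrable_fin_num measurableT (integrable_test mB lB tphi).
  rewrite -[LHS]fineK//; congr EFin.
  have -> : fine (\int[mu]_x ((g x - g' x) * phi x)%:E) =
    (\int[mu]_x ((g x - g' x) * phi x))%R by [].
  rewrite Rintegral_subM//; apply/eqP; rewrite subr_eq0; apply/eqP.
  apply: oppr_inj; rewrite -H// -H'//.
  by apply: (Rintegral_off nM) => x /uu ->.
by exists M' => // x /HM'/eqP; rewrite subr_eq0 => /eqP.
Qed.

(** The difference of two weak partial derivatives is orthogonal to all test
    functions, and [weakly_zero] applies. *)
Lemma weak_gradient_unique (f : T -> R[i]) G G' : is_weak_gradient f G -> is_weak_gradient f G' ->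
  exists2 M, borel_null M & forall x, ~ M x -> G x = G' x.
Proof.
move=> /weak_gradient_parts[M [u [v [gu [gv [P0 Pz wu wv]]]]]].
move=> /weak_gradient_parts[M' [u' [v' [gu' [gv' [P0' Pz' wu' wv']]]]]].
have [nM _ _ fuv] := P0; have [nM' _ _ fuv'] := P0'.
have nMM := borel_nullU nM nM'.
have uu x : ~ (M `|` M') x -> u x = u' x /\ v x = v' x.
  move=> /not_orP[Mx M'x]; have [<- <-] := fuv x Mx; exact: fuv'.
have /choice[A HA] : forall i, exists A : set T, borel_null A /\
    forall x, ~ A x -> gu i x = gu' i x /\ gv i x = gv' i x.
  move=> i; have [_ [mgu lgu] [mgv lgv] _] := Pz i.
  have [_ [mgu' lgu'] [mgv' lgv'] _] := Pz' i.
  have [A1 nA1 H1] := weak_partials_unique nMM (fun x h => (uu x h).1) mgu lgu mgu' lgu' (wu i) (wu' i).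
  have [A2 nA2 H2] := weak_partials_unique nMM (fun x h => (uu x h).2) mgv lgv mgv' lgv' (wv i) (wv' i).
  exists (A1 `|` A2); split; first exact: borel_nullU.
  by move=> x /not_orP[Ax1 Ax2]; rewrite H1// H2.
exists ((M `|` M') `|` \bigcup_i A i).
  by apply: borel_nullU => //; apply: borel_null_countable => i; have [] := HA i.
move=> x /not_orP[/not_orP[Mx M'x] Ax]; apply/colP => i.
have [_ _ _ /(_ x Mx)] := Pz i; have [_ _ _ /(_ x M'x)] := Pz' i.
have [|E1 E2] := (HA i).2 x; first by move=> Aix; apply: Ax; exists i.
rewrite -E1 -E2; case: (G x i ord0) => a b; case: (G' x i ord0) => a' b' /=.
by move=> [-> ->] [-> ->].
Qed.

Lemma borel_partsB f g M M' u v u' v' : borel_parts f M u v ->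
  borel_parts g M' u' v' ->
  borel_parts (f - g) (M `|` M') (fun x => u x - u' x) (fun x => v x - v' x).
Proof.
move=> [nM [mu' lu] [mv lv] fuv] [nM' [mu2 lu'] [mv' lv'] guv]; split.
- exact: borel_nullU.
- by split; [exact: measurable_funB|exact: box_integrableB].
- by split; [exact: measurable_funB|exact: box_integrableB].
- move=> x /not_orP[/fuv[<- <-] /guv[<- <-]].
  by rewrite -Re_sub -Im_sub.
Qed.

Lemma weak_gradientB (f g : T -> R[i]) G H : is_weak_gradient f G -> is_weak_gradient g H ->
  is_weak_gradient (f - g) (fun x => G x - H x).
Proof.
move=> /weak_gradient_parts[M [u [v [gu [gv [P0 Pz wu wv]]]]]].
move=> /weak_gradient_parts[M' [u' [v' [gu' [gv' [P0' Pz' wu' wv']]]]]].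
apply: (@gradient_parts_weak _ _ (M `|` M') (fun x => u x - u' x) (fun x => v x - v' x)
  (fun i x => gu i x - gu' i x) (fun i x => gv i x - gv' i x)); split.
- exact: borel_partsB.
- move=> i; have := borel_partsB (Pz i) (Pz' i).
  by rewrite (_ : _ - _ = (fun x => (G x - H x) i ord0))//; apply/funext => x; rewrite !mxE.
- move=> i phi tphi; have [_ [mu' lu] _ _] := P0; have [_ [mu2 lu'] _ _] := P0'.
  have [_ [mg lg] _ _] := Pz i; have [_ [mg' lg'] _ _] := Pz' i.
  rewrite Rintegral_subM//; last exact: test_partial.
  by rewrite Rintegral_subM// wu// wu'// opprB addrC opprK.
- move=> i phi tphi; have [_ _ [mu' lu] _] := P0; have [_ _ [mu2 lu'] _] := P0'.
  have [_ _ [mg lg] _] := Pz i; have [_ _ [mg' lg'] _] := Pz' i.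
  rewrite Rintegral_subM//; last exact: test_partial.
  by rewrite Rintegral_subM// wv// wv'// opprB addrC opprK.
Qed.
End weak_gradients.

Section translations.
Context (R : realType) (n : nat).
Local Notation T := 'rV[R]_n.
Local Notation mu := (lebesgue_rV R n).
Implicit Types (c : T) (phi u : T -> R).

Lemma borel_null_shift c (M : set T) : borel_null M ->
  borel_null ((fun x => c + x) @^-1` M).
Proof.
move=> [mM M0]; split; last by have := lebesgue_rV_shift c mM; rewrite M0.
by rewrite -[X in measurable X]setTI; exact: measurable_shift.
Qed.

Lemma difference_quotient_shift c phi (x v : T) :
  (fun h : R => h^-1 *: (((fun z : T => phi (c + z)) \o shift x) (h *: v) - phi (c + x))) =
  (fun h : R => h^-1 *: ((phi \o shift (c + x)) (h *: v) - phi (c + x))).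
Proof. by apply/funext => h /=; rewrite addrCA. Qed.

Lemma partial_shift c i phi : partial i (fun x => phi (c + x)) =
  fun x => partial i phi (c + x).
Proof.
by apply/funext => x; rewrite /partial /derive (difference_quotient_shift c phi).
Qed.

Lemma derivable_shift c phi (x v : T) : derivable phi (c + x) v ->
  derivable (fun x => phi (c + x)) x v.
Proof. by rewrite /derivable -difference_quotient_shift. Qed.

Lemma continuous_shift c : continuous (fun x : T => c + x).
Proof.
move=> x; apply: (@cvgD _ _ _ (nbhs x) _ (fun=> c) id); first exact: cvg_cst.
exact: cvg_id.
Qed.

Lemma class_C_shift c k phi : class_C k phi -> class_C k (fun x => phi (c + x)).
Proof.
elim: k phi => [|k IH] phi /= H.
  move=> x; apply: (@continuous_comp _ _ _ (fun x : T => c + x) phi).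
    exact: continuous_shift.
  exact: H.
move=> i; have [d C] := H i; split; first by move=> x; apply: derivable_shift.
by rewrite partial_shift; exact: IH.
Qed.

Lemma test_function_shift c phi : test_function phi ->
  test_function (fun x => phi (c + x)).
Proof.
move=> [smooth csupp]; split; first by move=> k; exact: class_C_shift.
pose K := (fun x : T => - c + x) @` closure [set x : T | phi x != 0].
have cK : compact K.
  apply: continuous_compact => //; apply: continuous_subspaceT; exact: continuous_shift.
apply: (subclosed_compact _ cK); first exact: closed_closure.
have clK : closed K by apply: compact_closed => //; exact: norm_hausdorff.
rewrite [X in _ `<=` X](closure_id _).1//; apply: closure_subset => x /= px.
by exists (c + x); [exact: subset_closure|rewrite addKr].
Qed.

Lemma measurable_fun_shift c u : measurable_fun setT u ->
  measurable_fun setT (fun x => u (c + x)).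
Proof. by move=> mu'; apply: measurableT_comp => //; exact: measurable_shift. Qed.

Lemma Rintegral_shift c u : measurable_fun setT u ->
  (\int[mu]_x u (c + x) = \int[mu]_x u x)%R.
Proof.
move=> mu'; rewrite /Rintegral; congr fine.
have me : measurable_fun setT (fun x => (u x)%:E) by exact/measurable_EFinP.
rewrite integralE [RHS]integralE.
rewrite [in RHS](integral_shift c measurableT (measurable_funepos me)); last first.
  by move=> x; exact: funepos_ge0.
rewrite [in RHS](integral_shift c measurableT (measurable_funeneg me)); last first.
  by move=> x; exact: funeneg_ge0.
by congr (_ - _)%E; apply: eq_integral => x _; rewrite ?funeposE ?funenegE.
Qed.

Lemma box_integrable_shift c u : measurable_fun setT u -> box_integrable u ->
  box_integrable (fun x => u (c + x)).
Proof.
move=> mu' lu N; pose N' := (N + (Num.truncn (norm1 c)).+1)%N.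
have mau : measurable_fun setT (fun x => `|u x|%:E) by exact: measurable_absE.
have mN := @measurable_big_cube R n N; have mN' := @measurable_big_cube R n N'.
apply: le_lt_trans (lu N').
rewrite [leRHS](integral_shift c mN')//; last exact: measurable_funS mau.
apply: ge0_subset_integral => //.
- by rewrite -[X in measurable X]setTI; exact: measurable_shift.
- apply: (@measurable_funS _ _ _ _ setT) => //.
  exact: (measurableT_comp mau (@measurable_shift _ _ c)).
move=> x Nx i; rewrite mxE.
have ci : `|c ord0 i| < (Num.truncn (norm1 c)).+1%:R.
  apply: le_lt_trans (truncnS_gt _); rewrite /norm1 (bigD1 i)//= lerDl; exact: sumr_ge0.
have := Nx i; rewrite /N' natrD; move: ci; rewrite ltr_norml => /andP[a1 a2] /andP[b1 b2].
by apply/andP; split; lra.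
Qed.

Lemma borel_parts_shift c (f : T -> R[i]) M u v : borel_parts f M u v ->
  borel_parts (fun x => f (c + x)) ((fun x => c + x) @^-1` M)
    (fun x => u (c + x)) (fun x => v (c + x)).
Proof.
move=> [nM [mu' lu] [mv lv] fuv]; split.
- exact: borel_null_shift.
- by split; [exact: measurable_fun_shift|exact: box_integrable_shift].
- by split; [exact: measurable_fun_shift|exact: box_integrable_shift].
- by move=> x Mx; exact: fuv.
Qed.

(** The translation is moved to the test function by invariance of the Lebesgue
    measure. *)
Lemma weak_partials_shift c u (g : 'I_n -> T -> R) : measurable_fun setT u ->
  (forall i, measurable_fun setT (g i)) -> weak_partials u g ->
  weak_partials (fun x => u (c + x)) (fun i x => g i (c + x)).
Proof.
move=> mu' mg H i phi tphi.
have tphi' := test_function_shift (- c) tphi.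
have := H i _ tphi'; rewrite partial_shift.
rewrite -(@Rintegral_shift c); last first.
  apply: measurable_funM => //; apply: (@measurable_fun_shift (- c) (partial i phi)).
  by apply: measurable_continuous; apply: test_continuous; exact: test_partial.
rewrite -(@Rintegral_shift c (fun x => g i x * _)); last first.
  apply: measurable_funM => //; apply: (@measurable_fun_shift (- c) phi).
  by apply: measurable_continuous; apply: test_continuous.
under eq_Rintegral do rewrite addKr.
by under [in X in _ = X -> _]eq_Rintegral do rewrite addKr.
Qed.

Lemma weak_gradient_translate y (f : T -> R[i]) G : is_weak_gradient f G ->
  is_weak_gradient (translate y f) (fun x => G (x - y)).
Proof.
move=> /weak_gradient_parts[M [u [v [gu [gv [P0 Pz wu wv]]]]]].
pose c := - y.
have -> : translate y f = fun x => f (c + x).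
  by apply/funext => x; rewrite /translate addrC.
have -> : (fun x => G (x - y)) = fun x => G (c + x).
  by apply/funext => x; rewrite addrC.
apply: (@gradient_parts_weak _ _ _ _ ((fun x => c + x) @^-1` M) (fun x => u (c + x))
  (fun x => v (c + x)) (fun i x => gu i (c + x)) (fun i x => gv i (c + x))); split.
- exact: borel_parts_shift.
- by move=> i; exact: borel_parts_shift (Pz i).
- by apply: weak_partials_shift => //; [case: P0 => _ []|move=> i; case: (Pz i) => _ []].
- by apply: weak_partials_shift => //; [case: P0 => _ _ []|move=> i; case: (Pz i) => _ _ []].
Qed.

Lemma weak_gradientP (f : T -> R[i]) : (exists G, is_weak_gradient f G) ->
  is_weak_gradient f (weak_gradient f).
Proof. by move=> [G fG]; rewrite /weak_gradient; case: xgetP => // /(_ G). Qed.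

(** [weak_gradient] is chosen for each function separately; uniqueness makes it
    additive up to null sets. *)
Lemma weak_gradient_subE (f g : T -> R[i]) : (exists G, is_weak_gradient f G) ->
  (exists G, is_weak_gradient g G) ->
  (exists G, is_weak_gradient (f - g) G) /\ exists2 M, borel_null M &
    forall x, ~ M x -> weak_gradient (f - g) x = weak_gradient f x - weak_gradient g x.
Proof.
move=> /weak_gradientP fG /weak_gradientP gG.
have fg := weak_gradientB fG gG.
have ex : exists G, is_weak_gradient (f - g) G by eexists; exact: fg.
by split=> //; exact: (weak_gradient_unique (weak_gradientP ex) fg).
Qed.

Lemma weak_gradient_sub_translateE y (f : T -> R[i]) : (exists G, is_weak_gradient f G) ->
  (exists G, is_weak_gradient (f - translate y f) G) /\ exists2 M, borel_null M &
    forall x, ~ M x -> weak_gradient (f - translate y f) x =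
      weak_gradient f x - weak_gradient f (x - y).
Proof.
move=> /weak_gradientP fG.
have fg := weak_gradientB fG (weak_gradient_translate y fG).
have ex : exists G, is_weak_gradient (f - translate y f) G by eexists; exact: fg.
by split=> //; exact: (weak_gradient_unique (weak_gradientP ex) fg).
Qed.
End translations.

(** * Borel functional calculus of Hermitian matrices *)

Section limit_algebra.
Context (R : realType).

(** These closure properties force a class of functions to contain every nonnegative
    Borel function, see [la_borel]. *)
Record limit_algebra (C : set (R -> R)) : Prop := LimitAlgebra {
  la_cst : forall c, C (fun=> c);
  la_id : C id;
  la_add : forall f g, C f -> C g -> C (fun x => f x + g x);
  la_mul : forall f g, C f -> C g -> C (fun x => f x * g x);
  la_lim : forall (f_ : nat -> R -> R) f, (forall k, C (f_ k)) ->
    (forall x, f_ k x @[k --> \oo] --> f x) -> C f }.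

Variables (C : set (R -> R)) (CP : limit_algebra C).

Lemma la_scale c f : C f -> C (fun x => c * f x).
Proof. by move=> Cf; apply: (la_mul CP) => //; exact: la_cst. Qed.

Lemma la_sub f g : C f -> C g -> C (fun x => f x - g x).
Proof.
move=> Cf Cg; have := la_add CP Cf (la_scale (-1) Cg).
by congr C; apply/funext => x; rewrite mulN1r.
Qed.

Lemma la_sum (I : Type) (s : seq I) (F : I -> R -> R) : (forall i, C (F i)) ->
  C (fun x => \sum_(i <- s) F i x).
Proof.
move=> CF; elim: s => [|i s IH].
  by under eq_fun do rewrite big_nil; exact: la_cst.
by under eq_fun do rewrite big_cons; exact: la_add.
Qed.

Lemma la_prod (I : Type) (s : seq I) (F : I -> R -> R) : (forall i, C (F i)) ->
  C (fun x => \prod_(i <- s) F i x).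
Proof.
move=> CF; elim: s => [|i s IH].
  by under eq_fun do rewrite big_nil; exact: la_cst.
by under eq_fun do rewrite big_cons; exact: la_mul.
Qed.

Lemma la_exp f : C f -> C (fun x => expR (f x)).
Proof.
move=> Cf; apply: (la_lim CP (f_ := fun k x => series (exp_coeff (f x)) k)).
  move=> k; rewrite /series /=; apply: la_sum => i; rewrite /exp_coeff /=.
  have := la_scale (i`!%:R^-1) (@la_prod _ (index_enum 'I_i) (fun _ x => f x) (fun=> Cf)).
  by congr C; apply/funext => x; rewrite prodr_const card_ord mulrC.
by move=> x; rewrite /expR; exact: is_cvg_series_exp_coeff.
Qed.

(** [expR (- expR (- k * y))] tends to 1 or 0 according to the sign of [y], and to
    [expR (- 1)] at [y = 0]; the second factor restores the value 0 there and tends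
    to 1 elsewhere. *)
Lemma la_gt a : C (\1_(`]a, +oo[%classic) : R -> R).
Proof.
pose y x : R := x - a.
have Cy : C y by apply: (la_sub (la_id CP)); exact: la_cst.
pose f_ (k : nat) x := expR (- expR (- (k%:R * y x))) * (1 - expR (- (k%:R * (y x * y x)))).
apply: (la_lim CP (f_ := f_)) => [k|x].
  have Cs g : C g -> C (fun x => expR (- (k%:R * g x))).
    move=> Cg; apply: la_exp; have := la_scale (- k%:R) Cg.
    by congr C; apply/funext => x; rewrite mulNr.
  apply: (la_mul CP).
    apply: la_exp; have := la_scale (-1) (Cs _ Cy).
    by congr C; apply/funext => x; rewrite mulN1r.
  apply: la_sub; first exact: la_cst.
  by apply: Cs; exact: (la_mul CP).
have E0 (s : R) : 0 < s -> expR (- (k%:R * s)) @[k --> \oo] --> 0.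
  move=> s0; under eq_fun do rewrite -mulrN expRM_natl.
  apply: cvg_expr; rewrite ger0_norm ?expR_ge0//.
  by rewrite -expR0 ltr_expR oppr_lt0.
rewrite indicE; have [ya|] := ltP a x.
  rewrite mem_set; last by rewrite /= in_itv/= andbT.
  have y0 : 0 < y x by rewrite subr_gt0.
  have -> : (true%:R : R) = expR (- 0) * (1 - 0) by rewrite !oppr0 expR0 addr0 mulr1.
  apply: cvgM.
    apply: continuous_cvg; first exact: continuous_expR.
    by apply: cvgN; exact: E0.
  by apply: cvgB; [exact: cvg_cst|apply: E0; exact: mulr_gt0].
rewrite le_eqVlt => /predU1P[->|xa]; rewrite memNset ?(in_itv,ltxx)//=.
- apply: cvg_near_cst; apply: nearW => k.
  by rewrite /f_ /y subrr !mulr0 oppr0 expR0 subrr mulr0.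
- by rewrite in_itv/= ltxx.
- have y0 : 0 < - y x by rewrite opprB subr_gt0.
  apply: (@squeeze_cvgr _ _ _ _ (fun=> 0) (fun k : nat => expR (- (k%:R * - y x)))).
  + apply: nearW => k; have h : 0 <= 1 - expR (- (k%:R * (y x * y x))) <= 1.
      rewrite subr_ge0 lerBlDr lerDl expR_ge0 andbT -expR0 ler_expR oppr_le0.
      by rewrite mulr_ge0// -expr2 sqr_ge0.
    have /andP[h0 h1] := h; apply/andP; split; first by rewrite mulr_ge0 ?expR_ge0.
    apply: (@le_trans _ _ (expR (- expR (- (k%:R * y x))))).
      by rewrite ler_piMr ?expR_ge0.
    rewrite ler_expR lerN2 -mulrN; apply: le_trans (expR_ge1Dx _).
    by rewrite lerDr.
  + exact: cvg_cst.
  + exact: E0.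
- by rewrite in_itv/= andbT ltNge ltW.
Qed.

(** The sets whose indicator function is in the class form a sigma-algebra, which
    contains the open half-lines by [la_gt]. *)
Lemma la_indic (A : set (measurableTypeR R)) : measurable A -> C (\1_A : R -> R).
Proof.
move=> mA; pose G : set (set R) := [set A | C (\1_A : R -> R)].
suff : <<s RGenOInfty.G (R := R) >> `<=` G.
  by apply; move: mA; rewrite RGenOInfty.measurableE.
apply: smallest_sub; last by move=> _ [a ->]; exact: la_gt.
split.
- rewrite /G /= (_ : \1_set0 = fun=> 0); first exact: la_cst.
  by apply/funext => x; rewrite indicE in_set0.
- move=> B GB; rewrite /G /=.
  have := la_sub (la_cst CP 1) GB; congr C; apply/funext => x.
  rewrite !indicE setTD in_setC; case: (x \in B); rewrite /= ?subrr ?subr0//.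
- move=> B GB; rewrite /G /=.
  (* the indicator functions of the finite unions *)
  pose f_ (k : nat) (x : R) := (1 - \prod_(i <- iota 0 k) (1 - \1_(B i) x) : R).
  apply: (la_lim CP (f_ := f_)) => [k|x].
    apply: la_sub; first exact: la_cst.
    by apply: la_prod => i; apply: la_sub; [exact: la_cst|exact: GB].
  have [[i _ Bix]|nB] := pselect ((\bigcup_i B i) x); rewrite indicE.
    rewrite mem_set; last by exists i.
    apply: cvg_near_cst; exists i.+1 => // k /= ik; rewrite /f_.
    rewrite (big_rem i)/=; last by rewrite mem_iota add0n.
    by rewrite indicE mem_set// subrr mul0r subr0.
  rewrite memNset//; apply: cvg_near_cst; apply: nearW => k; rewrite /f_.
  rewrite big1 ?subrr// => i _; rewrite indicE memNset ?subr0// => Bix.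
  by apply: nB; exists i.
Qed.

Lemma la_borel (f : measurableTypeR R -> R) : measurable_fun setT f ->
  (forall x, 0 <= f x) -> C f.
Proof.
move=> mf f0; have mf' : measurable_fun setT (EFin \o f) by exact/measurable_EFinP.
pose f_ k : {nnsfun measurableTypeR R >-> R} := nnsfun_approx measurableT mf' k.
pose g_ (k : nat) : R -> R := f_ k.
apply: (la_lim CP (f_ := g_)) => [k|x]; last first.
  have := @cvg_nnsfun_approx _ _ _ _ measurableT _ mf' (fun x _ => f0 x) x Logic.I.
  by move/fine_cvgP => -[].
rewrite /g_ (_ : (f_ k : R -> R) = fun x =>
  \sum_(y <- finmap.enum_fset (fset_set (range (f_ k)))) y * \1_(f_ k @^-1` [set y]) x).
  by apply: la_sum => y; apply: la_scale; exact: la_indic.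
by apply/funext => x; rewrite [LHS]fimfunE fsbig_finite.
Qed.
End limit_algebra.

Lemma cvg_eq_fun (R : realType) (u v : nat -> R) (a b : R) : u =1 v -> a = b ->
  v @ \oo --> b -> u @ \oo --> a.
Proof. by move=> /funext -> ->. Qed.

Lemma cvg_finite_sum (R : realType) (I : Type) (s : seq I) (u : I -> nat -> R) (l : I -> R) :
  (forall i, u i m @[m --> \oo] --> l i) ->
  \sum_(i <- s) u i m @[m --> \oo] --> \sum_(i <- s) l i.
Proof.
move=> ul; elim: s => [|i s IH].
  by under eq_fun do rewrite big_nil; rewrite big_nil; exact: cvg_cst.
under eq_fun do rewrite big_cons; rewrite big_cons; exact: cvgD.
Qed.

Section functional_calculus.
Context (R : realType) (n : nat).
Local Notation C := R[i].
Implicit Types (A : 'M[C]_n) (g h : R -> R).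

Lemma Re_add (z w : C) : complex.Re (z + w) = complex.Re z + complex.Re w.
Proof. by case: z w => [a b] [c e]. Qed.

Lemma Im_add (z w : C) : complex.Im (z + w) = complex.Im z + complex.Im w.
Proof. by case: z w => [a b] [c e]. Qed.

Lemma Re_mul (z w : C) : complex.Re (z * w) =
  complex.Re z * complex.Re w - complex.Im z * complex.Im w.
Proof. by case: z w => [a b] [c e]. Qed.

Lemma Im_mul (z w : C) : complex.Im (z * w) =
  complex.Re z * complex.Im w + complex.Im z * complex.Re w.
Proof. by case: z w => [a b] [c e]. Qed.

Lemma Re_sum (I : Type) (s : seq I) (F : I -> C) :
  complex.Re (\sum_(i <- s) F i) = \sum_(i <- s) complex.Re (F i).
Proof. by elim/big_rec2: _ => // i x y _ <-; rewrite Re_add. Qed.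

Lemma Im_sum (I : Type) (s : seq I) (F : I -> C) :
  complex.Im (\sum_(i <- s) F i) = \sum_(i <- s) complex.Im (F i).
Proof. by elim/big_rec2: _ => // i x y _ <-; rewrite Im_add. Qed.

Definition fcalc g A : 'M[C]_n :=
  invmx (spectralmx A) *m
  diag_mx (map_mx (fun l => real_complex R (g (complex.Re l))) (spectral_diag A)) *m
  spectralmx A.

Let eig A k : R := complex.Re (spectral_diag A ord0 k).
Let coef A i j k : C := invmx (spectralmx A) i k * spectralmx A k j.

Lemma fcalcE g A i j : fcalc g A i j =
  \sum_k coef A i j k * real_complex R (g (eig A k)).
Proof.
rewrite mxE; apply: eq_bigr => k _; rewrite mxE (bigD1 k)//= big1 ?addr0.
  by rewrite !mxE eqxx mulr1n -mulrA [_ * spectralmx A k j]mulrC mulrA.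
by move=> l lk; rewrite !mxE (negPf lk) mulr0n mulr0.
Qed.

Lemma Re_fcalc g A i j : complex.Re (fcalc g A i j) =
  \sum_k complex.Re (coef A i j k) * g (eig A k).
Proof. by rewrite fcalcE Re_sum; apply: eq_bigr => k _; rewrite Re_mul_real. Qed.

Lemma Im_fcalc g A i j : complex.Im (fcalc g A i j) =
  \sum_k complex.Im (coef A i j k) * g (eig A k).
Proof. by rewrite fcalcE Im_sum; apply: eq_bigr => k _; rewrite Im_mul_real. Qed.

Lemma fcalc_add g h A : fcalc (fun x => g x + h x) A = fcalc g A + fcalc h A.
Proof.
apply/matrixP => i j; rewrite [RHS]mxE.
apply: (etrans (fcalcE _ _ _ _)).
apply: etrans (esym (congr2 _ (fcalcE g A i j) (fcalcE h A i j))).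
rewrite -big_split.
by apply: eq_bigr => k _; rewrite rmorphD mulrDr.
Qed.

Lemma fcalc_mul g h A : fcalc (fun x => g x * h x) A = fcalc g A *m fcalc h A.
Proof.
rewrite /fcalc; move: (spectralmx A) (spectral_unit A) (spectral_diag A) => P uP l.
rewrite !mulmxA (mulmxK uP); congr (_ *m _).
rewrite -!mulmxA mulmx_diag; congr (_ *m diag_mx _).
by apply/rowP => k; rewrite !mxE rmorphM.
Qed.

Lemma fcalc_cst c A : fcalc (fun=> c) A = (real_complex R c)%:M.
Proof.
rewrite /fcalc; move: (spectralmx A) (spectral_unit A) (spectral_diag A) => P uP l.
rewrite (_ : map_mx _ _ = const_mx (real_complex R c)).
  by rewrite diag_const_mx -scalemx1 -scalemxAr mulmx1 -scalemxAl (mulVmx uP).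
by apply/rowP => k; rewrite !mxE.
Qed.

Lemma fcalc_id A : A \is hermsymmx -> fcalc id A = A.
Proof.
move=> hA; have E := orthomx_spectralP (hermitian_normalmx hA).
have r : map_mx (fun l => real_complex R (complex.Re l)) (spectral_diag A) = spectral_diag A.
  apply/rowP => k; rewrite mxE; apply: RRe_real.
  by have /mxOverP := hermitian_spectral_diag_real hA; exact.
by apply: etrans (esym E); rewrite /fcalc r.
Qed.

Lemma det_fcalc g A : \det (fcalc g A) = \prod_k real_complex R (g (eig A k)).
Proof.
rewrite /fcalc /eig; move: (spectralmx A) (spectral_unit A) (spectral_diag A) => P uP l.
rewrite !det_mulmx det_inv mulrAC mulVr ?mul1r -?unitmxE//.
by rewrite det_diag; apply: eq_bigr => k _; rewrite mxE.
Qed.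

Lemma eq_fcalc g h A : (forall k, g (eig A k) = h (eig A k)) -> fcalc g A = fcalc h A.
Proof.
move=> gh; apply/matrixP => i j; apply: (etrans (fcalcE _ _ _ _)).
by apply: etrans (esym (fcalcE h A i j)); apply: eq_bigr => k _; rewrite gh.
Qed.

Lemma mxpowerE A (a : R) : mxpower A a = fcalc (fun x => x `^ a) A.
Proof. by congr (_ *m diag_mx _ *m _). Qed.

Context d (S : measurableType d).

Definition cmx_measurable (A : S -> 'M[C]_n) := forall i j,
  measurable_fun setT (fun s => complex.Re (A s i j)) /\
  measurable_fun setT (fun s => complex.Im (A s i j)).

Lemma cmx_measurableD (A B : S -> 'M[C]_n) : cmx_measurable A -> cmx_measurable B ->
  cmx_measurable (fun s => A s + B s).
Proof.
move=> mA mB i j; have [mA1 mA2] := mA i j; have [mB1 mB2] := mB i j.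
split; under eq_fun do rewrite mxE ?Re_add ?Im_add; exact: measurable_funD.
Qed.

Lemma cmx_measurableM (A B : S -> 'M[C]_n) : cmx_measurable A -> cmx_measurable B ->
  cmx_measurable (fun s => A s *m B s).
Proof.
move=> mA mB i j; split; under eq_fun do rewrite mxE ?Re_sum ?Im_sum;
  apply: measurable_sum => k; have [mA1 mA2] := mA i k; have [mB1 mB2] := mB k j.
  by under eq_fun do rewrite Re_mul; apply: measurable_funB; exact: measurable_funM.
by under eq_fun do rewrite Im_mul; apply: measurable_funD; exact: measurable_funM.
Qed.

(** The diagonalization of [A s] is not chosen measurably in [s], so the measurability
    of [g (A s)] cannot be read off its definition.  It is inherited from the
    identity function, for which the matrix is [A s] itself, through sums,
    products and limits. *)
Lemma fcalc_limit_algebra (A : S -> 'M[C]_n) : cmx_measurable A ->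
  (forall s, A s \is hermsymmx) ->
  limit_algebra [set g | cmx_measurable (fun s => fcalc g (A s))].
Proof.
move=> mA hA; split => /=.
- move=> c i j; split; under eq_fun do rewrite fcalc_cst.
    exact: measurable_cst.
  exact: measurable_cst.
- by under eq_fun do rewrite (fcalc_id (hA _)).
- move=> g h mg mh; rewrite (_ : (fun s => _) = fun s => fcalc g (A s) + fcalc h (A s)).
    exact: (cmx_measurableD mg mh).
  by apply/funext => s; exact: fcalc_add.
- move=> g h mg mh; rewrite (_ : (fun s => _) = fun s => fcalc g (A s) *m fcalc h (A s)).
    exact: (cmx_measurableM mg mh).
  by apply/funext => s; exact: fcalc_mul.
- move=> g_ g mg gg i j.
  have lim (c : 'I_n -> S -> R) s : \sum_k c k s * g_ m (eig (A s) k) @[m --> \oo] -->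
      \sum_k c k s * g (eig (A s) k).
    by apply: cvg_finite_sum => k; apply: cvgM; [exact: cvg_cst|exact: gg].
  split.
    apply: (measurable_fun_cvg (h := fun k s => complex.Re (fcalc (g_ k) (A s) i j))).
      by move=> k; have [] := mg k i j.
    move=> s _.
    exact: (cvg_eq_fun (fun m => Re_fcalc (g_ m) (A s) i j) (Re_fcalc g (A s) i j)
      (lim (fun k s => complex.Re (coef (A s) i j k)) s)).
  apply: (measurable_fun_cvg (h := fun k s => complex.Im (fcalc (g_ k) (A s) i j))).
    by move=> k; have [] := mg k i j.
  move=> s _.
  exact: (cvg_eq_fun (fun m => Im_fcalc (g_ m) (A s) i j) (Im_fcalc g (A s) i j)
      (lim (fun k s => complex.Im (coef (A s) i j k)) s)).
Qed.

Lemma measurable_mxpower (A : S -> 'M[C]_n) (a : R) : cmx_measurable A ->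
  (forall s, A s \is hermsymmx) -> cmx_measurable (fun s => mxpower (A s) a).
Proof.
move=> mA hA.
rewrite (_ : (fun s => _) = fun s => fcalc (fun x => x `^ a) (A s)); last first.
  by apply/funext => s; exact: mxpowerE.
apply: (la_borel (fcalc_limit_algebra mA hA) (f := fun x => x `^ a)).
  exact: measurable_powR.
by move=> x; exact: powR_ge0.
Qed.
End functional_calculus.

(** * Dyadic norms and gauges *)

Section dyadic_mixed_norm.
Context (R : realType) (n : nat).
Local Notation T := 'rV[R]_n.
Local Notation mu := (lebesgue_rV R n).
Local Open Scope ereal_scope.
Variables (c : int * 'rV[int]_n -> \bar R) (p : R) (r : \bar R).
Hypotheses (c0 : forall i, 0 < c i) (p1 : (1 <= p)%R) (pr : p%:E <= r).

Definition dyadic_norm : (T -> \bar R) -> \bar R :=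
  mixed_norm mu (fun jk : int * 'rV[int]_n => @dyadic_cube R n jk.1 jk.2) c p r.

Let c_ge0 i : 0 <= c i. Proof. exact: ltW. Qed.
Let mQ (jk : int * 'rV[int]_n) : measurable (@dyadic_cube R n jk.1 jk.2).
Proof. exact: measurable_dyadic. Qed.
Let term h i : c i * (\int[mu]_(y in dyadic_cube i.1 i.2) h y `^ p) `^ p^-1 <=
  dyadic_norm h.
Proof. exact: (mixed_norm_ge_term mu _ c_ge0 p1 pr h i). Qed.
Let p0 : (0 < p)%R. Proof. exact: lt_le_trans ltr01 p1. Qed.
Let r0 : 0 < r. Proof. by apply: lt_le_trans pr; rewrite lte_fin. Qed.

Lemma integral_cube_gt0 j k (h : T -> \bar R) : measurable_fun setT h ->
  (forall x, 0 <= h x) -> (forall x, dyadic_cube j k x -> 0 < h x) ->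
  0 < \int[mu]_(x in dyadic_cube j k) h x.
Proof.
move=> mh h0 hpos; rewrite lt_def integral_ge0// andbT; apply/eqP => I0.
have mQ' := @measurable_dyadic R n j k.
have : \int[mu]_(x in dyadic_cube j k) `|h x| = 0.
  by rewrite -[RHS]I0; apply: eq_integral => x _; rewrite gee0_abs.
move/(ae_eq_integral_abs mu mQ' (measurable_funS measurableT (@subsetT _ _) mh)).
move=> [N [mN N0 HN]].
have : mu (dyadic_cube j k) <= mu N.
  apply: le_measure; rewrite ?inE// => x Qx; apply: HN => /= /(_ Qx) hx0.
  by have := hpos x Qx; rewrite hx0 ltxx.
rewrite [X in _ <= X]N0 lebesgue_dyadic lee_fin leNgt exprn_gt0//.
exact: dyadic_side_gt0.
Qed.

Lemma dyadic_norm_quasinorm : lattice_quasinorm dyadic_norm.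
Proof.
split.
- move=> h; have H := term h (0%R, 0%R).
  by apply: le_trans H; rewrite mule_ge0// poweR_ge0.
- by move=> *; exact: le_mixed_norm.
- by move=> *; exact: mixed_normD_le.
- by move=> *; exact: mixed_normZ_le.
- by move=> *; exact: mixed_norm_average.
- move=> j k h mh h0 hpos.
  have H := term h (j, k).
  apply: lt_le_trans H => /=; rewrite mule_gt0//; apply: poweR_gt0; apply: integral_cube_gt0.
  + exact: (measurableT_comp (measurable_poweR p) mh).
  + by move=> x; exact: poweR_ge0.
  + by move=> x Qx; apply: poweR_gt0; exact: hpos.
Qed.

(** This compares the norm of a Lebesgue measurable function with that of a Borel
    representative, and rests on [ge0_le_integral_off]. *)
Lemma dyadic_norm_le_off M h1 h2 : borel_null M -> (forall x, 0 <= h1 x) ->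
  (forall x, 0 <= h2 x) -> (forall x, ~ M x -> h1 x <= h2 x) ->
  dyadic_norm h1 <= dyadic_norm h2.
Proof.
move=> nM h10 h20 h12; apply: le_lr_norm => // i.
  by rewrite mule_ge0// poweR_ge0.
apply: lee_wpmul2l => //; apply: le_poweR; first by rewrite invr_ge0 ltW.
  by apply: integral_ge0 => x _; exact: poweR_ge0.
apply: (le_integral_off nM) => [x _|x _|x Mx Qx]; [exact: poweR_ge0|exact: poweR_ge0|].
by split => //; apply: le_poweR => //; [exact: ltW|exact: h12].
Qed.
End dyadic_mixed_norm.

Section gauge_transfer.
Context (R : realType) (n' m : nat).
Local Notation n := n'.+1.
Local Notation T := 'rV[R]_n.
Local Notation mu := (lebesgue_rV R n).
Variables (c : int * 'rV[int]_n -> \bar R) (p : R) (r : \bar R).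
Hypotheses (c0 : forall i, (0 < c i)%E) (p1 : 1 <= p) (pr : (p%:E <= r)%E).
Local Notation Nr h := (dyadic_norm c p r (fun x => (h x)%:E)).

Variables (L : T -> 'M[R]_m) (lam : T -> R).
Hypothesis mL : forall i j, measurable_fun setT (fun x => L x i j).
Hypothesis mlam : measurable_fun setT lam.
Hypothesis lam0 : forall x, 0 < lam x.
Hypothesis lam_le : forall x v, lam x * norm1 v <= rho L x v.

Variables (Z : zmodType) (vec : Z -> 'rV[R]_m) (sg : T -> Z -> R) (K : R) (M0 : set T).
Hypothesis vecB : forall a b, vec (a - b) = vec a - vec b.
Hypothesis sg0 : forall x z, 0 <= sg x z.
Hypothesis K0 : 0 < K.
Hypothesis nM0 : borel_null M0.
Hypothesis sg_le : forall x z, ~ M0 x -> sg x z <= rho L x (vec z).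
Hypothesis sg_ge : forall x z, ~ M0 x -> rho L x (vec z) <= K * sg x z.

Variables (Idx : Type) (F : set Idx) (X : Idx -> T -> Z).
Hypothesis XG : forall f, F f -> exists g : T -> 'rV[R]_m,
  [/\ measurable_fun setT g, cube_integrable g &
      exists2 M, borel_null M & forall x, ~ M x -> vec (X f x) = g x].

Let NP := dyadic_norm_quasinorm c0 p1 pr.

(** The function [s] is arbitrary, so the factor is taken out of the norm of the
    Borel function [h]. *)
Lemma dyadic_norm_ler (h : T -> R) (s : T -> R) M (k : R) : measurable_fun setT h ->
  borel_null M -> 0 < k ->
  (forall x, 0 <= h x) -> (forall x, 0 <= s x) ->
  (forall x, ~ M x -> h x <= k * s x) -> (Nr h <= k%:E * Nr s)%E.
Proof.
move=> mh nM k0 h0 s0 hs.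
have mh' : measurable_fun setT (fun x => k^-1 * h x) by exact: measurable_funM.
have h0' x : 0 <= k^-1 * h x by rewrite mulr_ge0// invr_ge0 ltW.
have -> : h = (fun x => k * (k^-1 * h x)).
  by apply/funext => x; rewrite mulrA divff ?gt_eqF// mul1r.
apply: (le_trans (Nr_scale NP mh' h0' (ltW k0))).
apply: lee_wpmul2l; first by rewrite lee_fin ltW.
apply: (dyadic_norm_le_off c0 p1 pr nM) => x; rewrite ?lee_fin// => Mx.
by rewrite mulrC ler_pdivrMr// mulrC hs.
Qed.

(** The form of [equicontinuous_colouring] that applies to Lebesgue measurable
    functions with values in [Z], the gauge [sg] being comparable to [rho] off a
    null set. *)
Theorem gauge_colouring :
  (forall f, F f -> (Nr (fun x => sg x (X f x)) < +oo)%E) ->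
  (forall e : R, 0 < e -> exists a : R, forall f, F f ->
    (Nr (fun x => \1_(far a) x * sg x (X f x)) <= e%:E)%E) ->
  (forall e : R, 0 < e -> exists2 a : R, 0 < a & forall f, F f ->
    forall y : T, (forall i, `|y ord0 i| <= a) ->
    (Nr (fun x => sg x (X f x - X f (x - y)%R)) <= e%:E)%E) ->
  forall e : R, 0 < e ->
  exists (C : finType) (cls : Idx -> C), forall f g, F f -> F g -> cls f = cls g ->
    (Nr (fun x => sg x (X f x - X g x)) <= e%:E)%E.
Proof.
move=> fin van equi e e0.
have /choice[G HG] : forall f, exists g : T -> 'rV[R]_m, F f ->
    [/\ measurable_fun setT g, cube_integrable g &
      exists2 M, borel_null M & forall x, ~ M x -> vec (X f x) = g x].
  move=> f; have [/XG[g Hg]|nF] := pselect (F f); first by exists g.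
  by exists (fun=> 0).
have mG f : F f -> measurable_fun setT (G f) by move=> /HG[].
have iG f : F f -> cube_integrable (G f) by move=> /HG[].
have eps u : 0 < u -> (K%:E * (u / K)%:E = u%:E)%E.
  by move=> u0; rewrite -EFinM mulrCA divff ?gt_eqF// mulr1.
have [|||C [cls Hcls]] := equicontinuous_colouring NP mL mlam lam0 lam_le mG iG _ _ _ e0.
- move=> f Ff; have [M nM HM] := (HG f Ff).
  have [_ _ [M' nM' HM']] := HG f Ff.
  apply: (@le_lt_trans _ _ (K%:E * Nr (fun x => sg x (X f x)))%E).
    apply: (@dyadic_norm_ler _ _ (M0 `|` M')) => //.
    + by apply: (measurable_rho mL) => //; exact: mG.
    + exact: borel_nullU.
    + by move=> x; exact: rho_ge0.
    + by move=> x /not_orP[M0x /HM' <-]; exact: sg_ge.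
  by rewrite lte_mul_pinfty ?lee_fin ?ltW ?fin// ?fin_numE.
- move=> u u0; have [a Ha] := van (u / K) (divr_gt0 u0 K0); exists a => f Ff.
  have [_ _ [M' nM' HM']] := HG f Ff.
  apply: (@le_trans _ _ (K%:E * Nr (fun x => \1_(far a) x * sg x (X f x)))%E); last first.
    rewrite -[leRHS](eps _ u0); apply: lee_wpmul2l; first by rewrite lee_fin ltW.
    exact: Ha.
  apply: (@dyadic_norm_ler _ _ (M0 `|` M')) => //.
  + apply: measurable_funM; first by apply: measurable_indic; exact: measurable_far.
    by apply: (measurable_rho mL) => //; exact: mG.
  + exact: borel_nullU.
  + by move=> x; rewrite mulr_ge0// rho_ge0.
  + by move=> x; rewrite mulr_ge0.
  + move=> x /not_orP[M0x /HM' <-]; rewrite mulrCA; apply: ler_wpM2l => //.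
    exact: sg_ge.
- move=> u u0; have [a a0 Ha] := equi (u / K) (divr_gt0 u0 K0); exists a => // f Ff y ya.
  have [_ _ [M' nM' HM']] := HG f Ff.
  apply: (@le_trans _ _ (K%:E * Nr (fun x => sg x (X f x - X f (x - y)%R)))%E); last first.
    rewrite -[leRHS](eps _ u0); apply: lee_wpmul2l; first by rewrite lee_fin ltW.
    exact: Ha.
  apply: (@dyadic_norm_ler _ _ ((M0 `|` M') `|` ((fun x => - y + x) @^-1` M'))) => //.
  + apply: (measurable_rho mL) => //; apply: measurable_rVB; first exact: mG.
    under eq_fun do rewrite addrC.
    by apply: measurableT_comp; [exact: mG|exact: measurable_shift].
  + by apply: borel_nullU; [exact: borel_nullU|exact: borel_null_shift].
  + by move=> x; exact: rho_ge0.
  + move=> x /not_orP[/not_orP[M0x /HM' <-]] /= My.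
    by rewrite -HM' ?(addrC x)// -vecB; exact: sg_ge.
exists C, cls => f g Ff Fg fg; apply: le_trans (Hcls f g Ff Fg fg).
have [_ _ [M nM HM]] := HG f Ff; have [_ _ [M' nM' HM']] := HG g Fg.
apply: (dyadic_norm_le_off c0 p1 pr (borel_nullU nM0 (borel_nullU nM nM'))).
- by move=> x; rewrite lee_fin.
- by move=> x; rewrite lee_fin rho_ge0.
- move=> x /not_orP[M0x /not_orP[/HM <- /HM' <-]].
  by rewrite lee_fin -vecB; exact: sg_le.
Qed.
End gauge_transfer.

(** * Real form of complex matrices and of the weight *)

Section component_norm.
Context (R : realType).
Implicit Types z w : R[i].

Definition cnorm1 z : R := `|complex.Re z| + `|complex.Im z|.

Lemma cnorm1_ge0 z : 0 <= cnorm1 z. Proof. exact: addr_ge0. Qed.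

Lemma cnorm1D z w : cnorm1 (z + w) <= cnorm1 z + cnorm1 w.
Proof. by rewrite /cnorm1 Re_add Im_add addrACA lerD// ler_normD. Qed.

Lemma cnorm1_sum (I : Type) (s : seq I) (F : I -> R[i]) :
  cnorm1 (\sum_(i <- s) F i) <= \sum_(i <- s) cnorm1 (F i).
Proof.
elim/big_rec2: _ => [|i x y _ xy]; first by rewrite /cnorm1 /= normr0 addr0.
by apply: le_trans (cnorm1D _ _) _; rewrite lerD2l.
Qed.

Lemma cnorm1M z w : cnorm1 (z * w) <= cnorm1 z * cnorm1 w.
Proof.
rewrite /cnorm1 Re_mul Im_mul mulrDl !mulrDr -!normrM.
apply: (le_trans (lerD (ler_normB _ _) (ler_normD _ _))).
set a := `|_|; set b := `|_|; set c := `|_|; set e := `|_|; lra.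
Qed.

Lemma cnorm1_le z : cnorm1 z <= 2 * Normc.normc z.
Proof. by rewrite mulr_natl mulr2n lerD// (normc_Re_le, normc_Im_le). Qed.

Lemma cnorm1_eq0 z : cnorm1 z = 0 -> z = 0.
Proof.
case: z => a b /eqP; rewrite /cnorm1 /= paddr_eq0// !normr_eq0.
by move=> /andP[/eqP -> /eqP ->].
Qed.
End component_norm.

Section realification.
Context (R : realType) (k : nat).
Local Notation C := R[i].
Implicit Types (z : 'cV[C]_k) (A : 'M[C]_k).

Definition vec z : 'rV[R]_(k + k) :=
  row_mx (\row_i complex.Re (z i ord0)) (\row_i complex.Im (z i ord0)).

(** The real matrix of [z |-> A *m z] in the coordinates [vec], acting on row vectors
    from the right. *)
Definition realify A : 'M[R]_(k + k) :=
  let a := \matrix_(i, j) complex.Re (A j i) in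
  let b := \matrix_(i, j) complex.Im (A j i) in block_mx a b (- b) a.

Lemma vecB z w : vec (z - w) = vec z - vec w.
Proof.
by rewrite /vec opp_row_mx add_row_mx; congr row_mx; apply/rowP => i;
  rewrite !mxE (Re_sub, Im_sub).
Qed.

Lemma vec_realify A z : vec z *m realify A = vec (A *m z).
Proof.
rewrite /vec /realify mul_row_block; congr row_mx; apply/rowP => j;
  rewrite !mxE ?Re_sum ?Im_sum -big_split; apply: eq_bigr => i _; rewrite !mxE.
  by rewrite Re_mul /= mulrN; congr (_ - _); exact: mulrC.
by rewrite Im_mul /= addrC; congr (_ + _); exact: mulrC.
Qed.

Lemma vec_surj (v : 'rV[R]_(k + k)) : exists z, v = vec z.
Proof.
exists (\col_i Complex (v ord0 (lshift k i)) (v ord0 (rshift k i))).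
rewrite /vec -[LHS]hsubmxK; congr row_mx; apply/rowP => i; by rewrite !mxE.
Qed.

Lemma norm1_vec z : norm1 (vec z) = \sum_i cnorm1 (z i ord0).
Proof.
rewrite /norm1 /vec big_split_ord /= -big_split; apply: eq_bigr => i _ /=.
by rewrite row_mxEl row_mxEr !mxE.
Qed.

Definition mxnorm1 A : R := \sum_i \sum_j cnorm1 (A i j).

Lemma mxnorm1_ge0 A : 0 <= mxnorm1 A.
Proof. by apply: sumr_ge0 => i _; apply: sumr_ge0 => j _; exact: cnorm1_ge0. Qed.

Lemma norm1_vecM A z : norm1 (vec (A *m z)) <= mxnorm1 A * norm1 (vec z).
Proof.
rewrite [leLHS]norm1_vec mulr_suml; apply: ler_sum => i _.
rewrite mxE; apply: (le_trans (cnorm1_sum _ _)).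
rewrite mulr_suml; apply: ler_sum => j _; apply: (le_trans (cnorm1M _ _)).
apply: ler_wpM2l; first exact: cnorm1_ge0.
rewrite norm1_vec (bigD1 j)//= lerDl; apply: sumr_ge0 => l _; exact: cnorm1_ge0.
Qed.

Lemma sqrt_sum_sqr_le (I : finType) (a : I -> R) : (forall i, 0 <= a i) ->
  Num.sqrt (\sum_i a i ^+ 2) <= \sum_i a i.
Proof.
move=> a0; have s0 : 0 <= \sum_i a i by exact: sumr_ge0.
rewrite -[leRHS]ger0_norm// -sqrtr_sqr; apply: ler_wsqrtr.
rewrite [leRHS]expr2 mulr_suml; apply: ler_sum => i _; rewrite expr2.
by apply: ler_wpM2l => //; rewrite (bigD1 i)//= lerDl sumr_ge0.
Qed.

Lemma enorm_ge0 z : 0 <= enorm z. Proof. exact: sqrtr_ge0. Qed.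

Lemma normc_le_enorm z i : Normc.normc (z i ord0) <= enorm z.
Proof.
rewrite -[leLHS]ger0_norm ?normc_ge0// -sqrtr_sqr; apply: ler_wsqrtr.
by rewrite (bigD1 i)//= lerDl; apply: sumr_ge0 => j _; exact: sqr_ge0.
Qed.

Lemma enorm_le z : enorm z <= norm1 (vec z).
Proof.
apply: (le_trans (sqrt_sum_sqr_le (fun i => normc_ge0 (z i ord0)))).
by rewrite norm1_vec; apply: ler_sum => i _; exact: normc_le.
Qed.

Lemma norm1_vec_le z : norm1 (vec z) <= (2 * k)%:R * enorm z.
Proof.
rewrite norm1_vec; apply: (@le_trans _ _ (\sum_(i < k) (2 * enorm z))).
  apply: ler_sum => i _; apply: (le_trans (cnorm1_le _)).
  by apply: ler_wpM2l => //; exact: normc_le_enorm.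
by rewrite sumr_const card_ord -[leLHS]mulr_natl mulrA -natrM mulnC.
Qed.

Context (n : nat).
Local Notation T := 'rV[R]_n.
Variables (A B : T -> 'M[C]_k).
Hypotheses (mA : cmx_measurable A) (mB : cmx_measurable B).
Hypothesis BA : forall x, B x *m A x = 1%:M.

Lemma rho_realify x z : rho (fun x => realify (A x)) x (vec z) = norm1 (vec (A x *m z)).
Proof. by rewrite /rho vec_realify. Qed.

Lemma measurable_realify i j : measurable_fun setT (fun x => realify (A x) i j).
Proof.
rewrite /realify; case: (split_ordP i) => a ->; case: (split_ordP j) => b ->.
- by under eq_fun do rewrite block_mxEul mxE; have [] := mA b a.
- by under eq_fun do rewrite block_mxEur mxE; have [] := mA b a.
- under eq_fun do rewrite block_mxEdl mxE mxE.
  by apply: measurableT_comp => //; have [] := mA b a.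
- by under eq_fun do rewrite block_mxEdr mxE; have [] := mA b a.
Qed.

Lemma measurable_mxnorm1 : measurable_fun setT (fun x => mxnorm1 (B x)).
Proof.
apply: measurable_sum => i; apply: measurable_sum => j; have [m1 m2] := mB i j.
by apply: measurable_funD; apply: measurableT_comp => //; exact: normr_measurable.
Qed.

(** As [norm1 v] is at most [mxnorm1 (B x)] times the seminorm of [v], any function
    below the inverse of [mxnorm1 (B x)] would do; this one is measurable and
    positive for simple reasons, and [s * expR (- s) <= 1]. *)
Definition realify_modulus x : R := expR (- mxnorm1 (B x)).

Lemma realify_modulus_gt0 x : 0 < realify_modulus x.
Proof. exact: expR_gt0. Qed.

Lemma measurable_realify_modulus : measurable_fun setT realify_modulus.
Proof.
apply: (measurableT_comp (@measurable_expR R)).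
by apply: measurableT_comp => //; exact: measurable_mxnorm1.
Qed.

Lemma realify_modulus_le x v :
  realify_modulus x * norm1 v <= rho (fun x => realify (A x)) x v.
Proof.
have [z ->] := vec_surj v; rewrite rho_realify.
rewrite /realify_modulus expRN mulrC ler_pdivrMr ?expR_gt0// mulrC.
have -> : z = B x *m (A x *m z) by rewrite mulmxA BA mul1mx.
rewrite [X in _ <= _ * norm1 (vec (_ *m X))](_ : _ = z); last by rewrite mulmxA BA mul1mx.
apply: (le_trans (norm1_vecM _ _)); apply: ler_wpM2r; first exact: norm1_ge0.
by apply: le_trans (expR_ge1Dx _); rewrite lerDr.
Qed.
End realification.

Section operator_norm.
Context (R : realType) (n : nat).
Local Notation C := R[i].
Implicit Types (A : 'M[C]_n.+1) (z : 'cV[C]_n.+1).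

Lemma enorm_delta (j : 'I_n.+1) : enorm (delta_mx j ord0 : 'cV[C]_n.+1) = 1.
Proof.
rewrite /enorm (bigD1 j)//= big1 ?addr0.
  by rewrite mxE !eqxx /= expr1n expr0n addr0 sqrtr1 expr1n sqrtr1.
by move=> i ij; rewrite mxE (negPf ij) /= expr0n addr0 sqrtr0 expr0n.
Qed.

Lemma enorm_mul_le A z : enorm z = 1 -> enorm (A *m z) <= 2 * mxnorm1 A.
Proof.
move=> z1; apply: (le_trans (enorm_le _)); rewrite norm1_vec mulr_sumr.
apply: ler_sum => i _; rewrite mxE; apply: (le_trans (cnorm1_sum _ _)).
rewrite mulr_sumr; apply: ler_sum => j _; apply: (le_trans (cnorm1M _ _)).
rewrite mulrC; apply: ler_wpM2r; first exact: cnorm1_ge0.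
apply: (le_trans (cnorm1_le _)); rewrite -[leRHS]mulr1; apply: ler_wpM2l => //.
by rewrite -z1; exact: normc_le_enorm.
Qed.

Lemma opnorm_has_sup A : has_sup [set enorm (A *m z) | z in [set z | enorm z = 1]].
Proof.
split; first by exists (enorm (A *m delta_mx ord0 ord0)), (delta_mx ord0 ord0) => //; exact: enorm_delta.
by exists (2 * mxnorm1 A) => _ [z /= z1 <-]; exact: enorm_mul_le.
Qed.

Lemma opnorm_le A : opnorm A <= 2 * mxnorm1 A.
Proof.
apply: ge_sup; first by have [] := opnorm_has_sup A.
by move=> _ [z /= z1 <-]; exact: enorm_mul_le.
Qed.

Lemma entry_le_opnorm A i j : Normc.normc (A i j) <= opnorm A.
Proof.
apply: (@le_trans _ _ (enorm (A *m delta_mx j ord0))).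
  rewrite -colE; apply: le_trans (normc_le_enorm _ i); by rewrite mxE.
apply: ub_le_sup; first by have [] := opnorm_has_sup A.
by exists (delta_mx j ord0) => //; exact: enorm_delta.
Qed.

Lemma opnorm_ge0 A : 0 <= opnorm A.
Proof. exact: le_trans (normc_ge0 _) (entry_le_opnorm A ord0 ord0). Qed.

(** With [opnorm_le], this allows the operator norm, a supremum over a sphere, to be
    replaced by a finite sum of functions of the entries. *)
Lemma mxnorm1_le A : mxnorm1 A <= (2 * n.+1 ^ 2)%:R * opnorm A.
Proof.
apply: (@le_trans _ _ (\sum_(i < n.+1) \sum_(j < n.+1) (2 * opnorm A))).
  apply: ler_sum => i _; apply: ler_sum => j _; apply: (le_trans (cnorm1_le _)).
  by apply: ler_wpM2l => //; exact: entry_le_opnorm.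
rewrite !sumr_const !card_ord -mulrnA -[leLHS]mulr_natl mulrA -natrM.
by rewrite [(_ * 2)%N]mulnC.
Qed.

Lemma mxnorm1_gt0 A : A \in unitmx -> 0 < mxnorm1 A.
Proof.
move=> uA; rewrite lt_def mxnorm1_ge0 andbT; apply/eqP => A0.
have Aij i j : A i j = 0.
  apply: cnorm1_eq0; apply/eqP; move/eqP: A0; rewrite psumr_eq0; last first.
    by move=> l _; apply: sumr_ge0 => ? _; exact: cnorm1_ge0.
  move=> /allP/(_ i (mem_index_enum i))/=; rewrite psumr_eq0; last first.
    by move=> l _; exact: cnorm1_ge0.
  by move=> /allP/(_ j (mem_index_enum j)).
move: uA; rewrite (_ : A = 0) ?unitmxE ?det0 ?unitr0//.
by apply/matrixP => i j; rewrite Aij mxE.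
Qed.

End operator_norm.

Section power_inverse.
Context (R : realType) (n : nat).
Local Notation C := R[i].

(** No eigenvalue of [A] is 0, and the two powers are inverse of each other off 0. *)
Lemma mxpowerN_mul (A : 'M[C]_n) (a : R) : A \is hermsymmx -> A \in unitmx ->
  mxpower A (- a) *m mxpower A a = 1%:M.
Proof.
move=> hA uA; rewrite !mxpowerE; apply: (etrans (esym (fcalc_mul _ _ A))).
have E := det_fcalc id A; rewrite (fcalc_id hA) in E.
have e0 k : complex.Re (spectral_diag A ord0 k) != 0.
  move: uA; rewrite unitmxE E unitfE prodf_seq_neq0 => /allP/(_ k (mem_index_enum k)) /=.
  by rewrite fmorph_eq0.
apply: etrans (fcalc_cst 1 A); apply: eq_fcalc => k.
by rewrite /powR (negPf (e0 k)) -expRD mulNr addNr expR0.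
Qed.
End power_inverse.

Section weight_representative.
Context (R : realType) (n : nat).
Local Notation C := R[i].
Local Notation T := 'rV[R]_n.
Local Notation mu := (lebesgue_rV R n).

Lemma borel_null0 : borel_null (set0 : set T).
Proof. by split; [exact: measurable0|exact: measure0]. Qed.

Lemma hermsymmx1 k : (1%:M : 'M[C]_k) \is hermsymmx.
Proof. by apply/is_hermitianmxP; rewrite expr0 scale1r trmx1 map_mx1. Qed.

(** Where the entries are not given by Borel functions, or [W] is singular, [V] is
    the identity matrix. *)
Lemma weight_representative (W : T -> 'M[C]_n) : matrix_weight W ->
  exists (M : set T) (V : T -> 'M[C]_n),
    [/\ borel_null M, cmx_measurable V,
        (forall x, V x \is hermsymmx /\ V x \in unitmx),
        (forall i j N, (\int[mu]_(x in big_cube N) (cnorm1 (V x i j))%:E < +oo)%E) &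
        forall x, ~ M x -> W x = V x].
Proof.
move=> [Wh /borel_null_of[M1 nM1 HM1] Wl].
have /choice[z Hz] : forall ij : 'I_n * 'I_n, exists z : set T * ((T -> R) * (T -> R)),
    borel_parts (fun x => W x ij.1 ij.2) z.1 z.2.1 z.2.2.
  by move=> ij; have [M [u [v H]]] := loc_integrable_parts (Wl ij.1 ij.2); exists (M, (u, v)).
pose M := M1 `|` \bigcup_ij (z ij).1.
have nM : borel_null M.
  by apply: borel_nullU => //; apply: borel_null_countable => ij; have [] := Hz ij.
have [mM _] := nM.
pose V x := if x \in M then 1%:M else W x.
have WV x : ~ M x -> W x = V x by move=> Mx; rewrite /V memNset.
have Vh x : V x \is hermsymmx.
  rewrite /V; case: ifP => _; first exact: hermsymmx1.
  by have [] := Wh x.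
have Vu x : V x \in unitmx.
  rewrite /V; case: (boolP (x \in M)) => [_|]; first exact: unitmx1.
  rewrite notin_setE => /not_orP[Mx _]; apply: contrapT => Wx.
  by apply: Mx; apply: HM1.
have redefine (g w : T -> R) (e : R) : measurable_fun setT w ->
    (forall x, ~ M x -> g x = w x) ->
    measurable_fun setT (fun x => if x \in M then e else g x).
  move=> mw gw; rewrite (_ : (fun x => _) = fun x => \1_M x * e + \1_(~` M) x * w x).
    apply: measurable_funD; apply: measurable_funM => //; apply: measurable_indic => //.
    exact: measurableC.
  apply/funext => x; rewrite !indicE in_setC; case: (boolP (x \in M)) => /= [_|].
    by rewrite mul1r mul0r addr0.
  by rewrite notin_setE => /gw ->; rewrite mul0r mul1r add0r.
have part i j x : ~ M x -> complex.Re (W x i j) = (z (i, j)).2.1 x /\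
    complex.Im (W x i j) = (z (i, j)).2.2 x.
  move=> /not_orP[_ Mx]; have [_ _ _ H] := Hz (i, j); apply: H => zx.
  by apply: Mx; exists (i, j).
have mV : cmx_measurable V.
  move=> i j; have [_ [mu1 _] [mu2 _] _] := Hz (i, j); split.
    rewrite (_ : (fun x => _) = fun x =>
      if x \in M then complex.Re ((1%:M : 'M[C]_n) i j) else complex.Re (W x i j)).
      by apply: (redefine _ _ _ mu1) => x Mx; have [] := part i j x Mx.
    by apply/funext => x; rewrite /V; case: ifP.
  rewrite (_ : (fun x => _) = fun x =>
    if x \in M then complex.Im ((1%:M : 'M[C]_n) i j) else complex.Im (W x i j)).
    by apply: (redefine _ _ _ mu2) => x Mx; have [] := part i j x Mx.
  by apply/funext => x; rewrite /V; case: ifP.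
exists M, V; split => // i j N.
have [_ [mu1 l1] [mu2 l2] _] := Hz (i, j).
apply: (@le_lt_trans _ _ (\int[mu]_(x in big_cube N) (`|(z (i, j)).2.1 x|%:E + `|(z (i, j)).2.2 x|%:E))%E).
  apply: (le_integral_off nM) => [x _|x _|x Mx Nx].
  - by rewrite lee_fin cnorm1_ge0.
  - by rewrite -EFinD lee_fin addr_ge0.
  split => //; rewrite -WV// /cnorm1; have [-> ->] := part i j x Mx.
  by rewrite EFinD.
rewrite ge0_integralD//; [|exact: measurable_big_cube|exact: measurable_absE|exact: measurable_absE].
by apply: lte_add_pinfty; [exact: l1|exact: l2].
Qed.

Lemma dyadic_sub_big_cube j (k : 'rV[int]_n) : exists N,
  @dyadic_cube R n j k `<=` big_cube N.
Proof.
have [N HN] := compact_big_cube (@compact_closed_box R n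
  (fun i => 2 ^ (- j) * (k ord0 i)%:~R) (fun i => 2 ^ (- j) * (k ord0 i + 1)%:~R)).
by exists N => x Qx; apply: HN => i; have /andP[-> /ltW ->] := Qx i.
Qed.

Lemma vec_representative k (X : T -> 'cV[C]_k) :
  (forall i, loc_integrable (fun x => X x i ord0)) ->
  exists g : T -> 'rV[R]_(k + k), [/\ measurable_fun setT g, cube_integrable g &
    exists2 M, borel_null M & forall x, ~ M x -> vec (X x) = g x].
Proof.
move=> lX.
have /choice[z Hz] : forall i, exists z : set T * ((T -> R) * (T -> R)),
    borel_parts (fun x => X x i ord0) z.1 z.2.1 z.2.2.
  by move=> i; have [M [u [v H]]] := loc_integrable_parts (lX i); exists (M, (u, v)).
pose g x : 'rV[R]_(k + k) := row_mx (\row_i (z i).2.1 x) (\row_i (z i).2.2 x).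
have gi i : measurable_fun setT (fun x => g x ord0 i) /\ box_integrable (fun x => g x ord0 i).
  rewrite /g; case: (split_ordP i) => a ->; have [_ H1 H2 _] := Hz a.
    by under eq_fun do rewrite row_mxEl mxE.
  by under eq_fun do rewrite row_mxEr mxE.
exists g; split.
- by apply: measurable_fun_rV => i; have [] := gi i.
- move=> j l i; have [mg lg] := gi i; have [N HN] := dyadic_sub_big_cube j l.
  apply: (integrableS _ _ HN); [exact: measurable_big_cube|exact: measurable_dyadic|].
  exact: box_integrable_abs.
- exists (\bigcup_i (z i).1); first by apply: borel_null_countable => i; have [] := Hz i.
  move=> x Mx; rewrite /vec /g; congr row_mx; apply/rowP => i; rewrite !mxE;
    have [_ _ _ H] := Hz i; have [|E1 E2] := H x; rewrite ?E1 ?E2//.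
    by move=> zx; apply: Mx; exists i.
  by move=> zx; apply: Mx; exists i.
Qed.
End weight_representative.

(** * The two parts of the Sobolev norm *)

Section net.
Context (R : realType) (n' : nat).
Local Notation n := n'.+1.
Local Notation C := R[i].
Local Notation T := 'rV[R]_n.
Local Notation mu := (lebesgue_rV R n).
Variables (p t : R) (r : \bar R) (W : T -> 'M[C]_n) (F : set (T -> C)).
Hypothesis p1 : 1 <= p.
Hypothesis pr : (p%:E <= r)%E.
Hypothesis hW : matrix_weight W.

Let p0 : 0 < p. Proof. exact: lt_le_trans ltr01 p1. Qed.
Let pn0 : p != 0. Proof. by rewrite gt_eqF. Qed.

Definition cube_coef (jk : int * 'rV[int]_n) : \bar R :=
  ((\int[mu]_(y in dyadic_cube jk.1 jk.2) (opnorm (W y))%:E) `^ (t^-1 - p^-1))%E.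

(** Scalars are seen as column vectors of size 1, so that both parts of the norm fall
    under [gauge_colouring]. *)
Definition scalar_gauge (x : T) (z : 'cV[C]_1) : R :=
  Normc.normc (z ord0 ord0) * opnorm (W x) `^ p^-1.

Definition matrix_gauge (x : T) (z : 'cV[C]_n) : R :=
  enorm (mxpower (W x) p^-1 *m z).

Local Notation N h := (dyadic_norm cube_coef p r (fun x => (h x)%:E)).

Lemma scalar_gauge_ge0 x z : 0 <= scalar_gauge x z.
Proof. by rewrite mulr_ge0 ?normc_ge0 ?powR_ge0. Qed.

Lemma matrix_gauge_ge0 x z : 0 <= matrix_gauge x z.
Proof. exact: enorm_ge0. Qed.

Lemma bm_normE (f : T -> C) : bm_norm (fun x => opnorm (W x)) p t r f =
  N (fun x => scalar_gauge x (const_mx (f x))).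
Proof.
rewrite /bm_norm /dyadic_norm /mixed_norm; congr lr_norm; apply/funext => jk.
congr (_ * _ `^ _)%E; apply: eq_integral => x _.
rewrite poweR_EFin /scalar_gauge mxE powRM ?normc_ge0 ?powR_ge0//.
by rewrite -powRrM mulVf// powRr1// opnorm_ge0.
Qed.

Lemma matrix_bm_normE (g : T -> 'cV[C]_n) :
  matrix_bm_norm W p t r g = N (fun x => matrix_gauge x (g x)).
Proof. by []. Qed.

(** Finite because the entries of the weight are locally integrable, positive because
    it is almost everywhere invertible; hence the coefficients of the norm, powers
    of these integrals, are positive. *)
Lemma weight_cube jk :
  exists2 a : R, 0 < a & (\int[mu]_(y in dyadic_cube jk.1 jk.2) (opnorm (W y))%:E = a%:E)%E.
Proof.
have [M [V [nM mV Vhu lV WV]]] := weight_representative hW.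
have mV1 := measurable_mxnorm1 mV.
set I := (\int[mu]_(y in _) _)%E.
have mQ := @measurable_dyadic R n jk.1 jk.2.
have K0 : 0 < ((2 * n ^ 2)%:R)^-1 :> R by rewrite invr_gt0 ltr0n.
have I0 : (0 < I)%E.
  apply: (@lt_le_trans _ _ (\int[mu]_(y in dyadic_cube jk.1 jk.2)
      (((2 * n ^ 2)%:R)^-1 * mxnorm1 (V y))%:E)%E).
    apply: integral_cube_gt0.
    - by apply/measurable_EFinP; exact: measurable_funM.
    - by move=> x; rewrite lee_fin mulr_ge0 ?mxnorm1_ge0// ltW.
    - by move=> x _; rewrite lte_fin mulr_gt0// mxnorm1_gt0//; have [] := Vhu x.
  apply: (le_integral_off nM) => [x _|x _|x Mx Qx].
  - by rewrite lee_fin mulr_ge0 ?mxnorm1_ge0// ltW.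
  - by rewrite lee_fin opnorm_ge0.
  by split => //; rewrite lee_fin WV// mulrC ler_pdivrMr ?ltr0n// mulrC mxnorm1_le.
have Ioo : (I < +oo)%E.
  have [N HN] := @dyadic_sub_big_cube R n jk.1 jk.2.
  apply: (@le_lt_trans _ _ (\int[mu]_(y in big_cube N)
      (2%:E * \sum_i \sum_j (cnorm1 (V y i j))%:E))%E).
    apply: (le_integral_off nM) => [x _|x _|x Mx /HN Qx].
    - by rewrite lee_fin opnorm_ge0.
    - rewrite mule_ge0// sume_ge0// => i _; apply: sume_ge0 => j _.
      by rewrite lee_fin cnorm1_ge0.
    split => //; rewrite WV//.
    under eq_bigr do rewrite sumEFin.
    by rewrite sumEFin -EFinM lee_fin opnorm_le.
  have mN := @measurable_big_cube R n N.
  have mc i j : measurable_fun (big_cube N) (fun y => (cnorm1 (V y i j))%:E).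
    apply: (@measurable_funS _ _ _ _ setT) => //; apply/measurable_EFinP.
    have [m1 m2] := mV i j.
    by apply: measurable_funD; apply: measurableT_comp => //; exact: normr_measurable.
  have c0 i j y : (0 <= (cnorm1 (V y i j))%:E)%E by rewrite lee_fin cnorm1_ge0.
  rewrite ge0_integralZl//; last 2 first.
  - by apply: emeasurable_sum => i; apply: emeasurable_sum => j; exact: mc.
  - by move=> y _; apply: sume_ge0 => i _; exact: sume_ge0.
  apply: lte_mul_pinfty => //.
  rewrite ge0_integral_sum//; last 2 first.
  - by move=> i; apply: emeasurable_sum => j; exact: mc.
  - by move=> i y _; exact: sume_ge0.
  apply: lte_sum_pinfty => i _; rewrite ge0_integral_sum//.
  by apply: lte_sum_pinfty => j _; exact: lV.
move: I0 Ioo; case: I => // a a0 _; exists a => //.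
Qed.

Lemma cube_coef_gt0 jk : (0 < cube_coef jk)%E.
Proof. by have [a a0 Ea] := weight_cube jk; rewrite /cube_coef Ea poweR_EFin lte_fin powR_gt0. Qed.

Let N0 := cube_coef_gt0.

(** The field of norms is [om x `^ p^-1] times the l^1 norm on the plane, where [om]
    is a multiple of [mxnorm1] comparable to [opnorm]. *)
Lemma scalar_colouring (X : (T -> C) -> T -> 'cV[C]_1) :
  (forall f, F f -> loc_integrable (fun x => X f x ord0 ord0)) ->
  (forall f, F f -> (N (fun x => scalar_gauge x (X f x)) < +oo)%E) ->
  (forall e : R, 0 < e -> exists a : R, forall f, F f ->
    (N (fun x => \1_(far a) x * scalar_gauge x (X f x)) <= e%:E)%E) ->
  (forall e : R, 0 < e -> exists2 a : R, 0 < a & forall f, F f ->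
    forall y : T, (forall i, `|y ord0 i| <= a) ->
    (N (fun x => scalar_gauge x (X f x - X f (x - y)%R)) <= e%:E)%E) ->
  forall e : R, 0 < e ->
  exists (D : finType) (cls : (T -> C) -> D), forall f g, F f -> F g -> cls f = cls g ->
    (N (fun x => scalar_gauge x (X f x - X g x)) <= e%:E)%E.
Proof.
move=> lX fin van equi.
have [M [V [nM mV Vhu lV WV]]] := weight_representative hW.
have mV1 := measurable_mxnorm1 mV.
pose om x := 2 * mxnorm1 (V x).
have om0 x : 0 < om x by rewrite mulr_gt0// mxnorm1_gt0//; have [] := Vhu x.
pose A (s : R) x : 'M[C]_1 := const_mx (real_complex R (om x `^ s)).
have mA s : cmx_measurable (A s).
  move=> i j; split; under eq_fun do rewrite mxE; last exact: measurable_cst.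
  apply: (measurableT_comp (measurable_powR s)); exact: measurable_funM.
have BA x : A (- p^-1) x *m A p^-1 x = 1%:M.
  apply/matrixP => i j; rewrite !mxE big_ord1 !mxE !ord1 eqxx -rmorphM /=.
  by rewrite powRN mulVf ?rmorph1// gt_eqF// powR_gt0.
have AE x z : norm1 (vec (A p^-1 x *m z)) = om x `^ p^-1 * cnorm1 (z ord0 ord0).
  rewrite norm1_vec big_ord1 mxE big_ord1 mxE mulrC /cnorm1 Re_mul_real Im_mul_real.
  by rewrite !normrM [`|_ `^ _|]ger0_norm ?powR_ge0// -mulrDl mulrC.
have pi0 : 0 <= p^-1 by rewrite invr_ge0 ltW.
have pi1 : p^-1 <= 1 by rewrite invf_le1.
apply: (@gauge_colouring R n' (1 + 1) cube_coef p r N0 p1 pr (fun x => realify (A p^-1 x))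
  (realify_modulus (A (- p^-1))) _ _ _ _ 'cV[C]_1 (@vec R 1) scalar_gauge
  (2 * (2 * (2 * n ^ 2))%:R) M _ scalar_gauge_ge0 _ nM) => //.
- exact: measurable_realify.
- exact: measurable_realify_modulus.
- exact: realify_modulus_gt0.
- exact: realify_modulus_le.
- exact: vecB.
- move=> x z Mx; rewrite rho_realify AE /scalar_gauge mulrC; apply: ler_pM.
  + exact: powR_ge0.
  + exact: normc_ge0.
  + apply: ge0_ler_powR => //; [exact: opnorm_ge0|exact: ltW|].
    by rewrite WV//; exact: opnorm_le.
  + exact: normc_le.
- move=> x z Mx; rewrite rho_realify AE /scalar_gauge.
  have h1 : om x `^ p^-1 <= (2 * (2 * n ^ 2))%:R * opnorm (W x) `^ p^-1.
    apply: (@le_trans _ _ (((2 * (2 * n ^ 2))%:R * opnorm (W x)) `^ p^-1)).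
      apply: ge0_ler_powR => //; [exact: ltW|by rewrite nnegrE mulr_ge0 ?opnorm_ge0|].
      by rewrite natrM -mulrA /om ler_wpM2l// WV// mxnorm1_le.
    rewrite powRM ?opnorm_ge0//; apply: ler_wpM2r; first exact: powR_ge0.
    rewrite -[leRHS]powRr1//; apply: ler_powR => //.
    by rewrite ler1n.
  rewrite (_ : 2 * _ * _ = ((2 * (2 * n ^ 2))%:R * opnorm (W x) `^ p^-1) *
    (2 * Normc.normc (z ord0 ord0))); last by ring.
  by apply: ler_pM => //; [exact: powR_ge0|exact: cnorm1_ge0|exact: cnorm1_le].
- by move=> f Ff; apply: vec_representative => i; rewrite ord1; exact: lX.
Qed.

(** The field of norms is given by the real form of [mxpower (V x) p^-1], whose
    inverse [mxpower (V x) (- p^-1)] is Borel for the same reason. *)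
Lemma matrix_colouring (X : (T -> C) -> T -> 'cV[C]_n) :
  (forall f, F f -> forall i, loc_integrable (fun x => X f x i ord0)) ->
  (forall f, F f -> (N (fun x => matrix_gauge x (X f x)) < +oo)%E) ->
  (forall e : R, 0 < e -> exists a : R, forall f, F f ->
    (N (fun x => \1_(far a) x * matrix_gauge x (X f x)) <= e%:E)%E) ->
  (forall e : R, 0 < e -> exists2 a : R, 0 < a & forall f, F f ->
    forall y : T, (forall i, `|y ord0 i| <= a) ->
    (N (fun x => matrix_gauge x (X f x - X f (x - y)%R)) <= e%:E)%E) ->
  forall e : R, 0 < e ->
  exists (D : finType) (cls : (T -> C) -> D), forall f g, F f -> F g -> cls f = cls g ->
    (N (fun x => matrix_gauge x (X f x - X g x)) <= e%:E)%E.
Proof.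
move=> lX fin van equi.
have [M [V [nM mV Vhu lV WV]]] := weight_representative hW.
have Vh x : V x \is hermsymmx by have [] := Vhu x.
pose A (s : R) x : 'M[C]_n := mxpower (V x) s.
have mA s : cmx_measurable (A s) by exact: measurable_mxpower.
have BA x : A (- p^-1) x *m A p^-1 x = 1%:M.
  by apply: mxpowerN_mul; have [] := Vhu x.
apply: (@gauge_colouring R n' (n + n) cube_coef p r N0 p1 pr (fun x => realify (A p^-1 x))
  (realify_modulus (A (- p^-1))) _ _ _ _ 'cV[C]_n (@vec R n) matrix_gauge
  (2 * n)%:R M _ matrix_gauge_ge0 _ nM) => //.
- exact: measurable_realify.
- exact: measurable_realify_modulus.
- exact: realify_modulus_gt0.
- exact: realify_modulus_le.
- exact: vecB.
- by move=> x z Mx; rewrite rho_realify /matrix_gauge WV//; exact: enorm_le.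
- by move=> x z Mx; rewrite rho_realify /matrix_gauge WV//; exact: norm1_vec_le.
- by move=> f Ff; apply: vec_representative; exact: lX.
Qed.
End net.

(** * Total boundedness *)

Section filters.
Context (R : realType).
Local Open Scope ereal_scope.

Lemma nnsup_ge (A : set (\bar R)) x : A x -> x <= nnsup A.
Proof. by move=> Ax; apply: ereal_sup_ubound; left. Qed.

Lemma cvg_to0_le (F : set_system R) (FF : ProperFilter F) (u : R -> \bar R) (e : R) :
  (0 < e)%R -> u a @[a --> F] --> 0 -> \forall a \near F, u a <= e%:E.
Proof.
move=> e0 /fine_cvgP[fu] /cvgrPdist_le /(_ e e0) H.
near=> a; have fa : u a \is a fin_num by near: a; exact: fu.
rewrite -(fineK fa) lee_fin.
have : (`|0 - fine (u a)| <= e)%R by near: a; exact: H.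
by rewrite sub0r normrN; apply: le_trans; exact: ler_norm.
Unshelve. all: by end_near. Qed.

Lemma coord_le_eucl n (x : 'rV[R]_n) i : (`|x ord0 i| <= Num.sqrt (\sum_i x ord0 i ^+ 2))%R.
Proof.
rewrite -sqrtr_sqr; apply: ler_wsqrtr; rewrite (bigD1 i)//= lerDl.
by apply: sumr_ge0 => j _; exact: sqr_ge0.
Qed.

Lemma far_sub_ball n (a : R) : far a `<=` ~` (@eucl_ball R n.+1 a).
Proof.
by move=> x [i ai] /=; apply/negP; rewrite -leNgt (le_trans ai)// coord_le_eucl.
Qed.

Lemma small_eucl_ball n (a : R) : (0 < a)%R -> exists2 b : R, (0 < b)%R &
  forall y : 'rV[R]_n, (forall i, `|y ord0 i| <= b)%R -> eucl_ball a y.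
Proof.
move=> a0; exists (a / n.+1%:R)%R; first by rewrite divr_gt0.
move=> y yb; rewrite /eucl_ball /=.
have -> : (\sum_(i < n) y ord0 i ^+ 2 = \sum_(i < n) `|y ord0 i| ^+ 2)%R.
  by apply: eq_bigr => i _; rewrite real_normK ?num_real.
apply: (le_lt_trans (sqrt_sum_sqr_le (fun i => normr_ge0 (y ord0 i)))).
apply: (@le_lt_trans _ _ (\sum_(i < n) a / n.+1%:R)%R); first exact: ler_sum.
rewrite sumr_const card_ord -[ltLHS]mulr_natr -mulrA gtr_pMr// mulrC ltr_pdivrMr//.
by rewrite mul1r ltr_nat.
Qed.
End filters.

Theorem corollary3p6 (R : realType) (n : nat) (p t : R) (r : \bar R)
  (W : 'rV[R]_n -> 'M[R[i]]_n) (F : set ('rV[R]_n -> R[i]))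
  (n_gt0 : (0 < n)%N)
  (hptr : [/\ 1 <= p, p < t, (t%:E < r)%E & (r < +oo)%E] \/
          [/\ 1 <= p, p <= t & r = +oo%E])
  (hW : matrix_weight W)
  (hF : F `<=` bms_space W p t r)
  (vanish : nnsup [set bms_norm_on (~` eucl_ball a) W p t r f | f in F]
              @[a --> +oo] --> 0%E)
  (equicont : nnsup [set nnsup [set bms_norm W p t r (f - translate y f)
                                 | y in eucl_ball a] | f in F]
                @[a --> 0^'+] --> 0%E) :
  totally_bounded (bms_norm W p t r) (bms_space W p t r) F.
Proof.
case: n n_gt0 W F hW hF vanish equicont => // n _ W F hW hF vanish equicont.
have p1 : 1 <= p by case: hptr => -[].
have pr : (p%:E <= r)%E.
  case: hptr => [[_ pt tr _]|[_ _ ->]]; last by rewrite leey.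
  by rewrite (le_trans _ (ltW tr))// lee_fin ltW.
set bms := bms_norm W p t r.
pose Nm h := dyadic_norm (cube_coef p t W) p r (fun x => EFin (h x)).
have NP := dyadic_norm_quasinorm (cube_coef_gt0 p t hW) p1 pr.
have Nm0 h : (0 <= Nm h)%E by exact: lq_ge0.
have NmE h h' M : borel_null M -> (forall x, 0 <= h x) -> (forall x, 0 <= h' x) ->
    (forall x, ~ M x -> h x <= h' x) -> (Nm h <= Nm h')%E.
  move=> nM h0 h0' hh; apply: (dyadic_norm_le_off (cube_coef_gt0 p t hW) p1 pr nM) => x.
  - by rewrite lee_fin.
  - by rewrite lee_fin.
  - by move=> Mx; rewrite lee_fin hh.
have grad f : (bms f < +oo)%E -> exists G, is_weak_gradient f G.
  by rewrite /bms /bms_norm; case: asboolP.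
have bmsE f : (exists G, is_weak_gradient f G) -> bms f =
    (Nm (fun x => scalar_gauge p W x (const_mx (f x))) +
     Nm (fun x => matrix_gauge p W x (weak_gradient f x)))%E.
  move=> h; rewrite /bms /bms_norm; case: asboolP => [_|/(_ h)//].
  by rewrite bm_normE.
have Fgrad f : F f -> exists G, is_weak_gradient f G by move=> /hF[_ /grad].
have Ffin f : F f -> (bms f < +oo)%E by move=> /hF[].
pose X0 (f : 'rV[R]_n.+1 -> R[i]) x : 'cV[R[i]]_1 := const_mx (f x).
have leL (x y z : \bar R) : (0 <= y -> x + y <= z -> x <= z)%E.
  by move=> y0; apply: le_trans; rewrite leeDl.
have leR (x y z : \bar R) : (0 <= x -> x + y <= z -> y <= z)%E.
  by move=> y0; apply: le_trans; rewrite leeDr.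
have van (e : R) : 0 < e -> exists a : R, forall f, F f ->
    (Nm (fun x : 'rV[R]_n.+1 => \1_(far a) x * scalar_gauge p W x (X0 f x))%R <= e%:E)%E /\
    (Nm (fun x : 'rV[R]_n.+1 => \1_(far a) x * matrix_gauge p W x (weak_gradient f x))%R <= e%:E)%E.
  move=> e0; have := cvg_to0_le _ e0 vanish.
  move=> [a [_ Ha]]; exists (a + 1) => f Ff.
  have H : (bms_norm_on (~` eucl_ball (a + 1)) W p t r f <= e%:E)%E.
    by apply: le_trans (Ha (a + 1) _); [apply: nnsup_ge; exists f|rewrite ltrDl].
  move: H; rewrite /bms_norm_on; case: asboolP => [_|/(_ (Fgrad f Ff))//].
  rewrite (bm_normE t r W p1) matrix_bm_normE => H.
  (* the factor of [bms_norm_on] is 1 on the region [far] *)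
  have far1 x : far (a + 1) x -> (\1_(~` eucl_ball (a + 1)) x : R[i]) = 1.
    by move=> fx; rewrite indicE mem_set//; exact: far_sub_ball.
  split.
    apply: le_trans (leL _ _ _ (Nm0 _) H); apply: (NmE _ _ _ (@borel_null0 R n.+1)) => [x|x|x _].
    - by rewrite mulr_ge0// scalar_gauge_ge0.
    - exact: scalar_gauge_ge0.
    - rewrite indicE; case: (boolP (x \in far (a + 1))) => [/set_mem/far1 ->|_].
        by rewrite !mul1r.
      by rewrite mul0r scalar_gauge_ge0.
  apply: le_trans (leR _ _ _ (Nm0 _) H); apply: (NmE _ _ _ (@borel_null0 R n.+1)) => [x|x|x _].
  - by rewrite mulr_ge0// matrix_gauge_ge0.
  - exact: matrix_gauge_ge0.
  - rewrite indicE; case: (boolP (x \in far (a + 1))) => [/set_mem/far1 ->|_].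
      by rewrite mul1r scale1r.
    by rewrite mul0r matrix_gauge_ge0.
have equi (e : R) : 0 < e -> exists2 a : R, 0 < a & forall f, F f ->
    forall y : 'rV[R]_n.+1, (forall i, `|y ord0 i| <= a) ->
    (Nm (fun x => scalar_gauge p W x (X0 f x - X0 f (x - y))%R) <= e%:E)%E /\
    (Nm (fun x => matrix_gauge p W x (weak_gradient f x - weak_gradient f (x - y))%R)
      <= e%:E)%E.
  move=> e0.
  have [a a0 Ha] : exists2 a : R, 0 < a & (nnsup [set nnsup [set bms (f - translate y f)%R
      | y in eucl_ball a] | f in F] <= e%:E)%E.
    have H := cvg_to0_le _ e0 equicont.
    near (0 : R)^'+ => a; exists a; last by near: a; exact: H.
    by near: a; exact: nbhs_right_gt.
  (* the euclidean ball contains a cube around the origin *)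
  have [b b0 Hb] := @small_eucl_ball R n.+1 a a0.
  exists b => // f Ff y /Hb yb.
  have H : (bms (f - translate y f)%R <= e%:E)%E.
    apply: le_trans Ha; apply: (@le_trans _ _ (nnsup [set bms (f - translate y f)%R
      | y in eucl_ball a])); first by apply: nnsup_ge; exists y.
    by apply: nnsup_ge; exists f.
  have [ex [M nM HM]] := weak_gradient_sub_translateE y (Fgrad f Ff).
  rewrite bmsE// in H; split.
    apply: le_trans (leL _ _ _ (Nm0 _) H); apply: (NmE _ _ _ (@borel_null0 R n.+1)) => [x|x|x _].
    - exact: scalar_gauge_ge0.
    - exact: scalar_gauge_ge0.
    - rewrite (_ : X0 f x - X0 f (x - y) = const_mx ((f - translate y f) x))//.
      by apply/matrixP => i j; rewrite !mxE.
  apply: le_trans (leR _ _ _ (Nm0 _) H); apply: (NmE _ _ _ nM) => [x|x|x Mx].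
  - exact: matrix_gauge_ge0.
  - exact: matrix_gauge_ge0.
  - by rewrite HM.
move=> e e0; have e40 : 0 < e / 4 by rewrite divr_gt0.
have [||||D [cls Hcls]] := @scalar_colouring R n p t r W F p1 pr hW X0 _ _ _ _ (e / 4) e40.
- move=> f /Fgrad[G [lf _]].
  by rewrite (_ : (fun x => _) = f)//; apply/funext => x; rewrite mxE.
- move=> f Ff; have := Ffin f Ff; rewrite bmsE; last exact: Fgrad.
  by apply: le_lt_trans; rewrite leeDl.
- by move=> u u0; have [a Ha] := van u u0; exists a => f Ff; exact: (Ha f Ff).1.
- by move=> u u0; have [a a0 Ha] := equi u u0; exists a => // f Ff y yb; exact: (Ha f Ff y yb).1.
have [||||D' [cls' Hcls']] := @matrix_colouring R n p t r W F p1 pr hW (@weak_gradient R n.+1) _ _ _ _ (e / 4) e40.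
- by move=> f /Fgrad/weak_gradientP[_ H] i; have [] := H i.
- move=> f Ff; have := Ffin f Ff; rewrite bmsE; last exact: Fgrad.
  by apply: le_lt_trans; rewrite leeDr.
- by move=> u u0; have [a Ha] := van u u0; exists a => f Ff; exact: (Ha f Ff).2.
- by move=> u u0; have [a a0 Ha] := equi u u0; exists a => // f Ff y yb; exact: (Ha f Ff y yb).2.
(* one member of the family for each pair of colours that occurs *)
have /choice[rep Hrep] : forall c : D * D', exists g : 'rV[R]_n.+1 -> R[i],
    forall f, F f -> (cls f, cls' f) = c -> F g /\ (cls g, cls' g) = c.
  move=> c; have [[g Hg]|nex] := pselect (exists g, F g /\ (cls g, cls' g) = c).
    by exists g.
  by exists 0 => f Ff fc; exfalso; apply: nex; exists f.
exists ((rep @` [set: D * D']) `&` F); split.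
- by apply: finite_setIl; apply: finite_image.
- by move=> f [_ /hF].
move=> f Ff; have [Fg] := Hrep (cls f, cls' f) f Ff erefl.
set g := rep _ in Fg * => -[gc gc'].
exists g; first by split=> //; exists (cls f, cls' f).
have [ex [M nM HM]] := weak_gradient_subE (Fgrad f Ff) (Fgrad g Fg).
rewrite bmsE//.
apply: (@le_lt_trans _ _ ((e / 4)%:E + (e / 4)%:E)%E); last first.
  by rewrite -EFinD lte_fin; lra.
apply: leeD.
  apply: le_trans (Hcls f g Ff Fg (esym gc)).
  apply: (NmE _ _ _ (@borel_null0 R n.+1)) => [x|x|x _].
  - exact: scalar_gauge_ge0.
  - exact: scalar_gauge_ge0.
  - rewrite (_ : X0 f x - X0 g x = const_mx ((f - g) x))//.
    by apply/matrixP => i j; rewrite !mxE.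
apply: le_trans (Hcls' f g Ff Fg (esym gc')).
apply: (NmE _ _ _ nM) => [x|x|x Mx].
- exact: matrix_gauge_ge0.
- exact: matrix_gauge_ge0.
- by rewrite HM.
Unshelve. all: by end_near.
Qed.
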